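(* Let $d\ge1$ and let $W:\mathbb{R}^d\to\mathbb{R}\cup\{+\infty\}$ be lower semicontinuous, bounded from below by a finite constant, locally integrable and symmetric ($W(-x)=W(x)$ for all $x$). Suppose that $W_\infty:=\lim_{|x|\to\infty}W(x)$ exists in $\mathbb{R}\cup\{+\infty\}$, that there is $R_W>0$ such that $W$ is radially strictly increasing on $\mathbb{R}^d\setminus B_{R_W}$, and that $W$ is unstable. Suppose also that $W$ is $\beta$-repulsive for some $0<\beta<d$ and that $\Delta^0W\le C_W$ on $\mathbb{R}^d$ for some $C_W>0$. Then there is a constant $C'>0$, depending only on $W$, such that every minimiser $\rho\in\mathcal{P}(\mathbb{R}^d)$ of the continuum interaction energy $E$ satisfies $\rho\in\mathcal{M}_p(\mathbb{R}^d)$ with $p=d/(d-\beta)$ and $\|\rho\|_{\mathcal{M}_p(\mathbb{R}^d)}\le 2^\beta C'$.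
   Context: $B_R(z)$ is the open ball of radius $R$ and centre $z$, $B_R:=B_R(0)$. $\mathcal{P}(\mathbb{R}^d)$ is the set of Borel probability measures. ''Radially strictly increasing on $\mathbb{R}^d\setminus B_{R_W}$'' means $W(x)<W(y)$ whenever $R_W\le|x|<|y|$. $E(\rho)=\frac12\int\int W(x-y)\,d\rho(x)\,d\rho(y)\in\mathbb{R}\cup\{+\infty\}$ for $\rho\in\mathcal{P}(\mathbb{R}^d)$; a minimiser is a global minimiser on $\mathcal{P}(\mathbb{R}^d)$. $W$ is unstable if there is $\rho\in\mathcal{P}(\mathbb{R}^d)$ with $E(\rho)<\frac12W_\infty$. Generalised Laplacian: $\Delta^\varepsilon W(x)=\frac{2(d+2)}{\varepsilon^2}\left(\frac{1}{|B_\varepsilon|}\int_{B_\varepsilon}W(x+y)\,dy-W(x)\right)$ for $\varepsilon>0$ (equal to $-\infty$ if $W(x)=+\infty$), and $\Delta^0W(x)=\liminf_{\varepsilon\to0}\Delta^\varepsilon W(x)\in[-\infty,+\infty]$. $W$ is $\beta$-repulsive if it is locally integrable and there exist $\delta>0$, $C>0$ with $-\Delta^0W(x)\ge C|x|^{-\beta}$ for all $0<|x|<\delta$ and $-\Delta^0W(0)=+\infty$. Morrey spaces: for $p\in[1,\infty]$ with Hölder dual $q$ ($1/p+1/q=1$), a finite signed Borel measure $\rho$ belongs to $\mathcal{M}_p(\mathbb{R}^d)$ if there is $M>0$ with $|\rho|(B_r(x))\le Mr^{d/q}$ for all $r>0$, $x\in\mathbb{R}^d$, where $|\rho|$ is the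 total variation; $\|\rho\|_{\mathcal{M}_p(\mathbb{R}^d)}=\sup_{r>0,\,x\in\mathbb{R}^d}r^{-d/q}|\rho|(B_r(x))$. (For $p=d/(d-\beta)$ one has $d/q=\beta$.) *)

(* Defs.v *)
From HB Require Import structures.
From mathcomp Require Import all_boot all_order all_algebra.
From mathcomp Require Import all_classical all_reals all_analysis.
From mathcomp Require Import measurable_realfun.

Set Implicit Arguments.
Unset Strict Implicit.
Unset Printing Implicit Defensive.

Import Order.TTheory GRing.Theory Num.Def Num.Theory.
Import numFieldTopology.Exports numFieldNormedType.Exports.

Local Open Scope classical_set_scope.
Local Open Scope ring_scope.

(* R^d is 'rV[R]_d.  The library norm `|x| and the balls [ball x e] on matrices
   are those of the sup norm; they induce the usual topology, but they are not
   the Euclidean ones, which are [enorm] and [eball] below. *)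

(* The Borel sigma-algebra, generated by the open sets. *)
HB.instance Definition _ (R : realType) (m n : nat) :=
  Measurable.copy 'M[R]_(m, n) (g_sigma_algebraType (@open 'M[R]_(m, n))).

Section lebesgue_measure_rV.
Context {R : realType}.

Lemma open_measurable_mx m n (U : set 'M[R]_(m, n)) : open U -> measurable U.
Proof. by move=> oU; apply: sub_sigma_algebra. Qed.

Lemma coord_measurable_mx m n i j :
  measurable_fun setT (fun M : 'M[R]_(m, n) => M i j : measurableTypeR R).
Proof.
apply: (measurability _ (@RGenOpens.measurableE R)) => _ [_ [a [b ->]] <-].
rewrite setTI; apply: open_measurable_mx.
by apply: open_comp => [M _|]; [exact: coord_continuous|exact: interval_open].
Qed.

Lemma open_mx_bigcup_ball m n (U : set 'M[R]_(m, n)) : open U ->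
  U = \bigcup_(qk in [set qk : 'M[rat]_(m, n) * nat |
        ball (map_mx ratr qk.1 : 'M[R]_(m, n)) qk.2.+1%:R^-1 `<=` U])
      ball (map_mx ratr qk.1 : 'M[R]_(m, n)) qk.2.+1%:R^-1.
Proof.
move=> oU; apply/seteqP; split=> [M UM|M [qk /= + qkM]]; last exact.
have /nbhs_ballP[e /= e0 eU] : nbhs M U by apply: open_nbhs_nbhs.
have [k ke] : exists k, k.+1%:R^-1 < e / 2.
  have e20 : 0 < e / 2 by rewrite divr_gt0.
  have [N _ /(_ N (leqnn N))] := near_infty_natSinv_lt (PosNum e20).
  by exists N.
have k0 : 0 < k.+1%:R^-1 :> R by rewrite invr_gt0.
have /(_ _ _)/cid qP i j : exists q : rat, ball (ratr q : R) k.+1%:R^-1 (M i j).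
  have [|q] := @rat_in_itvoo R (M i j - k.+1%:R^-1) (M i j + k.+1%:R^-1).
    by rewrite ltrD2l gt0_cp.
  rewrite in_itv/= => /andP[q1 q2]; exists q.
  by rewrite /ball/= ltr_distlC; apply/andP; split; rewrite ?ltrBlDr// -ltrBlDr.
pose q : 'M[rat]_(m, n) := \matrix_(i, j) sval (qP i j).
have qM : ball (map_mx ratr q : 'M[R]_(m, n)) k.+1%:R^-1 M.
  by split=> // i j; rewrite !mxE; exact: (svalP (qP i j)).
exists (q, k) => //= N qN; apply: eU; rewrite (splitr e).
apply: (@ball_triangle _ _ (map_mx ratr q : 'M[R]_(m, n))).
  by apply: ball_sym; apply: le_ball qM; exact: ltW.
by apply: le_ball qN; exact: ltW.
Qed.

Lemma measurable_fun_mx d (T : measurableType d) m n (f : T -> 'M[R]_(m, n)) :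
  (forall i j, measurable_fun setT (fun t => f t i j : measurableTypeR R)) ->
  measurable_fun setT f.
Proof.
move=> mf; apply: (measurability (@open 'M[R]_(m, n)) erefl) => _ [U oU <-].
rewrite setTI (open_mx_bigcup_ball oU) preimage_bigcup.
rewrite bigcup_mkcond; apply: countable_bigcupT_measurable => // qk.
case: ifP => // _.
have -> : f @^-1` ball (map_mx ratr qk.1 : 'M[R]_(m, n)) qk.2.+1%:R^-1 =
    \bigcap_(i in [set: 'I_m]) \bigcap_(j in [set: 'I_n])
      (fun t => f t i j) @^-1` ball (ratr (qk.1 i j) : R) qk.2.+1%:R^-1.
  apply/seteqP; split=> t /=.
    by move=> [_ ft] i _ j _; move: (ft i j); rewrite mxE.
  move=> ft; split=> [|i j]; first by rewrite invr_gt0.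
  by rewrite mxE; exact: ft.
apply: fin_bigcap_measurable => // i _; apply: fin_bigcap_measurable => // j _.
rewrite -[X in measurable X]setTI; apply: mf => //; exact: measurable_ball.
Qed.

Definition rV_cons n (p : measurableTypeR R * 'rV[R]_n) : 'rV[R]_n.+1 :=
  row_mx (const_mx p.1 : 'rV[R]_1) p.2.

Definition rV_uncons n (x : 'rV[R]_n.+1) : measurableTypeR R * 'rV[R]_n :=
  (x 0 0, \row_j x 0 (lift ord0 j)).

Lemma rV_cons0 n p : @rV_cons n p 0 0 = p.1.
Proof.
have e0 : (0 : 'I_n.+1) = lshift n (0 : 'I_1) by apply/val_inj.
by rewrite [X in rV_cons _ _ X]e0 [LHS]row_mxEl mxE.
Qed.

Lemma rV_consS n p j : @rV_cons n p 0 (lift ord0 j) = p.2 0 j.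
Proof.
have -> : lift ord0 j = rshift 1 j by apply/val_inj.
by rewrite [LHS]row_mxEr.
Qed.

Lemma rV_consK n : cancel (@rV_cons n) (@rV_uncons n).
Proof.
move=> [a x]; rewrite /rV_uncons rV_cons0; congr pair.
by apply/rowP => j; rewrite mxE rV_consS.
Qed.

Lemma measurable_rV_cons n : measurable_fun setT (@rV_cons n).
Proof.
apply: measurable_fun_mx => i j; rewrite (ord1 i).
have [k ->|->] := unliftP ord0 j.
  under eq_fun do rewrite rV_consS.
  apply: (measurableT_comp (coord_measurable_mx 0 k)); exact: measurable_snd.
by under eq_fun do rewrite rV_cons0; exact: measurable_fst.
Qed.

Lemma measurable_rV_uncons n : measurable_fun setT (@rV_uncons n).
Proof.
apply: measurable_fun_pair; first exact: coord_measurable_mx.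
apply: measurable_fun_mx => i j; under eq_fun do rewrite mxE.
exact: coord_measurable_mx.
Qed.

Section lebesgue_step.
Context n (mu : {sigma_finite_measure set 'rV[R]_n -> \bar R}).

Definition lebesgue_step : set 'rV[R]_n.+1 -> \bar R :=
  pushforward (@lebesgue_measure R \x mu)%E (@rV_cons n).

Let lebesgue_step0 : lebesgue_step set0 = 0%E.
Proof. by rewrite /lebesgue_step /pushforward preimage_set0 measure0. Qed.

Let lebesgue_step_ge0 A : (0 <= lebesgue_step A)%E.
Proof. by rewrite /lebesgue_step /pushforward measure_ge0. Qed.

Let lebesgue_step_sigma_additive : semi_sigma_additive lebesgue_step.
Proof.
have mcons A : measurable A -> measurable (@rV_cons n @^-1` A).
  by move=> mA; rewrite -[X in measurable X]setTI; exact: measurable_rV_cons.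
move=> F mF tF mUF; rewrite /lebesgue_step /pushforward preimage_bigcup.
apply: measure_semi_sigma_additive.
- by move=> k; exact: mcons.
- apply/trivIsetP => /= i j _ _ ij; rewrite -preimage_setI.
  by move/trivIsetP : tF => /(_ _ _ _ _ ij) ->//; rewrite preimage_set0.
- by rewrite -preimage_bigcup; exact: mcons.
Qed.

HB.instance Definition _ := isMeasure.Build _ _ _ lebesgue_step
  lebesgue_step0 lebesgue_step_ge0 lebesgue_step_sigma_additive.

Let lebesgue_step_sigma_finite : sigma_finite setT lebesgue_step.
Proof.
have /sigma_finiteP[F [TF ndF Foo]] := sigma_finiteT (@lebesgue_measure R).
have /sigma_finiteP[G [TG ndG Goo]] := sigma_finiteT mu.
exists (fun k => @rV_uncons n @^-1` (F k `*` G k)).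
  apply/esym/seteqP; split=> // x _.
  have [i _ Fi] : (\bigcup_i F i) (rV_uncons x).1 by rewrite -TF.
  have [j _ Gj] : (\bigcup_i G i) (rV_uncons x).2 by rewrite -TG.
  exists (maxn i j) => //; split.
    by move: Fi; apply/subsetPset/ndF/leq_maxl.
  by move: Gj; apply/subsetPset/ndG/leq_maxr.
move=> k; have [mF Fk] := Foo k; have [mG Gk] := Goo k.
have mFG : measurable (F k `*` G k) by exact: measurableX.
split; first by rewrite -[X in measurable X]setTI; exact: measurable_rV_uncons.
rewrite /lebesgue_step /pushforward -comp_preimage (_ : _ \o _ = id); last first.
  by apply/funext => p; exact: rV_consK.
by rewrite product_measure1E// lte_mul_pinfty// ge0_fin_numE.
Qed.

HB.instance Definition _ := Measure_isSigmaFinite.Build _ _ _ lebesgue_step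
  lebesgue_step_sigma_finite.

End lebesgue_step.

(* The d-dimensional Lebesgue measure, as the image of the iterated product of
   [lebesgue_measure] on R; see [lebesgue_rV_box]. *)
Fixpoint lebesgue_rV n : {sigma_finite_measure set 'rV[R]_n -> \bar R} :=
  match n with
  | 0 => \d_(0 : 'rV[R]_0)
  | n'.+1 => lebesgue_step (lebesgue_rV n')
  end.

Lemma lebesgue_rV_box n (A : 'I_n -> set R) : (forall i, measurable (A i)) ->
  lebesgue_rV n [set x | forall i, A i (x 0 i)] =
  (\prod_(i < n) lebesgue_measure (A i))%E.
Proof.
elim: n A => [|n IH] A mA.
  by rewrite big_ord0 /= diracE mem_set// => -[].
have mB : measurable [set x : 'rV[R]_n | forall i, A (lift ord0 i) (x 0 i)].
  have -> : [set x : 'rV[R]_n | forall i, A (lift ord0 i) (x 0 i)] =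
    \bigcap_(i in [set: 'I_n]) (fun x : 'rV[R]_n => x 0 i) @^-1` A (lift ord0 i).
    by apply/seteqP; split=> x /= Ax i; [move=> _; exact: Ax|exact: Ax].
  apply: fin_bigcap_measurable => // i _; rewrite -[X in measurable X]setTI.
  by apply: (coord_measurable_mx 0 i) => //; exact: mA.
rewrite big_ord_recl -(IH (A \o lift ord0)); last by move=> i; exact: mA.
rewrite -[RHS](product_measure1E lebesgue_measure (lebesgue_rV n) (mA ord0) mB).
rewrite [LHS]/= /lebesgue_step /pushforward.
congr (product_measure1 _ _ _); apply/seteqP; split=> [p /= Ap|p [/= A0 AS] i].
  by split=> /= [|i]; rewrite -(rV_cons0 p, rV_consS p).
have [k ->|->] := unliftP ord0 i; first by rewrite rV_consS.
by rewrite rV_cons0.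
Qed.

End lebesgue_measure_rV.

Section euclidean_norm.
Context {R : realType} {d : nat}.
Implicit Types x : 'rV[R]_d.

Definition enorm x : R := Num.sqrt (\sum_(i < d) x 0 i ^+ 2).

Definition eball x (r : R) : set 'rV[R]_d := [set y | enorm (y - x) < r].

(* The filter of "|x| tends to infinity". *)
Definition at_infinity : set_system 'rV[R]_d :=
  filter_from [set: R] (fun M => [set x | M < enorm x]).

Global Instance at_infinity_filter : Filter at_infinity.
Proof.
apply: filter_from_filter; first by exists 0.
move=> M N _ _; exists (maxr M N) => // x /=.
by rewrite gt_max => /andP[].
Qed.

End euclidean_norm.

Section potential.
Context {R : realType} {d : nat}.
Implicit Types (W : 'rV[R]_d -> \bar R) (rho : probability 'rV[R]_d R).
Local Open Scope ereal_scope.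

Definition locally_integrable_rV W :=
  forall K : set 'rV[R]_d, compact K -> (lebesgue_rV d).-integrable K W.

(* Meaningful when [cvg (W @ at_infinity)]. *)
Definition Winfty W : \bar R := lim (W @ at_infinity).

Definition radially_strictly_increasing W (RW : R) :=
  forall x y, (RW <= enorm x)%R -> (enorm x < enorm y)%R -> W x < W y.

Definition energy W rho : \bar R :=
  2^-1%:E * \int[rho]_x \int[rho]_y W (x - y)%R.

Definition is_minimiser W rho := forall mu, energy W rho <= energy W mu.

Definition unstable W := exists rho, energy W rho < 2^-1%:E * Winfty W.

Definition gen_laplacian (e : R) W (x : 'rV[R]_d) : \bar R :=
  if W x == +oo then -oo else
  ((2 * (d + 2))%:R / e ^+ 2)%:E *
  ((lebesgue_rV d (eball 0 e))^-1 *
     \int[lebesgue_rV d]_(y in eball 0 e) W (x + y)%R - W x).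

Definition gen_laplacian0 W (x : 'rV[R]_d) : \bar R :=
  limf_einf (fun e : R => gen_laplacian e W x) 0^'+.

Definition repulsive (beta : R) W :=
  locally_integrable_rV W /\
  exists delta C : R, [/\ (0 < delta)%R, (0 < C)%R,
    forall x, (0 < enorm x < delta)%R ->
      (C * enorm x `^ (- beta))%:E <= - gen_laplacian0 W x &
    - gen_laplacian0 W 0 = +oo].

End potential.

Section charge_total_variation.
Context d (T : measurableType d) (R : realType).
Implicit Types nu : {charge set T -> \bar R}.

Definition charge_total_variation nu : set T -> \bar R :=
  charge_variation (svalP (cid (svalP (cid (Hahn_decomposition nu))))).

End charge_total_variation.

Section morrey.
Context {R : realType} {d : nat}.
Implicit Types (p : \bar R) (nu : {charge set 'rV[R]_d -> \bar R}).
Local Open Scope ereal_scope.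

(* d / q for q the Hoelder conjugate of p in [1, +oo]; it is 0 for p = 1, since
   then q = +oo and q^-1 = 0. *)
Definition morrey_exponent p : R := (d%:R * fine (hoelder_conjugate p)^-1)%R.

Definition morrey p nu := exists2 M : R, (0 < M)%R &
  forall (r : R) (x : 'rV[R]_d), (0 < r)%R ->
    charge_total_variation nu (eball x r) <= (M * r `^ morrey_exponent p)%:E.

Definition morrey_norm p nu : \bar R :=
  ereal_sup [set z | exists (r : R) (x : 'rV[R]_d), (0 < r)%R /\
    z = (r `^ (- morrey_exponent p))%:E * charge_total_variation nu (eball x r)].

End morrey.

(* Main.v *)
(* Write psi = W * rho (W shifted to be nonnegative), and e for its rho-mean.
   First variation gives psi >= e almost everywhere for Lebesgue measure and
   psi <= e at rho-almost every point, hence e <= P_t psi everywhere for the heat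
   semigroup P_t.  If a continuous function a of quadratic type dominates
   Delta^0 W, then P_t W <= W + lambda t (a + 2 eta) for small t: a Lipschitz
   minorant of W flows below the right-hand side, since a negative minimum of the
   (penalised) difference in space-time would make Delta^0 W exceed a at that
   point.  At a point x with psi(x) <= e, convolving with rho yields
   0 <= int (a + 2 eta)(x - y) drho(y).  As -Delta^0 W(y) >= C |y|^-beta near 0,
   one may take a = min(CW, B |y|^2 - A) with A = C (2r)^-beta, which is close to
   -A on B_r; so rho(B_r(x)) A is bounded by a multiple of CW, i.e.
   rho(B_r(x)) <= C' r^beta.  An arbitrary ball that is not rho-null contains such
   a point x, and is contained in B_2r(x), which costs the factor 2^beta. *)
Require Import Defs.
From HB Require Import structures.
From mathcomp Require Import all_boot all_order all_algebra.
From mathcomp Require Import all_fingroup.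
From mathcomp Require Import all_classical all_reals all_analysis.
From mathcomp Require Import measurable_realfun ring lra.

Set Implicit Arguments.
Unset Strict Implicit.
Unset Printing Implicit Defensive.

Import Order.TTheory GRing.Theory Num.Def Num.Theory.
Import numFieldTopology.Exports numFieldNormedType.Exports.

Local Open Scope classical_set_scope.
Local Open Scope ring_scope.

(** * Lebesgue measure under affine maps *)

(** Delta^0 W is only a liminf of ball averages, and W may be discontinuous or infinite, so neither
    W nor its flow is ever differentiated. The heat equation enters through one explicit kernel
    inequality: a ball average of radius s plus a step back in time by sigma s^2 / 2 is at least
    twice the value, up to O(s^4), where sigma is the variance of one coordinate on the unit ball.
    At a space-time minimum this becomes a lower bound on the ball average of W, hence on its
    discrete Laplacian. The same comparison produces ball averages of a, so these may exceed a by at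
    most O(s^2). This is why a is the minimum of a constant and a quadratic: truncation keeps that
    bound. The resulting error carries a factor t, and eta absorbs it once t is small. The heat
    semigroup serves to pass from almost every point to every point, since an integral against its
    kernel ignores Lebesgue-null sets. Integrals of signed functions are avoided throughout, by
    adding constants and moving terms across inequalities. *)

Section affine_invariance.
Context {R : realType}.

(** Half-open intervals determine Lebesgue measure, and [m_] has the right values on them. A
    negative c moves the closed end to the left, hence the two cases. *)
Lemma lebesgue_measure_affine (c b : R) (A : set (measurableTypeR R)) :
  c != 0 -> measurable A ->
  lebesgue_measure ((fun x : R => c * x + b) @^-1` A) =
  (`|c|^-1%:E * lebesgue_measure A)%E.
Proof.
move=> c0 mA.
have mf : measurable_fun [set: measurableTypeR R]
    (fun x : R => c * x + b : measurableTypeR R).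
  by apply: measurable_funD => //; exact: measurable_funM.
pose m_ : {measure set (measurableTypeR R) -> \bar R} :=
  mscale (NngNum (normr_ge0 c)) (pushforward (@lebesgue_measure R)
    (fun x : measurableTypeR R => c * x + b : measurableTypeR R)).
have mE X : m_ mf X =
    (`|c|%:E * lebesgue_measure ((fun x : R => c * x + b)%R @^-1` X))%E by [].
have key : lebesgue_measure A = m_ mf A.
  apply: lebesgue_measure_unique => // _ [[a a'] _ <-].
  rewrite mE lebesgue_measure_itv/= lte_fin.
  have [c_lt0|c_gt0] : c < 0 \/ 0 < c by case: (ltgtP c 0) c0 => //; [left|right].
    have -> : (fun x : R => c * x + b) @^-1` `]a, a'] =
        `[(a' - b) / c, (a - b) / c[%classic.
      apply/seteqP; split => x /=; rewrite !in_itv/= => /andP[h1 h2]; apply/andP.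
        by rewrite ler_ndivrMr// ltr_ndivlMr//; split; lra.
      by move: h1 h2; rewrite ler_ndivrMr// ltr_ndivlMr// => h1 h2; split; lra.
    rewrite lebesgue_measure_itv/= lte_fin ltr_nM2r ?invr_lt0//.
    rewrite ltr0_norm// ltrD2r.
    case: ifPn => [_|_]; last by rewrite mule0.
    by rewrite -!EFinD -EFinM; congr EFin; field.
  have -> : (fun x : R => c * x + b) @^-1` `]a, a'] =
      `](a - b) / c, (a' - b) / c]%classic.
    apply/seteqP; split => x /=; rewrite !in_itv/= => /andP[h1 h2]; apply/andP.
      by rewrite ler_pdivlMr// ltr_pdivrMr//; split; lra.
    by move: h1 h2; rewrite ler_pdivlMr// ltr_pdivrMr// => h1 h2; split; lra.
  rewrite lebesgue_measure_itv/= lte_fin ltr_pM2r ?invr_gt0//.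
  rewrite gtr0_norm// ltrD2r.
  case: ifPn => [_|_]; last by rewrite mule0.
  by rewrite -!EFinD -EFinM; congr EFin; field.
rewrite key mE muleA -EFinM mulVf ?mul1e//.
by rewrite normr_eq0.
Qed.

Lemma norm_coord_le m n (x : 'M[R]_(m, n)) i j : `|x i j| <= `|x|.
Proof.
rewrite [leRHS]/Num.norm/= mx_normrE.
by apply: (le_trans _ (le_bigmax _ (fun k : 'I_m * 'I_n => `|x k.1 k.2|) (i, j))).
Qed.

Definition box n (A : 'I_n -> set R) : set 'rV[R]_n :=
  [set x | forall i, A i (x 0 i)].

Lemma measurable_box n (A : 'I_n -> set R) :
  (forall i, measurable (A i)) -> measurable (box A).
Proof.
move=> mA; rewrite (_ : box A =
    \bigcap_(i in [set: 'I_n]) (fun x : 'rV[R]_n => x 0 i) @^-1` A i); last first.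
  by apply/seteqP; split=> x /= Ax i; [move=> _; exact: Ax|exact: Ax].
apply: fin_bigcap_measurable => // i _; rewrite -[X in measurable X]setTI.
by apply: (coord_measurable_mx 0 i) => //; exact: mA.
Qed.

Lemma lebesgue_rV_boxE n (A : 'I_n -> set R) : (forall i, measurable (A i)) ->
  lebesgue_rV n (box A) = (\prod_(i < n) lebesgue_measure (A i))%E.
Proof. exact: lebesgue_rV_box. Qed.

(** An open set is a countable union of sup-norm balls with rational data, and each such ball is a
    box. *)
Lemma measurable_rV_boxes n :
  @measurable _ 'rV[R]_n =
  <<s [set box A | A in [set A : 'I_n -> set R | forall i, measurable (A i)]] >>.
Proof.
apply/seteqP; split; last first.
  apply: smallest_sub; first exact: sigma_algebra_measurable.
  by move=> _ [A mA <-]; exact: measurable_box.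
apply: smallest_sub; first exact: smallest_sigma_algebra.
move=> U oU; rewrite (open_mx_bigcup_ball oU) bigcup_mkcond.
set G := [set box A | A in _].
have := @countable_bigcupT_measurable _ (g_sigma_algebraType G)
  ('M[rat]_(1, n) * nat)%type; apply => // -[q k].
case: ifPn => _; last exact: (@measurable0 _ (g_sigma_algebraType G)).
apply: sub_sigma_algebra.
exists (fun i => ball (ratr (q 0 i) : R) k.+1%:R^-1); first by move=> i; exact: measurable_ball.
apply/seteqP; split => x /=.
  by move=> qx; split=> [|i j]; [rewrite invr_gt0|rewrite mxE ord1; exact: qx].
by move=> [_ /(_ 0)] qx i; move: (qx i); rewrite mxE.
Qed.

(** Boxes are stable under intersection, and the cubes [-k, k]^n exhaust the space with finite
    measure. *)
Lemma lebesgue_rV_unique n (m : {measure set 'rV[R]_n -> \bar R}) :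
  (forall A : 'I_n -> set R, (forall i, measurable (A i)) ->
    lebesgue_rV n (box A) = m (box A)) ->
  forall A, measurable A -> lebesgue_rV n A = m A.
Proof.
move=> bm A mA.
apply: (measure_unique
  [set box A | A in [set A : 'I_n -> set R | forall i, measurable (A i)]]
  (fun k => box (fun=> `[- k%:R, k%:R]%classic))) => //.
- exact: measurable_rV_boxes.
- move=> _ _ [B mB <-] [C mC <-]; exists (fun i => B i `&` C i).
    by move=> i; exact: measurableI.
  by apply/seteqP; split => x /=; [move=> h; split=> i; have [] := h i|
    move=> [h1 h2] i; split; [exact: h1|exact: h2]].
- by move=> k; exists (fun=> `[- k%:R, k%:R]%classic).
- apply/seteqP; split => // x _; exists (Num.truncn `|x|).+1 => // i /=.
  rewrite in_itv/= -ler_norml; apply: (@le_trans _ _ `|x|); last first.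
    by rewrite ltW// truncnS_gt.
  exact: norm_coord_le.
- by move=> _ [B mB <-]; exact: bm.
- move=> k; pose I : set (measurableTypeR R) := `[- k%:R, k%:R]%classic; suff : (\prod_(i < n) lebesgue_measure I < +oo)%E.
    have mI : measurable I by exact: measurable_itv.
    rewrite -(@lebesgue_rV_boxE n (fun=> I)); last by move=> i; exact: mI.
    exact.
  rewrite /I.
  under eq_bigr do rewrite lebesgue_measure_itv /=.
  have finP : forall l : \bar R, l \is a fin_num ->
      (\prod_(i < n) l)%E \is a fin_num.
    by move=> l lf; elim/big_ind : _ => // x y; exact: fin_numM.
  rewrite ltey; set l := (X in (\prod_(i < n) X)%E).
  have : l \is a fin_num by rewrite /l; case: ifP.
  by move/finP; case: (\prod_(i < n) l)%E.
Qed.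

Definition rV_affine n (s : 'S_n) (c b : 'I_n -> R) (x : 'rV[R]_n) : 'rV[R]_n :=
  \row_i (c i * x 0 (s i) + b i).

Lemma measurable_rV_affine n (s : 'S_n) (c b : 'I_n -> R) :
  measurable_fun setT (rV_affine s c b).
Proof.
apply: measurable_fun_mx => i j; under eq_fun do rewrite mxE.
apply: measurable_funD => //; apply: measurable_funM => //.
exact: coord_measurable_mx.
Qed.

Lemma lebesgue_rV_affine n (s : 'S_n) (c b : 'I_n -> R) (A : set 'rV[R]_n) :
  (forall i, c i != 0) -> measurable A ->
  lebesgue_rV n (rV_affine s c b @^-1` A) =
  ((\prod_i `|c i|^-1)%:E * lebesgue_rV n A)%E.
Proof.
move=> c0 mA; set T := rV_affine s c b.
have mT : measurable_fun setT T.
  exact: measurable_rV_affine.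
have p0 : 0 <= \prod_i `|c i| by apply: prodr_ge0.
pose m_ : {measure set 'rV[R]_n -> \bar R} :=
  mscale (NngNum p0) (pushforward (lebesgue_rV n) T).
have mE X : m_ mT X = ((\prod_i `|c i|)%:E * lebesgue_rV n (T @^-1` X))%E by [].
have -> : lebesgue_rV n A = m_ mT A.
  apply: lebesgue_rV_unique => // B mB.
  rewrite mE lebesgue_rV_boxE//.
  (* Coordinate j of x only enters the image coordinate s^-1 j, so the sides of the box are merely
     permuted. *)
  have -> : T @^-1` box B =
      box (fun j => (fun x => c (s^-1%g j) * x + b (s^-1%g j)) @^-1` B (s^-1%g j)).
    apply/seteqP; split => x /= h i.
      by have := h (s^-1%g i); rewrite mxE permKV.
    by rewrite mxE; have := h (s i); rewrite permK.
  rewrite lebesgue_rV_boxE; last first.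
    move=> i; rewrite -[X in measurable X]setTI.
    have mf : measurable_fun [set: measurableTypeR R]
      (fun x : R => c (s^-1%g i) * x + b (s^-1%g i) : measurableTypeR R).
      by apply: measurable_funD => //; exact: measurable_funM.
    by apply: mf => //; exact: mB.
  rewrite [X in (_ * X)%E](reindex_inj (@perm_inj _ s))/=.
  rewrite [X in (_ * X)%E](eq_bigr (fun i => `|c i|^-1%:E * lebesgue_measure (B i)))%E;
    last by move=> i _; rewrite permK lebesgue_measure_affine//; exact: mB.
  elim/big_rec3 : _ => [|i x y z _ ->]; first by rewrite mul1e.
  rewrite EFinM [RHS]muleACA; congr (_ * _)%E.
  by rewrite muleA -EFinM mulfV ?mul1e// normr_eq0.
rewrite mE muleA -EFinM -big_split/= big1 ?mul1e// => i _.
by rewrite mulVf// normr_eq0.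
Qed.

Lemma ge0_integral_rV_affine n (s : 'S_n) (c b : 'I_n -> R) (D : set 'rV[R]_n)
    (f : 'rV[R]_n -> \bar R) :
  (forall i, c i != 0) -> measurable D -> measurable_fun D f ->
  (forall x, D x -> 0 <= f x)%E ->
  (\int[lebesgue_rV n]_(x in rV_affine s c b @^-1` D)
     f (rV_affine s c b x) =
  (\prod_i `|c i|^-1)%:E * \int[lebesgue_rV n]_(x in D) f x)%E.
Proof.
move=> c0 mD mf f0; set T := rV_affine s c b.
have mT : measurable_fun setT T.
  exact: measurable_rV_affine.
have p0 : 0 <= \prod_i `|c i|^-1 by apply: prodr_ge0.
have fin : {in D, forall y, 0 <= f y}%E by move=> y /[!inE]; exact: f0.
rewrite -[LHS](ge0_integral_pushforward mT)//.
transitivity (\int[mscale (NngNum p0) (lebesgue_rV n)]_(x in D) f x)%E.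
  apply: eq_measure_integral => A mA _.
  exact: (lebesgue_rV_affine s b c0 mA).
by rewrite ge0_integral_mscale.
Qed.

End affine_invariance.

(** * Euclidean norm and averages over balls *)

Section euclidean.
Context {R : realType}.

Lemma continuous_measurable_mx m n (f : 'M[R]_(m, n) -> R) :
  continuous f -> measurable_fun setT (f : 'M[R]_(m, n) -> measurableTypeR R).
Proof.
move=> cf; apply: (measurability _ (@RGenOpens.measurableE R)) => _ [_ [a [b ->]] <-].
rewrite setTI; apply: open_measurable_mx.
by apply: open_comp => [M _|]; [exact: cf|exact: interval_open].
Qed.

Lemma lower_semicontinuous_measurable_mx m n (f : 'M[R]_(m, n) -> \bar R) :
  lower_semicontinuous f -> measurable_fun setT f.
Proof.
move=> scif; apply: (measurability _ (ErealGenOInfty.measurableE R)).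
move=> /= _ [_ [a ->]] <-; rewrite setTI; apply: open_measurable_mx.
by rewrite preimage_itvoy; move/lower_semicontinuousP : scif; exact.
Qed.

Variable d : nat.
Implicit Types x y z : 'rV[R]_d.

Definition dotr x y : R := \sum_(i < d) x 0 i * y 0 i.
Definition sqnorm x : R := \sum_(i < d) x 0 i ^+ 2.

Lemma sqnorm_ge0 x : 0 <= sqnorm x.
Proof. by apply: sumr_ge0 => i _; exact: sqr_ge0. Qed.

Lemma enorm_ge0 x : 0 <= enorm x. Proof. exact: sqrtr_ge0. Qed.

Lemma sqr_enorm x : enorm x ^+ 2 = sqnorm x.
Proof. by rewrite sqr_sqrtr ?sqnorm_ge0. Qed.

Lemma sqnormZ c x : sqnorm (c *: x) = c ^+ 2 * sqnorm x.
Proof. by rewrite /sqnorm mulr_sumr; apply: eq_bigr => i _; rewrite mxE exprMn. Qed.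

Lemma sqnormN x : sqnorm (- x) = sqnorm x.
Proof. by rewrite -scaleN1r sqnormZ sqrrN expr1n mul1r. Qed.

Lemma sqnormD x y : sqnorm (x + y) = sqnorm x + 2 * dotr x y + sqnorm y.
Proof.
rewrite /sqnorm /dotr mulr_sumr -!big_split/=; apply: eq_bigr => i _.
by rewrite mxE; ring.
Qed.

Lemma sqnormB x y : sqnorm (x - y) = sqnorm x - 2 * dotr x y + sqnorm y.
Proof.
rewrite sqnormD sqnormN (_ : dotr x (- y) = - dotr x y); first by ring.
by rewrite /dotr -sumrN; apply: eq_bigr => i _; rewrite mxE mulrN.
Qed.

Lemma dotrZr c x y : dotr x (c *: y) = c * dotr x y.
Proof. by rewrite /dotr mulr_sumr; apply: eq_bigr => i _; rewrite mxE; ring. Qed.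

(** Cauchy-Schwarz, from the nonnegative square norm of |x|^2 y - (x . y) x. *)
Lemma dotr_sqr_le x y : dotr x y ^+ 2 <= sqnorm x * sqnorm y.
Proof.
have [x0|x0] := eqVneq (sqnorm x) 0.
  have xi i : x 0 i = 0.
    apply/eqP; rewrite -sqrf_eq0; apply/eqP.
    exact: (@psumr_eq0P _ _ _ (fun i => x 0 i ^+ 2) (fun i _ => sqr_ge0 _) x0).
  by rewrite /dotr big1 ?expr0n ?x0 ?mul0r//= => i _; rewrite xi mul0r.
have xp : 0 < sqnorm x by rewrite lt_neqAle eq_sym x0 sqnorm_ge0.
have := sqnorm_ge0 (sqnorm x *: y - dotr x y *: x).
rewrite sqnormB !sqnormZ dotrZr (_ : dotr (sqnorm x *: y) x = sqnorm x * dotr x y); last first.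
  by rewrite /dotr mulr_sumr; apply: eq_bigr => i _; rewrite mxE; ring.
have -> : sqnorm x ^+ 2 * sqnorm y - 2 * (dotr x y * (sqnorm x * dotr x y)) +
  dotr x y ^+ 2 * sqnorm x = sqnorm x * (sqnorm x * sqnorm y - dotr x y ^+ 2) by ring.
by rewrite pmulr_rge0// subr_ge0.
Qed.

Lemma enormN x : enorm (- x) = enorm x.
Proof. by rewrite /enorm; congr Num.sqrt; exact: sqnormN. Qed.

Lemma enormZ c x : enorm (c *: x) = `|c| * enorm x.
Proof. by rewrite /enorm -/(sqnorm _) sqnormZ sqrtrM ?sqr_ge0// sqrtr_sqr. Qed.

Lemma ler_enormD x y : enorm (x + y) <= enorm x + enorm y.
Proof.
rewrite -(@ler_pXn2r _ 2) ?nnegrE ?addr_ge0 ?enorm_ge0//.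
have -> : (enorm x + enorm y) ^+ 2 = sqnorm x + 2 * (enorm x * enorm y) + sqnorm y.
  by rewrite -!sqr_enorm; ring.
rewrite sqr_enorm sqnormD lerD2r lerD2l ler_pM2l//.
rewrite (le_trans (ler_norm _))// -(@ler_pXn2r _ 2) ?nnegrE ?mulr_ge0 ?enorm_ge0//.
by rewrite exprMn !sqr_enorm real_normK ?num_real// dotr_sqr_le.
Qed.

Lemma norm_le_enorm x : `|x| <= enorm x.
Proof.
have [x0|x0] := eqVneq x 0; first by rewrite x0 normr0 enorm_ge0.
rewrite [leLHS]/Num.norm/=.
have [|i ->] := @mx_norm_neq0 _ _ _ x; first by apply: contra x0 => /eqP/mx_norm_eq0/eqP.
rewrite -(@ler_pXn2r _ 2) ?nnegrE ?enorm_ge0// sqr_enorm real_normK ?num_real//.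
rewrite (ord1 i.1) /sqnorm (bigD1 i.2)//= lerDl.
by apply: sumr_ge0 => j _; exact: sqr_ge0.
Qed.

Lemma continuous_sumr (T : topologicalType) (I : finType) (F : I -> T -> R) :
  (forall i, continuous (F i)) -> continuous (fun t => \sum_i F i t).
Proof.
move=> cF; apply: continuous_big => // -[u v].
by apply: cvgD; [exact: cvg_fst|exact: cvg_snd].
Qed.

Lemma continuous_sqnorm : continuous sqnorm.
Proof.
apply: continuous_sumr => i x.
by have cF := @coord_continuous R 1 d 0 i x; exact: (cvgM cF cF).
Qed.

Lemma continuous_dotr z : continuous (dotr z).
Proof.
apply: continuous_sumr => i x.
by have cF := @coord_continuous R 1 d 0 i x; exact: (cvgM (cvg_cst _) cF).
Qed.

Lemma continuous_enorm : continuous (@enorm R d).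
Proof.
move=> x; apply: (@continuous_comp _ _ _ sqnorm Num.sqrt).
  exact: continuous_sqnorm.
exact: sqrt_continuous.
Qed.

Lemma measurable_eball x r : measurable (eball x r).
Proof.
apply: open_measurable_mx.
have oI : open [set t : R | t < r] by exact: open_lt.
apply: (@open_comp _ _ (fun y => enorm (y - x)) [set t | t < r]) oI => y _.
apply: (@continuous_comp _ _ _ (fun y => y - x) enorm); last exact: continuous_enorm.
exact: (@cvgB _ _ _ _ _ _ _ _ _ (@cvg_id _ _) (cvg_cst x)).
Qed.

End euclidean.

(** * Ball averages of every radius as integrals against one probability *)

Section ball_average.
Context {R : realType}.

(** [P] is the default value of [mnormalize] for total mass 0 or +oo; both are excluded here. *)
Lemma ge0_integral_restr_probability d (T : measurableType d)
    (m : {measure set T -> \bar R}) (P : probability T R) (A : set T)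
    (mA : measurable A) (f : T -> \bar R) :
  (0 < m A)%E -> (m A < +oo)%E -> measurable_fun setT f -> (forall x, 0 <= f x)%E ->
  (\int[mnormalize (mrestr m mA) P]_x f x = (fine (m A))^-1%:E * \int[m]_(x in A) f x)%E.
Proof.
move=> mA0 mAoo mf f0.
have i0 : 0 <= (fine (m A))^-1 by rewrite invr_ge0 fine_ge0// measure_ge0.
transitivity (\int[mscale (NngNum i0) (mrestr m mA)]_x f x)%E.
  apply: eq_measure_integral => B mB _.
  have Ar : mrestr m mA setT = m A by rewrite /mrestr setTI.
  transitivity (mnormalize (mrestr m mA) P B) => //.
  rewrite /mnormalize /= Ar ifF; first by rewrite /mscale/= muleC.
  by apply/negbTE; rewrite negb_or gt_eqF//= lt_eqF.
rewrite ge0_integral_mscale//; congr (_ * _)%E.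
transitivity (\int[mrestr m mA]_(x in A) f x)%E.
  have := @ge0_negligible_integral _ _ _ (mrestr m mA) setT (~` A) f
    (measurableC mA) measurableT mf (fun x _ => f0 x).
  rewrite setTD setCK; apply.
  by rewrite /= /mrestr setICl measure0.
apply: eq_measure_integral => B mB BA.
by rewrite /= /mrestr (_ : B `&` A = B)//; exact/setIidPl.
Qed.

Lemma ge0_integralZT d (T : measurableType d) (m : {measure set T -> \bar R})
    (k : R) (f : T -> \bar R) :
  0 <= k -> measurable_fun setT f -> (forall x, 0 <= f x)%E ->
  (\int[m]_x (k%:E * f x) = k%:E * \int[m]_x f x)%E.
Proof. by move=> k0 mf f0; rewrite ge0_integralZl. Qed.

Lemma ge0_integralDT d (T : measurableType d) (m : {measure set T -> \bar R})
    (f g : T -> \bar R) :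
  measurable_fun setT f -> measurable_fun setT g ->
  (forall x, 0 <= f x)%E -> (forall x, 0 <= g x)%E ->
  (\int[m]_x (f x + g x) = \int[m]_x f x + \int[m]_x g x)%E.
Proof. by move=> mf mg f0 g0; rewrite ge0_integralD. Qed.

Lemma ge0_le_integralT d (T : measurableType d) (m : {measure set T -> \bar R})
    (f g : T -> \bar R) :
  measurable_fun setT f -> measurable_fun setT g ->
  (forall x, 0 <= f x)%E -> (forall x, f x <= g x)%E ->
  (\int[m]_x f x <= \int[m]_x g x)%E.
Proof.
by move=> mf mg f0 fg; apply: ge0_le_integral => // x _; rewrite (le_trans (f0 x)).
Qed.

Variable d : nat.

Lemma ge0_integral_rV_shift (b : 'rV[R]_d) (f : 'rV[R]_d -> \bar R) :
  measurable_fun setT f -> (forall x, 0 <= f x)%E ->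
  (\int[lebesgue_rV d]_x f (x + b)%R = \int[lebesgue_rV d]_x f x)%E.
Proof.
move=> mf f0.
have := @ge0_integral_rV_affine R d 1%g (fun=> 1) (fun i => b 0 i) setT f
  (fun=> oner_neq0 _) measurableT mf (fun x _ => f0 x).
rewrite preimage_setT big1 ?mul1e; last by move=> i _; rewrite normr1 invr1.
move=> <-; apply: eq_integral => x _; congr f.
by apply/rowP => i; rewrite !mxE perm1 mul1r.
Qed.

Lemma ge0_integral_rV_scale (c : R) (D : set 'rV[R]_d) (f : 'rV[R]_d -> \bar R) :
  c != 0 -> measurable D ->
  measurable_fun setT f -> (forall x, 0 <= f x)%E ->
  (\int[lebesgue_rV d]_(x in (fun x => c *: x)%R @^-1` D) f (c *: x)%R =
   (`|c| ^- d)%:E * \int[lebesgue_rV d]_(x in D) f x)%E.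
Proof.
move=> c0 mD mf f0.
have := @ge0_integral_rV_affine R d 1%g (fun=> c) (fun=> 0) D f
  (fun=> c0) mD (measurable_funS measurableT (@subsetT _ _) mf) (fun x _ => f0 x).
have -> : rV_affine 1%g (fun=> c) (fun=> 0) = (fun x : 'rV[R]_d => c *: x).
  by apply/funext => x; apply/rowP => i; rewrite !mxE perm1 addr0.
by move=> ->; rewrite prodr_const card_ord exprVn.
Qed.

Lemma mem_eball0 (x : 'rV[R]_d) r : eball 0 r x <-> enorm x < r.
Proof. by rewrite /eball/= subr0. Qed.

Lemma preimage_eball0 (e : R) : 0 < e ->
  (fun x : 'rV[R]_d => e *: x) @^-1` eball 0 e = eball 0 1.
Proof.
move=> e0; apply/seteqP; split => x; rewrite /preimage/= !mem_eball0 enormZ gtr0_norm//.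
  by rewrite -ltr_pdivlMl// mulVf ?gt_eqF.
by move=> h; rewrite -ltr_pdivlMl// mulVf ?gt_eqF.
Qed.

Lemma lebesgue_eball1_lty : (lebesgue_rV d (eball 0 1 : set 'rV[R]_d) < +oo)%E.
Proof.
have mb : measurable (box (fun _ : 'I_d => `[-1, 1]%classic : set R)).
  by apply: measurable_box => i; exact: measurable_itv.
apply: (@le_lt_trans _ _ (lebesgue_rV d (box (fun _ : 'I_d => `[-1, 1]%classic : set R)))).
  apply: le_measure; rewrite ?inE//; first exact: measurable_eball.
  move=> x; rewrite mem_eball0 => x1 i /=; rewrite in_itv/= -ler_norml.
  by rewrite (le_trans (norm_coord_le _ _ _))// (le_trans (norm_le_enorm _))// ltW.
rewrite lebesgue_rV_boxE//.
under eq_bigr do rewrite lebesgue_measure_itv/= ?lte_fin ifT ?gtrN//.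
rewrite -EFinD ltey.
suff : (\prod_(i < d) (1 - -1)%:E)%E \is a @fin_num R by case: (\prod_(i < d) _)%E.
by elim/big_ind : _ => // x y; exact: fin_numM.
Qed.

Lemma lebesgue_eball1_gt0 : (0 < lebesgue_rV d (eball 0 1 : set 'rV[R]_d))%E.
Proof.
(* The cube of half-side 1/(d+1) lies in the unit ball because d/(d+1)^2 < 1; taking d+1 avoids
   dividing by zero when d = 0. *)
pose r : R := d.+1%:R^-1.
have r0 : 0 < r by rewrite invr_gt0.
have mb : measurable (box (fun _ : 'I_d => `[-r, r]%classic : set R)).
  by apply: measurable_box => i; exact: measurable_itv.
apply: (@lt_le_trans _ _ (lebesgue_rV d (box (fun _ : 'I_d => `[-r, r]%classic : set R)))).
  rewrite lebesgue_rV_boxE//.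
  elim/big_ind : _ => [|x y x0 y0|i _]; [by rewrite lte_fin|exact: mule_gt0|].
  rewrite lebesgue_measure_itv/= ifT -?EFinD lte_fin; lra.
apply: le_measure; rewrite ?inE//; first exact: measurable_eball.
move=> x xr; rewrite mem_eball0.
rewrite -(@ltr_pXn2r _ 2) ?nnegrE ?enorm_ge0// sqr_enorm expr1n.
apply: (@le_lt_trans _ _ (\sum_(i < d) r ^+ 2)).
  apply: ler_sum => i _; rewrite -[leLHS]real_normK ?num_real//.
  rewrite ler_pXn2r ?nnegrE// ?(ltW r0)//.
  by have := xr i; rewrite /= in_itv/= -ler_norml.
rewrite sumr_const card_ord -mulr_natr /r expr2 -mulrA.
rewrite ltr_pdivrMl ?mulr1; last by rewrite ltr0n.
rewrite mulrC ltr_pdivrMr ?ltr0n//.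
by rewrite -natrM ltr_nat mulnSr; apply: leq_trans (_ : d.+1 <= _)%N => //; rewrite ?leq_addl.
Qed.

Definition uball : probability 'rV[R]_d R :=
  mnormalize (mrestr (lebesgue_rV d) (measurable_eball 0 1)) (dirac (0 : 'rV[R]_d)).

Lemma ge0_integral_uball (f : 'rV[R]_d -> \bar R) :
  measurable_fun setT f -> (forall x, 0 <= f x)%E ->
  (\int[uball]_x f x =
   (fine (lebesgue_rV d (eball 0 1 : set 'rV[R]_d)))^-1%:E * \int[lebesgue_rV d]_(x in eball 0 1) f x)%E.
Proof.
move=> mf f0; apply: ge0_integral_restr_probability => //.
- exact: lebesgue_eball1_gt0.
- exact: lebesgue_eball1_lty.
Qed.

Lemma measurable_rV_scale (e : R) : measurable_fun setT (fun y : 'rV[R]_d => e *: y).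
Proof.
apply: measurable_fun_mx => i j; under eq_fun do rewrite mxE.
by apply: measurable_funM => //; exact: coord_measurable_mx.
Qed.

Lemma measurable_rV_shift (b : 'rV[R]_d) : measurable_fun setT (fun y : 'rV[R]_d => y + b).
Proof.
apply: measurable_fun_mx => i j; under eq_fun do rewrite mxE.
by apply: measurable_funD => //; exact: coord_measurable_mx.
Qed.

Lemma lebesgue_eball1E (e : R) : 0 < e ->
  lebesgue_rV d (eball 0 1 : set 'rV[R]_d) = ((`|e| ^- d)%:E * lebesgue_rV d (eball 0 e))%E.
Proof.
move=> e0; have := @ge0_integral_rV_scale e (eball 0 e) (cst 1%E) (lt0r_neq0 e0)
  (measurable_eball _ _) (@measurable_cst _ _ _ _ _ _) (fun=> lee01).
rewrite preimage_eball0// !integral_cst//; [|exact: measurable_eball..].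
by rewrite !mul1e.
Qed.

Lemma eball_average (e : R) (f : 'rV[R]_d -> \bar R) : 0 < e ->
  measurable_fun setT f -> (forall x, 0 <= f x)%E ->
  ((lebesgue_rV d (eball 0 e))^-1 * \int[lebesgue_rV d]_(y in eball 0 e) f y =
   \int[uball]_y f (e *: y)%R)%E.
Proof.
move=> e0 mf f0.
have mfe : measurable_fun setT (fun y : 'rV[R]_d => f (e *: y)).
  by apply: measurableT_comp => //; exact: measurable_rV_scale.
rewrite ge0_integral_uball//.
rewrite -[in X in _ = (_ * X)%E](preimage_eball0 e0) ge0_integral_rV_scale ?gt_eqF//; last exact: measurable_eball.
rewrite muleA; congr (_ * _)%E.
have B1 : (0 < lebesgue_rV d (eball 0 1 : set 'rV[R]_d) < +oo)%E.
  by rewrite lebesgue_eball1_gt0 lebesgue_eball1_lty.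
have ed : 0 < `|e| ^- d by rewrite invr_gt0 exprn_gt0// normr_gt0 gt_eqF.
move: B1; rewrite (lebesgue_eball1E e0); case: (lebesgue_rV d (eball 0 e)) => [l| |].
- rewrite -EFinM !lte_fin => /andP[l0 _].
  have {}l0 : 0 < l by move: l0; rewrite pmulr_rgt0.
  rewrite inver gt_eqF//= -EFinM; congr EFin.
  rewrite /=; move: (`|e| ^- d) ed => q q0.
  by field; rewrite !gt_eqF.
- by rewrite gt0_muley ?lte_fin//= ltxx andbF.
- by rewrite gt0_muleNy ?lte_fin//=.
Qed.

End ball_average.

(** * Second moments of the uniform law on the unit ball *)

Section ball_moments.
Context {R : realType} {d : nat}.
Implicit Types x y z : 'rV[R]_d.

Lemma measurable_sqnorm : measurable_fun setT (@sqnorm R d).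
Proof. by apply: continuous_measurable_mx; exact: continuous_sqnorm. Qed.

Lemma measurable_dotr z : measurable_fun setT (dotr z).
Proof. by apply: continuous_measurable_mx; exact: continuous_dotr. Qed.

(** A signed permutation of the coordinates is an isometry, so it preserves the ball and its
    volume. *)
Lemma ge0_integral_uball_affine (s : 'S_d) (c : 'I_d -> R) (f : 'rV[R]_d -> \bar R) :
  (forall i, `|c i| = 1) -> measurable_fun setT f -> (forall x, 0 <= f x)%E ->
  (\int[@uball R d]_x f (rV_affine s c (fun=> 0%R) x) = \int[@uball R d]_x f x)%E.
Proof.
move=> c1 mf f0; set T := rV_affine s c (fun=> 0).
have mT : measurable_fun setT T by exact: measurable_rV_affine.
rewrite !ge0_integral_uball//; last exact: measurableT_comp.
congr (_ * _)%E.
have c0 i : c i != 0 by rewrite -normr_eq0 c1 oner_eq0.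
have := ge0_integral_rV_affine s (fun=> 0) c0 (measurable_eball 0 1)
  (measurable_funS measurableT (@subsetT _ _) mf) (fun x _ => f0 x).
rewrite big1 ?mul1e => [<-|i _]; last by rewrite c1 invr1.
congr (integral _ _ _); apply/seteqP.
have Tn x : enorm (T x) = enorm x.
  rewrite /enorm; congr Num.sqrt; rewrite [RHS](reindex_inj (@perm_inj _ s))/=.
  apply: eq_bigr => i _; rewrite mxE addr0 exprMn -[c i ^+ 2]real_normK ?num_real//.
  by rewrite c1 expr1n mul1r.
by split => x; rewrite /preimage/= !mem_eball0 Tn.
Qed.

Lemma ge0_le_integral_uball (f g : 'rV[R]_d -> \bar R) :
  measurable_fun setT f -> measurable_fun setT g ->
  (forall x, 0 <= f x)%E -> (forall x, 0 <= g x)%E ->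
  (forall x, enorm x < 1 -> (f x <= g x)%E) ->
  (\int[@uball R d]_x f x <= \int[@uball R d]_x g x)%E.
Proof.
move=> mf mg f0 g0 fg; rewrite !ge0_integral_uball//.
apply: lee_pmul => //; first by rewrite lee_fin invr_ge0 fine_ge0.
  exact: integral_ge0.
apply: ge0_le_integral => //.
- exact: measurable_eball.
- exact: measurable_funS mf.
- exact: measurable_funS mg.
- by move=> x; rewrite mem_eball0 => /fg.
Qed.

Lemma uball_sqnorm_le1 : (\int[@uball R d]_y (sqnorm y)%:E <= 1 :> \bar R)%E.
Proof.
apply: (@le_trans _ _ (\int[@uball R d]_y (cst 1%E y))%E); last first.
  by rewrite integral_cst// mul1e; apply: probability_le1.
apply: ge0_le_integral_uball => //.
- by apply/measurable_EFinP; apply: measurable_sqnorm.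
- by move=> x; rewrite lee_fin sqnorm_ge0.
- move=> x x1; rewrite lee_fin -sqr_enorm expr_le1// ?enorm_ge0//.
  exact: ltW.
Qed.

(** The variance of one coordinate under [uball]. It equals 1/(d+2), but is kept symbolic:
    [heat_speed] absorbs its value and only its sign has to be proved. *)
Definition usig : R := fine (\int[@uball R d]_y (@sqnorm R d y)%:E)%E / d%:R.

Lemma uball_sqnorm : (\int[@uball R d]_y (sqnorm y)%:E = (d%:R * usig)%:E)%E.
Proof.
have fin : (\int[@uball R d]_y (@sqnorm R d y)%:E)%E \is a fin_num.
  rewrite ge0_fin_numE; last by apply: integral_ge0 => x _; rewrite lee_fin sqnorm_ge0.
  by rewrite (le_lt_trans uball_sqnorm_le1)// ltry.
(* For d = 0 division by zero makes [usig] zero, in agreement with an integral that vanishes. *)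
rewrite /usig; have [d0|d0] := eqVneq d 0%N; last first.
  by rewrite mulrC divfK ?pnatr_eq0// fineK.
have -> : d%:R = 0 :> R by rewrite d0.
rewrite mul0r; apply: integral0_eq => y _.
by rewrite /sqnorm big1// => i _; have := ltn_ord i; rewrite {2}d0.
Qed.

(** Exchanging two coordinates shows that all d second moments agree, and their sum is known. *)
Lemma uball_coord i : (\int[@uball R d]_y (y 0%R i ^+ 2)%:E = usig%:E)%E.
Proof.
have m2 j : measurable_fun setT (fun y : 'rV[R]_d => (y 0 j ^+ 2)%:E).
  apply/measurable_EFinP/measurable_funX; exact: coord_measurable_mx.
have p2 j (y : 'rV[R]_d) : (0 <= (y 0%R j ^+ 2)%:E)%E by rewrite lee_fin sqr_ge0.
have sym j : (\int[@uball R d]_y (y 0%R j ^+ 2)%:E = \int[@uball R d]_y (y 0%R i ^+ 2)%:E)%E.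
  apply: (etrans _ (@ge0_integral_uball_affine (tperm i j) (fun=> 1) _
    (fun=> normr1 _) (m2 i) (p2 i))).
  apply: eq_integral => y _; rewrite mxE tpermL mul1r addr0//.
have d0 : d%:R != 0 :> R by rewrite pnatr_eq0 -lt0n (leq_ltn_trans _ (ltn_ord i)).
have fin : (\int[@uball R d]_y (y 0%R i ^+ 2)%:E)%E \is a fin_num.
  rewrite ge0_fin_numE; last exact: integral_ge0.
  apply: (@le_lt_trans _ _ 1%E); last by rewrite ltry.
  apply: le_trans uball_sqnorm_le1; apply: ge0_le_integralT => //.
    by apply/measurable_EFinP; apply: measurable_sqnorm.
  move=> y; rewrite lee_fin /sqnorm (bigD1 i)//= lerDl.
  by apply: sumr_ge0 => j _; exact: sqr_ge0.
have sq : (\sum_(j < d) \int[@uball R d]_y (y 0%R j ^+ 2)%:E = (d%:R * usig)%:E)%E.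
  by rewrite -uball_sqnorm -ge0_integral_sum//; apply: eq_integral => y _; rewrite sumEFin.
move: sq; rewrite (eq_bigr _ (fun j _ => sym j)).
rewrite -(fineK fin) sumEFin sumr_const card_ord => -[] h; congr EFin.
by apply: (mulfI d0); rewrite -h mulr_natl.
Qed.

(** The covariance matrix is a multiple of the identity. The coordinates of z are switched on one at
    a time through [tr]; reflecting the new coordinate removes the cross term. *)
Lemma uball_dotr z : (\int[@uball R d]_y (dotr z y ^+ 2)%:E = (usig * sqnorm z)%:E)%E.
Proof.
pose tr (n : nat) : 'rV[R]_d := \row_i (if (i < n)%N then z 0 i else 0).
suff main n : (n <= d)%N ->
    (\int[@uball R d]_y (dotr (tr n) y ^+ 2)%:E = (usig * sqnorm (tr n))%:E)%E.
  suff -> : z = tr d by exact: main.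
  by apply/rowP => i; rewrite mxE ltn_ord.
have md (w : 'rV[R]_d) : measurable_fun setT (fun y => (dotr w y ^+ 2)%:E).
  by apply/measurable_EFinP/measurable_funX; exact: measurable_dotr.
have m2 j (c : R) : measurable_fun setT (fun y : 'rV[R]_d => ((c * y 0 j) ^+ 2)%:E).
  apply/measurable_EFinP/measurable_funX/measurable_funM => //; exact: coord_measurable_mx.
elim: n => [|n IH] nd.
  have -> : tr 0 = 0 by apply/rowP => i; rewrite !mxE.
  rewrite /sqnorm big1 ?mulr0 => [|i _]; last by rewrite mxE expr0n.
  apply: integral0_eq => y _.
  by rewrite /dotr big1 ?expr0n// => i _; rewrite mxE mul0r.
pose k := Ordinal nd.
have trS y : dotr (tr n.+1) y = dotr (tr n) y + z 0 k * y 0 k.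
  rewrite /dotr (bigD1 k)//= [in RHS](bigD1 k)//= !mxE ltnn ltnSn mul0r add0r addrC.
  congr (_ + _); apply: eq_bigr => i ik; rewrite !mxE ltnS leq_eqVlt.
  by rewrite -[_ == n]/(i == k :> nat) val_eqE (negbTE ik).
have nqS : sqnorm (tr n.+1) = sqnorm (tr n) + z 0 k ^+ 2.
  rewrite /sqnorm (bigD1 k)//= [in RHS](bigD1 k)//= !mxE ltnn ltnSn expr0n add0r addrC.
  congr (_ + _); apply: eq_bigr => i ik; rewrite !mxE ltnS leq_eqVlt.
  by rewrite -[_ == n]/(i == k :> nat) val_eqE (negbTE ik).
pose c (i : 'I_d) : R := if i == k then -1 else 1.
have flip : (\int[@uball R d]_y (dotr (tr n.+1) y ^+ 2)%:E =
             \int[@uball R d]_y ((dotr (tr n) y - z 0 k * y 0 k) ^+ 2)%:E)%E.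
  have c1 i : `|c i| = 1 by rewrite /c; case: ifP; rewrite ?normrN normr1.
  have p2 y : (0 <= (dotr (tr n.+1) y ^+ 2)%:E)%E by rewrite lee_fin sqr_ge0.
  apply: (etrans (esym (@ge0_integral_uball_affine 1%g c _ c1 (md _) p2))).
  apply: eq_integral => y _; rewrite trS; congr ((_ + _) ^+ 2)%:E.
      rewrite /dotr; apply: eq_bigr => i _; rewrite !mxE perm1 addr0 /c.
      by case: eqP => [->|_]; rewrite ?ltnn ?mul0r// mul1r.
    by rewrite mxE perm1 /c eqxx addr0 mulN1r mulrN.
(* Adding the reflected copy cancels the cross term inside the integrand, so only nonnegative
   functions are integrated. *)
have par : (\int[@uball R d]_y (dotr (tr n.+1) y ^+ 2)%:E + \int[@uball R d]_y (dotr (tr n.+1) y ^+ 2)%:E =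
    (2 * (usig * sqnorm (tr n.+1)))%:E)%E.
  rewrite [X in (_ + X)%E]flip -ge0_integralD//; last 3 first.
  - by move=> y _; rewrite lee_fin sqr_ge0.
  - by move=> y _; rewrite lee_fin sqr_ge0.
  - apply/measurable_EFinP/measurable_funX/measurable_funB; first exact: measurable_dotr.
    by apply: measurable_funM => //; exact: coord_measurable_mx.
  transitivity (\int[@uball R d]_y (2%:E * (dotr (tr n) y ^+ 2)%:E + (2 * z 0 k ^+ 2)%:E * (y 0%R k ^+ 2)%:E))%E.
    by apply: eq_integral => y _; rewrite trS -!EFinM -!EFinD; congr EFin; ring.
  have p2 j (y : 'rV[R]_d) : (0 <= (y 0%R j ^+ 2)%:E)%E by rewrite lee_fin sqr_ge0.
  have m1 : measurable_fun setT (fun y : 'rV[R]_d => (y 0 k ^+ 2)%:E).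
    apply/measurable_EFinP/measurable_funX; exact: coord_measurable_mx.
  have z0 : 0 <= 2 * z 0 k ^+ 2 by rewrite mulr_ge0// sqr_ge0.
  rewrite ge0_integralD//; last 4 first.
  - by move=> y _; rewrite mule_ge0// lee_fin sqr_ge0.
  - exact: measurable_funeM.
  - by move=> y _; rewrite mule_ge0.
  - exact: measurable_funeM.
  rewrite !ge0_integralZl//; last by move=> y _; rewrite lee_fin sqr_ge0.
  rewrite (IH (ltnW nd)) uball_coord nqS -!EFinM -EFinD; congr EFin; ring.
move: par; case: (\int[@uball R d]_y (dotr (tr n.+1) y ^+ 2)%:E)%E => [r| |]//.
by rewrite -EFinD => -[] h; congr EFin; lra.
Qed.

(** The square norm is at least 1/4 outside the ball of radius 1/2, which carries only the fraction
    2^-d of the mass. *)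
Lemma usig_gt0 : (0 < d)%N -> 0 < usig.
Proof.
move=> d0; pose q : R := 2^-1.
have q0 : 0 < q by rewrite invr_gt0.
have dR : 0 < d%:R :> R by rewrite ltr0n.
suff : ((4^-1 * (1 - q ^+ d))%:E <= (d%:R * usig)%:E)%E.
  rewrite lee_fin => h; rewrite -(pmulr_rgt0 _ dR); apply: lt_le_trans h.
  by rewrite mulr_gt0// subr_gt0 exprn_ilt1 ?ltW//?invf_lt1 ?ltr1n// -lt0n.
have mq : measurable (eball (0 : 'rV[R]_d) q) by exact: measurable_eball.
have uq : uball d (eball 0 q) = (q ^+ d)%:E.
  have miq : measurable_fun setT (fun y : 'rV[R]_d => (\1_(eball 0 q) y : R)%:E).
    by apply/measurable_EFinP; apply: measurable_indic.
  rewrite -[eball 0 q in LHS]setIT -(@integral_indic _ _ _ (@uball R d) setT measurableT _ mq).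
  rewrite ge0_integral_uball//.
  rewrite integral_indic//; last exact: measurable_eball.
  rewrite (_ : eball 0 q `&` eball 0 1 = eball 0 q); last first.
    apply/setIidPl => y; rewrite !mem_eball0 => /lt_trans; apply.
    by rewrite invf_lt1 ?ltr1n.
  rewrite -[X in (_ * X)%E]/(lebesgue_rV d (eball 0 q)).
  have : (0 < lebesgue_rV d (eball (0 : 'rV[R]_d) 1) < +oo)%E.
    by rewrite lebesgue_eball1_gt0 lebesgue_eball1_lty.
  rewrite (lebesgue_eball1E d q0) gtr0_norm//.
  have qd : 0 < q ^- d by rewrite invr_gt0 exprn_gt0.
  case: (lebesgue_rV d (eball 0 q)) => [l| |].
  - rewrite -EFinM !lte_fin/= => /andP[l0 _].
    rewrite -?EFinM; congr EFin; move: qd l0.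
    move: (q ^+ d) => u u0; rewrite pmulr_rgt0// => l0; move: u0; rewrite invr_gt0 => u0.
    by field; rewrite !gt_eqF.
  - by rewrite gt0_muley ?lte_fin//= ltxx andbF.
  - by rewrite gt0_muleNy ?lte_fin//=.
rewrite -uball_sqnorm.
apply: (@le_trans _ _ (\int[@uball R d]_y (4^-1 * (\1_(~` eball 0 q) y))%:E)%E).
  under eq_integral do rewrite EFinM.
  have mC : measurable_fun setT (fun y : 'rV[R]_d => (\1_(~` eball 0 q) y : R)%:E).
    by apply/measurable_EFinP; apply: measurable_indic; exact: measurableC.
  rewrite ge0_integralZT//.
  rewrite integral_indic//; last exact: measurableC.
  rewrite setIT -[X in (_ * X)%E]/(@uball R d (~` eball 0 q)).
  by rewrite (@probability_setC _ _ _ (@uball R d) _ mq) uq EFinM EFinB.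
apply: ge0_le_integralT => //.
- by apply/measurable_EFinP/measurable_funM => //; exact/measurable_indic/measurableC.
- by apply/measurable_EFinP; apply: measurable_sqnorm.
- move=> y; rewrite lee_fin indicE; case: (boolP (y \in _)); last by rewrite mulr0 sqnorm_ge0.
  rewrite inE => ny; have qy : q <= enorm y by rewrite leNgt; apply/negP => /mem_eball0.
  rewrite mulr1 -sqr_enorm.
  have -> : 4^-1 = q ^+ 2 by rewrite /q; field.
  by rewrite ler_pXn2r ?nnegrE ?enorm_ge0// ltW.
Qed.

End ball_moments.

(** * The heat kernel *)

Section gaussian.
Context {R : realType}.

(** The difference of the two sides vanishes at 0 and has derivative (e^y - 1)^2 / e^y. *)
Lemma expR_subN_ge (x : R) : 0 <= x -> 2 * x <= expR x - expR (- x).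
Proof.
move=> x0.
pose f := fun y : R => expR y - expR (- y) - 2 * y.
have df (y : R) : is_derive y 1 f (expR y + expR (- y) - 2).
  by apply: is_derive_eq; rewrite /GRing.scale/=; ring.
have f0 : f 0 = 0 by rewrite /f oppr0 mulr0 !subrr.
suff : f 0 <= f x by rewrite f0 /f subr_ge0.
apply: (@ger0_derive1_ndecry _ f 0) => //.
- move=> y _; rewrite derive1E; case: (df y) => _ ->; rewrite expRN.
  have e0 := expR_gt0 y.
  have -> : expR y + (expR y)^-1 - 2 = (expR y - 1) ^+ 2 / expR y by field; rewrite gt_eqF.
  by rewrite divr_ge0 ?sqr_ge0// ltW.
- apply/continuous_subspaceT => y; apply/differentiable_continuous/derivable1_diffP.
  by case: (df y).
Qed.

(** With u = e^(p/2) and v = e^(-p/2), the left side minus 2 is (u - v)^2, and u - v >= p for p >=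
    0. *)
Lemma expR_addN_ge (p : R) : 2 + p ^+ 2 <= expR p + expR (- p).
Proof.
wlog p0 : p / 0 <= p.
  move=> h; have [/h//|/ltW] := leP 0 p; rewrite -oppr_ge0 => /h.
  by rewrite opprK sqrrN addrC [in leRHS]addrC addrC.
have hp : 0 <= p / 2 by rewrite divr_ge0.
have := expR_subN_ge hp; set u := expR (p / 2); set v := expR (- (p / 2)).
have -> : expR p = u ^+ 2 by rewrite /u -expRM_natl; congr expR; field.
have -> : expR (- p) = v ^+ 2 by rewrite /v -expRM_natl; congr expR; field.
have uv : u * v = 1 by rewrite /u /v expRxMexpNx_1.
move=> h; have : p ^+ 2 <= (u - v) ^+ 2.
  by rewrite ler_pXn2r ?nnegrE//; lra.
nra.
Qed.

Lemma continuous_gauss_rV n b : continuous (fun z : 'rV[R]_n => expR (- (b * sqnorm z))).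
Proof.
move=> z; apply: (@continuous_comp _ _ _ (fun z => - (b * sqnorm z)) expR).
  exact: (cvgN (cvgM (cvg_cst b) (@continuous_sqnorm R n z))).
exact: continuous_expR.
Qed.

Lemma measurable_gauss_rV n b :
  measurable_fun setT (fun z : 'rV[R]_n => (expR (- (b * sqnorm z)))%:E).
Proof.
by apply/measurable_EFinP; apply: continuous_measurable_mx; exact: continuous_gauss_rV.
Qed.

Lemma integral_gauss_rV n :
  (\int[lebesgue_rV n]_z (expR (- @sqnorm R n z))%:E = (Num.sqrt pi ^+ n)%:E)%E.
Proof.
have mg k : measurable_fun setT (fun z : 'rV[R]_k => (expR (- sqnorm z))%:E).
  by have := measurable_gauss_rV (n := k) 1; under eq_fun do rewrite mul1r.
elim: n => [|n IH].
  rewrite [LHS]integral_dirac// diracT mul1e /sqnorm big_ord0 oppr0 expR0//.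
have sqc (p : measurableTypeR R * 'rV[R]_n) : sqnorm (rV_cons p) = p.1 ^+ 2 + sqnorm p.2.
  by rewrite /sqnorm big_ord_recl rV_cons0; congr (_ + _); apply: eq_bigr => i _; rewrite rV_consS.
transitivity (\int[pushforward (@lebesgue_measure R \x lebesgue_rV n)%E (@rV_cons R n)]_z
    (expR (- sqnorm z))%:E)%E; first by [].
rewrite (@ge0_integral_pushforward _ _ _ _ R _ (@measurable_rV_cons R n))//.
rewrite preimage_setT fubini_tonelli1//=; last first.
  by apply: measurableT_comp (mg _) _; exact: measurable_rV_cons.
rewrite /fubini_F/=.
transitivity (\int[@lebesgue_measure R]_x ((Num.sqrt pi ^+ n)%:E * (gauss_fun x)%:E))%E.
  apply: eq_integral => x _; rewrite muleC -IH -ge0_integralZT//=.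
  - by apply: eq_integral => y _; rewrite sqc/= opprD expRD EFinM.
  - exact: gauss_fun_ge0.
  - exact: mg.
rewrite ge0_integralZT; first by rewrite integralT_gauss -EFinM exprSr.
- by rewrite exprn_ge0// sqrtr_ge0.
- by apply/measurable_EFinP; exact: measurable_gauss_fun.
- by move=> x; rewrite lee_fin gauss_fun_ge0.
Qed.

Variable d : nat.
Implicit Types x y z : 'rV[R]_d.

Lemma integral_gauss_rV_scale b : 0 < b ->
  (\int[lebesgue_rV d]_z (expR (- (b * @sqnorm R d z)))%:E =
    ((Num.sqrt (pi / b)) ^+ d)%:E)%E.
Proof.
move=> b0; have c0 : Num.sqrt b != 0 by rewrite sqrtr_eq0 -ltNge.
have mg : measurable_fun setT (fun z : 'rV[R]_d => (expR (- sqnorm z))%:E).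
  by have := measurable_gauss_rV (n := d) 1; under eq_fun do rewrite mul1r.
have := ge0_integral_rV_scale c0 measurableT mg (fun z => expR_ge0 (- sqnorm z)).
rewrite preimage_setT integral_gauss_rV => h.
transitivity (\int[lebesgue_rV d]_x (expR (- sqnorm (Num.sqrt b *: x)))%:E)%E.
  by apply: eq_integral => z _; rewrite sqnormZ sqr_sqrtr ?ltW.
rewrite h -EFinM ger0_norm ?sqrtr_ge0//; congr EFin.
by rewrite sqrtrM ?pi_ge0// exprMn mulrC sqrtrV ?(ltW b0)// exprVn.
Qed.

Definition heat_kernel (t : R) z : R :=
  (Num.sqrt (4 * pi * t))^-1 ^+ d * expR (- (sqnorm z / (4 * t))).

Lemma heat_kernel_ge0 t z : 0 <= heat_kernel t z.
Proof. by rewrite mulr_ge0 ?expR_ge0// exprn_ge0// invr_ge0 sqrtr_ge0. Qed.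

Lemma continuous_heat_kernel t : continuous (heat_kernel t).
Proof.
rewrite /heat_kernel; under eq_fun do rewrite [sqnorm _ / _]mulrC.
move=> z; exact: (cvgM (cvg_cst _) (@continuous_gauss_rV d (4 * t)^-1 z)).
Qed.

Lemma measurable_heat_kernel t : measurable_fun setT (fun z => (heat_kernel t z)%:E).
Proof.
apply/measurable_EFinP; apply: continuous_measurable_mx; exact: continuous_heat_kernel.
Qed.

Lemma integral_heat_kernel t : 0 < t ->
  (\int[lebesgue_rV d]_z (heat_kernel t z)%:E = 1)%E.
Proof.
move=> t0; have t4 : 0 < (4 * t)^-1 by rewrite invr_gt0 mulr_gt0.
under eq_integral do rewrite EFinM [sqnorm _ / _]mulrC.
rewrite ge0_integralZT; [|by rewrite exprn_ge0// invr_ge0 sqrtr_ge0|exact: measurable_gauss_rV|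
  by move=> z; rewrite lee_fin expR_ge0].
rewrite integral_gauss_rV_scale// -EFinM -exprMn; congr EFin.
rewrite invrK (_ : pi * (4 * t) = 4 * pi * t); last by ring.
rewrite mulVf ?expr1n// sqrtr_eq0 -ltNge mulr_gt0// mulr_gt0// pi_gt0//.
Qed.

(** The kernel is frozen at time 1 and the argument of V is dilated. Time 0 then returns V, and a
    Lipschitz bound on V controls the dependence on t. *)
Definition heat (t : R) (V : 'rV[R]_d -> \bar R) x : \bar R :=
  (\int[lebesgue_rV d]_z (V (x + Num.sqrt t *: z)%R * (heat_kernel 1 z)%:E))%E.

Lemma heatE t V x : 0 < t -> measurable_fun setT V -> (forall x, 0 <= V x)%E ->
  heat t V x = (\int[lebesgue_rV d]_z (V (x + z)%R * (heat_kernel t z)%:E))%E.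
Proof.
move=> t0 mV V0; pose c := Num.sqrt t.
have c0 : 0 < c by rewrite sqrtr_gt0.
have mVx : measurable_fun setT (fun z => V (x + z)).
  apply: measurableT_comp mV _; have := measurable_rV_shift x.
  by under eq_fun do rewrite addrC.
pose F z := (V (x + z)%R * (heat_kernel 1 (c^-1 *: z))%:E)%E.
have mF : measurable_fun setT F.
  apply: emeasurable_funM => //; apply: measurableT_comp (measurable_heat_kernel 1) _.
  exact: measurable_rV_scale.
have F0 z : (0 <= F z)%E by rewrite mule_ge0// lee_fin heat_kernel_ge0.
have := ge0_integral_rV_scale (lt0r_neq0 c0) measurableT mF F0.
rewrite preimage_setT => h.
transitivity (\int[lebesgue_rV d]_z F (c *: z))%E.
  by apply: eq_integral => z _; rewrite /F scalerA mulVf ?gt_eqF// scale1r.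
rewrite h -ge0_integralZT; [|by rewrite invr_ge0 exprn_ge0|exact: mF|exact: F0].
apply: eq_integral => z _; rewrite /F muleCA -EFinM; congr (_ * _%:E)%E.
rewrite /heat_kernel sqnormZ mulr1 mulrA; congr (_ * expR (- _)).
  rewrite gtr0_norm// -exprVn -exprMn; congr (_ ^+ _).
  by rewrite -invfM -sqrtrM ?ltW// mulrC.
rewrite exprVn sqr_sqrtr ?ltW//; field; rewrite gt_eqF//.
Qed.

End gaussian.

(** * Ball averages against backward time steps of the kernel *)

Section heat_kernel_inequality.
Context {R : realType} {d : nat}.
Implicit Types x y z : 'rV[R]_d.
Local Notation sigma := (@usig R d).

(* Averaging y and -y turns the cross term into cosh p >= 1 + p^2/2. *)
Lemma gauss_symmetrized_ge b s z y : 0 < b -> b * s ^+ 2 <= 1 -> enorm y < 1 ->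
  expR (- (b * sqnorm z)) * (2 + 4 * b ^+ 2 * s ^+ 2 * dotr z y ^+ 2) <=
  expR (- (b * sqnorm (z - s *: y))) + expR (- (b * sqnorm (z + s *: y))) +
  expR (- (b * sqnorm z)) * (2 * b * s ^+ 2 * sqnorm y + 4 * b ^+ 3 * s ^+ 4 * sqnorm z).
Proof.
move=> b0 bs y1; set g := expR (- (b * sqnorm z)).
have g0 : 0 < g by exact: expR_gt0.
have y2 : sqnorm y <= 1 by rewrite -sqr_enorm expr_le1// ?enorm_ge0// ltW.
have yp : 0 <= sqnorm y by exact: sqnorm_ge0.
(* Expanding the squares, the exponents at z - s y and z + s y are the one at z plus - q + p and - q
   - p respectively. *)
pose q := b * s ^+ 2 * sqnorm y; pose p := 2 * b * s * dotr z y.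
have s2 : 0 <= s ^+ 2 by exact: sqr_ge0.
have bs0 : 0 <= b * s ^+ 2 by apply: mulr_ge0 => //; exact: ltW.
have q0 : 0 <= q by exact: mulr_ge0.
have q1 : q <= 1 by rewrite /q mulr_ile1.
have -> : expR (- (b * sqnorm (z - s *: y))) = g * expR (- q) * expR p.
  by rewrite -!expRD; congr expR; rewrite sqnormB sqnormZ dotrZr /q /p; ring.
have -> : expR (- (b * sqnorm (z + s *: y))) = g * expR (- q) * expR (- p).
  by rewrite -!expRD; congr expR; rewrite sqnormD sqnormZ dotrZr /q /p; ring.
have Eq : 1 - q <= expR (- q) by exact: expR_ge1Dx.
have Ep := expR_addN_ge p.
have key : (1 - q) * (2 + p ^+ 2) <= expR (- q) * (expR p + expR (- p)).
  by apply: ler_pM => //; [lra|have := sqr_ge0 p; lra].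
have cs := dotr_sqr_le z y; have z0 := sqnorm_ge0 z.
(* This product is of order s^4; Cauchy-Schwarz and |y| < 1 make its bound independent of y. *)
have qp : q * p ^+ 2 <= 4 * b ^+ 3 * s ^+ 4 * sqnorm z.
  have -> : q * p ^+ 2 = 4 * b ^+ 3 * s ^+ 4 * (sqnorm y * dotr z y ^+ 2) by rewrite /q /p; ring.
  apply: ler_wpM2l; first by apply: mulr_ge0; [apply: mulr_ge0 => //; apply: exprn_ge0; exact: ltW|exact: exprn_even_ge0].
  have : sqnorm y * dotr z y ^+ 2 <= 1 * dotr z y ^+ 2 by rewrite ler_wpM2r// sqr_ge0.
  have : sqnorm z * sqnorm y <= sqnorm z * 1 by rewrite ler_wpM2l.
  lra.
set Z := 4 * b ^+ 3 * s ^+ 4 * sqnorm z in qp *.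
set u := expR (- q) in key *; set v := expR p in key *; set w := expR (- p) in key *.
rewrite -subr_ge0 (_ : _ - _ = g * (u * (v + w) + 2 * q + Z - 2 - p ^+ 2)); last first.
  by rewrite /q /p; ring.
by apply: mulr_ge0; [exact: ltW|clearbody p q Z u v w; lra].
Qed.

Lemma measurable_rV_translate (s : R) z : measurable_fun setT (fun y => z + s *: y).
Proof.
apply: measurable_fun_mx => i j; under eq_fun do rewrite !mxE.
apply: measurable_funD => //; apply: measurable_funM => //; exact: coord_measurable_mx.
Qed.

Lemma uball_sym (s : R) z (f : 'rV[R]_d -> \bar R) :
  measurable_fun setT f -> (forall x, 0 <= f x)%E ->
  (\int[@uball R d]_y f (z + s *: y)%R = \int[@uball R d]_y f (z - s *: y)%R)%E.
Proof.
move=> mf f0.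
have mfs : measurable_fun setT (fun y => f (z + s *: y)).
  by apply: measurableT_comp mf _; exact: measurable_rV_translate.
have c1 (i : 'I_d) : `|-1 : R| = 1 by rewrite normrN normr1.
have <- := @ge0_integral_uball_affine R d 1%g (fun=> -1) _ c1 mfs (fun y => f0 _).
apply: eq_integral => y _; congr f; rewrite -scalerN; congr (_ + _ *: _).
by apply/rowP => i; rewrite !mxE perm1 mulN1r addr0.
Qed.

Definition gaussE (b : R) y : \bar R := (expR (- (b * sqnorm y)))%:E.

Lemma measurable_gaussE b : measurable_fun setT (gaussE b).
Proof. exact: measurable_gauss_rV. Qed.

Lemma gaussE_ge0 b y : (0 <= gaussE b y)%E.
Proof. by rewrite lee_fin expR_ge0. Qed.

Lemma measurable_gaussE_translate b s z :
  measurable_fun setT (fun y => gaussE b (z + s *: y)).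
Proof.
exact: (measurableT_comp (measurable_gaussE b) (measurable_rV_translate s z)).
Qed.

Lemma measurable_gaussE_translateN b s z :
  measurable_fun setT (fun y => gaussE b (z - s *: y)).
Proof.
by have := measurable_gaussE_translate b (- s) z; under eq_fun do rewrite scaleNr.
Qed.

Lemma integral_uball_cst (r : R) : (\int[@uball R d]_y (cst r%:E y) = r%:E)%E.
Proof.
rewrite integral_cst; last exact: measurableT.
rewrite [X in (_ * X)%E](_ : _ = 1%E); first by rewrite mule1.
exact: (@probability_setT _ _ _ (@uball R d)).
Qed.

Lemma gaussE_le1 b y : 0 < b -> (gaussE b y <= 1)%E.
Proof.
move=> b0; rewrite /gaussE lee_fin expR_le1 oppr_le0.
by apply: mulr_ge0; [exact: ltW|exact: sqnorm_ge0].
Qed.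

Lemma integral_gaussE_fin b s z : 0 < b ->
  (\int[@uball R d]_y gaussE b (z - s *: y)%R)%E \is a fin_num.
Proof.
move=> b0; rewrite ge0_fin_numE; last by apply: integral_ge0 => y _; exact: gaussE_ge0.
apply: (@le_lt_trans _ _ (\int[@uball R d]_y (cst 1%E y))%E); last first.
  by rewrite integral_uball_cst ltry.
apply: ge0_le_integralT.
- exact: measurable_gaussE_translateN.
- exact: measurable_cst.
- by move=> y; exact: gaussE_ge0.
- by move=> y; exact: gaussE_le1.
Qed.

Lemma uball_quadratic z (A B : R) : 0 <= A -> 0 <= B ->
  (\int[@uball R d]_y ((A * dotr z y ^+ 2)%R%:E + B%:E) = (A * (sigma * sqnorm z) + B)%:E)%E.
Proof.
move=> A0 B0.
have md2 : measurable_fun setT (fun y => (dotr z y ^+ 2)%:E).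
  by apply/measurable_EFinP; apply: measurable_funX; exact: measurable_dotr.
have mA : measurable_fun setT (fun y => (A * dotr z y ^+ 2)%:E).
  under eq_fun do rewrite EFinM; exact: measurable_funeM.
rewrite ge0_integralDT; [|exact: mA|exact: measurable_cst|
  by move=> y; rewrite lee_fin mulr_ge0// sqr_ge0|by move=> y; rewrite lee_fin].
rewrite (integral_uball_cst B); under eq_integral do rewrite EFinM.
rewrite ge0_integralZT; [|exact: A0|exact: md2|by move=> y; rewrite lee_fin sqr_ge0].
by rewrite uball_dotr EFinD EFinM.
Qed.

Lemma uball_sqnorm_affine (A B : R) : 0 <= A -> 0 <= B ->
  (\int[@uball R d]_y ((A * sqnorm y)%R%:E + B%:E) = (A * (d%:R * sigma) + B)%:E)%E.
Proof.
move=> A0 B0.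
have mn : measurable_fun setT (fun y : 'rV[R]_d => (sqnorm y)%:E).
  by apply/measurable_EFinP; apply: measurable_sqnorm.
have mA : measurable_fun setT (fun y : 'rV[R]_d => (A * sqnorm y)%:E).
  under eq_fun do rewrite EFinM; exact: measurable_funeM.
rewrite ge0_integralDT; [|exact: mA|exact: measurable_cst|
  by move=> y; rewrite lee_fin mulr_ge0// sqnorm_ge0|by move=> y; rewrite lee_fin].
rewrite (integral_uball_cst B); under eq_integral do rewrite EFinM.
rewrite ge0_integralZT; [|exact: A0|exact: mn|by move=> y; rewrite lee_fin sqnorm_ge0].
by rewrite uball_sqnorm EFinD EFinM.
Qed.

Lemma measurable_dotr2 z (A B : R) :
  measurable_fun setT (fun y => ((A * dotr z y ^+ 2)%R%:E + B%:E)%E).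
Proof.
under eq_fun do rewrite -EFinD.
apply/measurable_EFinP; apply: measurable_funD => //; apply: measurable_funM => //.
by apply: measurable_funX; exact: measurable_dotr.
Qed.

Lemma measurable_sqnorm_affine (A B : R) :
  measurable_fun setT (fun y : 'rV[R]_d => ((A * sqnorm y)%R%:E + B%:E)%E).
Proof.
under eq_fun do rewrite -EFinD.
apply/measurable_EFinP; apply: measurable_funD => //; apply: measurable_funM => //.
exact: measurable_sqnorm.
Qed.

(** Half the integral of [gauss_symmetrized_ge] over the ball, with the negative terms moved to the
    right so that every integrand is nonnegative. *)
Lemma gauss_ball_average_ge b s z : 0 < b -> b * s ^+ 2 <= 1 ->
  ((expR (- (b * sqnorm z)) * (1 + 2 * b ^+ 2 * s ^+ 2 * sigma * sqnorm z))%:E <=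
   \int[@uball R d]_y gaussE b (z - s *: y)%R +
   (expR (- (b * sqnorm z)) *
     (b * s ^+ 2 * (d%:R * sigma) + 2 * b ^+ 3 * s ^+ 4 * sqnorm z))%:E)%E.
Proof.
move=> b0 bs; set g := expR (- (b * sqnorm z)).
have g0 : 0 <= g by exact: expR_ge0.
(* The existentials make the coefficients opaque; their values come back only for the final
   arithmetic. *)
have [A [A0 AE]] : exists A, 0 <= A /\ A = g * (4 * b ^+ 2 * s ^+ 2).
  exists (g * (4 * b ^+ 2 * s ^+ 2)); split => //; apply: mulr_ge0 => //.
  by apply: mulr_ge0; [apply: mulr_ge0 => //|]; exact: sqr_ge0.
have [B [B0 BE]] : exists B, 0 <= B /\ B = g * (2 * b * s ^+ 2).
  exists (g * (2 * b * s ^+ 2)); split => //; apply: mulr_ge0 => //.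
  by apply: mulr_ge0; [apply: mulr_ge0 => //; exact: ltW|exact: sqr_ge0].
have [D [D0 DE]] : exists D, 0 <= D /\ D = g * (4 * b ^+ 3 * s ^+ 4 * sqnorm z).
  exists (g * (4 * b ^+ 3 * s ^+ 4 * sqnorm z)); split => //; apply: mulr_ge0 => //.
  apply: mulr_ge0; last exact: sqnorm_ge0.
  apply: mulr_ge0; last exact: exprn_even_ge0.
  by apply: mulr_ge0 => //; apply: exprn_ge0; exact: ltW.
have main : (\int[@uball R d]_y ((A * dotr z y ^+ 2)%R%:E + (2 * g)%:E) <=
    \int[@uball R d]_y ((gaussE b (z - s *: y)%R + gaussE b (z + s *: y)%R) +
       ((B * sqnorm y)%R%:E + D%:E)))%E.
  apply: ge0_le_integral_uball.
  - exact: measurable_dotr2.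
  - apply: emeasurable_funD; last exact: measurable_sqnorm_affine.
    apply: emeasurable_funD; first exact: measurable_gaussE_translateN.
    exact: measurable_gaussE_translate.
  - move=> y; rewrite -EFinD lee_fin; apply: addr_ge0; last exact: mulr_ge0.
    by apply: mulr_ge0 => //; exact: sqr_ge0.
  - move=> y; apply: adde_ge0; first by apply: adde_ge0; exact: gaussE_ge0.
    rewrite -EFinD lee_fin; apply: addr_ge0 => //; apply: mulr_ge0 => //.
    exact: sqnorm_ge0.
  - move=> y y1; rewrite /gaussE -!EFinD lee_fin.
    have := @gauss_symmetrized_ge b s z y b0 bs y1; rewrite -/g AE BE DE.
    clear; lra.
move: main; rewrite uball_quadratic; [|exact: A0|exact: mulr_ge0].
rewrite ge0_integralDT; first last.
- move=> y; rewrite -EFinD lee_fin; apply: addr_ge0 => //; apply: mulr_ge0 => //.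
  exact: sqnorm_ge0.
- by move=> y; apply: adde_ge0; exact: gaussE_ge0.
- exact: measurable_sqnorm_affine.
- apply: emeasurable_funD; first exact: measurable_gaussE_translateN.
  exact: measurable_gaussE_translate.
rewrite ge0_integralDT; first last.
- by move=> y; exact: gaussE_ge0.
- by move=> y; exact: gaussE_ge0.
- exact: measurable_gaussE_translate.
- exact: measurable_gaussE_translateN.
rewrite (uball_sym s z (measurable_gaussE b) (gaussE_ge0 b)) uball_sqnorm_affine//.
have := integral_gaussE_fin s z b0; case: (\int[@uball R d]_y _)%E => // r _.
rewrite -!EFinD !lee_fin AE BE DE; clear; lra.
Qed.

Lemma bernoulli_ge (e : R) n : 0 <= e -> 1 + n%:R * e <= (1 + e) ^+ n.
Proof.
move=> e0; elim: n => [|n IH]; first by rewrite mul0r addr0 expr0.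
rewrite exprS -natr1.
have : (1 + e) * (1 + n%:R * e) <= (1 + e) * (1 + e) ^+ n by rewrite ler_wpM2l// addr_ge0.
have : 0 <= n%:R * e * e by rewrite !mulr_ge0.
lra.
Qed.

(** First-order expansion in ep. Bernoulli handles (1 - ep)^(-d/2); for the exponential, ep / (1 -
    ep) <= ep + 2 ep^2 when ep <= 1/2, and e^-v >= 1 - v. *)
Lemma heat_kernel_backward_ge t ep z : 0 < t -> 0 <= ep -> ep <= 2^-1 ->
  heat_kernel t z * (1 + d%:R * ep / 2 - sqnorm z / (4 * t) * ep
     - (2 + d%:R) * (sqnorm z / (4 * t)) * ep ^+ 2) <=
  heat_kernel (t * (1 - ep)) z.
Proof.
move=> t0 ep0 ep1; set X := sqnorm z / (4 * t).
have X0 : 0 <= X by rewrite divr_ge0 ?sqnorm_ge0// mulr_ge0// ltW.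
have e1 : 0 < 1 - ep by lra.
rewrite /heat_kernel -/X.
have -> : sqnorm z / (4 * (t * (1 - ep))) = X + X * (ep / (1 - ep)).
  by rewrite /X; field; rewrite !gt_eqF.
have -> : Num.sqrt (4 * pi * (t * (1 - ep))) = Num.sqrt (4 * pi * t) * Num.sqrt (1 - ep).
  by rewrite -sqrtrM ?mulrA// !mulr_ge0// ?pi_ge0// ltW.
rewrite invfM exprMn opprD expRD.
set c := (Num.sqrt (4 * pi * t))^-1 ^+ d; set g := expR (- X).
have c0 : 0 <= c by rewrite exprn_ge0// invr_ge0 sqrtr_ge0.
have g0 : 0 <= g by exact: expR_ge0.
set A := _ ^+ d; set E := expR (- (X * _)).
rewrite (_ : c * A * (g * E) = c * g * (A * E)); last by ring.
apply: ler_wpM2l; first exact: mulr_ge0.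
have A1 : 1 + d%:R * (ep / 2) <= A.
  apply: le_trans (bernoulli_ge d _) _; first by rewrite divr_ge0.
  rewrite /A lerXn2r ?nnegrE ?addr_ge0 ?divr_ge0 ?invr_ge0 ?sqrtr_ge0//.
  rewrite -[leRHS]div1r ler_pdivlMr ?sqrtr_gt0// -(@ler_pXn2r _ 2) ?nnegrE//; last first.
    by apply: mulr_ge0; [lra|exact: sqrtr_ge0].
  rewrite exprMn sqr_sqrtr ?(ltW e1)// expr1n.
  have : 0 <= ep ^+ 2 by exact: sqr_ge0.
  have : 0 <= ep ^+ 3 by exact: exprn_ge0.
  lra.
have E1 : 1 - X * (ep + 2 * ep ^+ 2) <= E.
  rewrite /E; apply: le_trans (expR_ge1Dx _); rewrite lerD2l lerN2 ler_wpM2l//.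
  by rewrite ler_pdivrMr//; nra.
have E0 : 0 <= E by exact: expR_ge0.
have d0 : 0 <= d%:R :> R by [].
have h1 : (1 + d%:R * (ep / 2)) * E <= A * E by rewrite ler_wpM2r.
have h2 : (1 + d%:R * (ep / 2)) * (1 - X * (ep + 2 * ep ^+ 2)) <= (1 + d%:R * (ep / 2)) * E.
  by rewrite ler_wpM2l// addr_ge0// mulr_ge0// divr_ge0.
have h3 : 0 <= d%:R * X * ep ^+ 2 * (1 - 2 * ep) by apply: mulr_ge0; [do 1!apply: mulr_ge0; [exact: mulr_ge0|exact: sqr_ge0]|lra].
lra.
Qed.

(** With b = 1/(4t), the ball average contributes 2 b^3, and the backward step (2 + d) b ep^2 with
    ep = 2 b sigma s^2. *)
Definition heat_error (t : R) : R :=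
  (2 + 4 * (2 + d%:R) * sigma ^+ 2) * (4 * t)^-1 ^+ 3.

(** The kernel solves the heat equation: the terms d b sigma s^2 and 2 b^2 sigma s^2 |z|^2 appear
    with opposite signs in the ball average and in the backward step, and only s^4 remains. *)
Lemma heat_kernel_ineq t s z : 0 < t -> s ^+ 2 <= 4 * t -> 0 <= sigma ->
  sigma * s ^+ 2 <= t ->
  ((2 * heat_kernel t z)%:E <=
   \int[@uball R d]_y (heat_kernel t (z - s *: y))%:E +
   (heat_kernel (t - sigma * s ^+ 2 / 2) z + heat_error t * s ^+ 4 * (sqnorm z * heat_kernel t z))%:E)%E.
Proof.
move=> t0 st sg0 sst; pose b := (4 * t)^-1.
have t4 : 0 < 4 * t by rewrite mulr_gt0.
have b0 : 0 < b by rewrite invr_gt0.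
have bs : b * s ^+ 2 <= 1 by rewrite /b ler_pdivrMl// mulr1.
set c := (Num.sqrt (4 * pi * t))^-1 ^+ d.
have c0 : 0 <= c by rewrite exprn_ge0// invr_ge0 sqrtr_ge0.
have hk y : heat_kernel t y = c * expR (- (b * sqnorm y)) by rewrite /heat_kernel mulrC [b * _]mulrC mulrC.
have -> : (\int[@uball R d]_y (heat_kernel t (z - s *: y))%:E =
   c%:E * \int[@uball R d]_y gaussE b (z - s *: y)%R)%E.
  rewrite -ge0_integralZT; first by apply: eq_integral => y _; rewrite hk EFinM.
  - exact: c0.
  - apply: (measurableT_comp (measurable_gaussE b)).
    by have := measurable_rV_translate (- s) z; under eq_fun do rewrite scaleNr.
  - by move=> y; exact: gaussE_ge0.
have := gauss_ball_average_ge z b0 bs.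
set g := expR (- (b * sqnorm z)).
have := integral_gaussE_fin s z b0.
case: (\int[@uball R d]_y _)%E => // r _; rewrite -EFinD lee_fin => hI.
have {hI} cI := ler_wpM2l c0 hI.
pose ep := sigma * s ^+ 2 / (2 * t).
have ep0 : 0 <= ep by apply: divr_ge0; [apply: mulr_ge0 => //; exact: sqr_ge0|lra].
have ep1 : ep <= 2^-1 by rewrite /ep ler_pdivrMr ?mulr_gt0//; lra.
have := heat_kernel_backward_ge z t0 ep0 ep1.
have -> : t * (1 - ep) = t - sigma * s ^+ 2 / 2 by rewrite /ep; field; rewrite gt_eqF.
rewrite (_ : sqnorm z / (4 * t) = b * sqnorm z); last by rewrite mulrC.
have epb : ep = 2 * b * sigma * s ^+ 2 by rewrite /ep /b; field; rewrite gt_eqF.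
set h := heat_kernel (t - _) z => hh.
have hE : heat_error t * s ^+ 4 * (sqnorm z * heat_kernel t z) =
  c * g * sqnorm z * (2 * b ^+ 3 * s ^+ 4) +
  c * g * sqnorm z * ((2 + d%:R) * b * ep ^+ 2).
  by rewrite hk /heat_error -/b -/g epb; ring.
rewrite hE.
have gE : heat_kernel t z = c * g by rewrite hk.
rewrite gE in hh *.
rewrite -EFinM -!EFinD lee_fin.
move: hh cI; rewrite epb; clear; lra.
Qed.

End heat_kernel_inequality.

(** * Heat flow of bounded Lipschitz data *)

Section heat_flow.
Context {R : realType} {d : nat}.
Implicit Types x y z : 'rV[R]_d.
Local Notation sigma := (@usig R d).

Definition heat_moment (t : R) : R :=
  fine (\int[lebesgue_rV d]_z (@sqnorm R d z * heat_kernel t z)%:E)%E.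

Lemma measurable_moment t : measurable_fun setT (fun z => (sqnorm z * heat_kernel t z)%:E).
Proof.
apply/measurable_EFinP; apply: measurable_funM; first exact: measurable_sqnorm.
by apply: continuous_measurable_mx; exact: continuous_heat_kernel.
Qed.

Lemma moment_ge0 t z : (0 <= (sqnorm z * heat_kernel t z)%:E)%E.
Proof. by rewrite lee_fin; apply: mulr_ge0; [exact: sqnorm_ge0|exact: heat_kernel_ge0]. Qed.

(** Half of the Gaussian exponent absorbs the factor |z|^2, by u <= e^u with u = |z|^2 / (8t). *)
Lemma heat_momentE t : 0 < t ->
  (\int[lebesgue_rV d]_z (sqnorm z * heat_kernel t z)%:E = (heat_moment t)%:E)%E.
Proof.
move=> t0; rewrite fineK// ge0_fin_numE; last first.
  by apply: integral_ge0 => z _; exact: moment_ge0.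
have t4 : 0 < 4 * t by rewrite mulr_gt0.
have t8 : 0 < 8 * t by rewrite mulr_gt0.
pose c : R := (Num.sqrt (4 * pi * t))^-1 ^+ d * (8 * t).
have c0 : 0 <= c.
  by apply: mulr_ge0; [rewrite exprn_ge0// invr_ge0 sqrtr_ge0|exact: ltW].
apply: (@le_lt_trans _ _ (\int[lebesgue_rV d]_z (c%:E * (gaussE (8 * t)^-1 z)))%E).
  apply: ge0_le_integralT.
  - exact: measurable_moment.
  - apply: measurable_funeM; exact: measurable_gaussE.
  - exact: moment_ge0.
  - move=> z; rewrite /gaussE -EFinM lee_fin /heat_kernel [leLHS]mulrCA /c -[leRHS]mulrA.
    apply: ler_wpM2l; first by rewrite exprn_ge0// invr_ge0 sqrtr_ge0.
    have -> : sqnorm z / (4 * t) = (8 * t)^-1 * sqnorm z + (8 * t)^-1 * sqnorm z.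
      by field; rewrite gt_eqF.
    rewrite opprD expRD mulrA; apply: ler_wpM2r; first exact: expR_ge0.
    set u := (8 * t)^-1 * sqnorm z.
    have -> : sqnorm z = 8 * t * u by rewrite /u; field; rewrite gt_eqF.
    rewrite expRN ler_pdivrMr ?expR_gt0//; apply: ler_wpM2l; first exact: ltW.
    have := expR_ge1Dx u; lra.
rewrite ge0_integralZT; [|exact: c0|exact: measurable_gaussE|by move=> z; exact: gaussE_ge0].
by rewrite integral_gauss_rV_scale ?invr_gt0// -EFinM ltry.
Qed.

Section lipschitz_data.
Variables (f : 'rV[R]_d -> R) (M k : R).
Hypothesis f0 : forall x, 0 <= f x.
Hypothesis fM : forall x, f x <= M.
Hypothesis k0 : 0 <= k.
Hypothesis flip : forall x y, `|f x - f y| <= k * `|x - y|.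

Lemma lipschitz_continuous : continuous f.
Proof.
move=> x; apply/(@cvgrPdist_le _ _ _ (nbhs x) (nbhs_filter x)) => e e0.
have k1 : 0 < k + 1 by rewrite ltr_wpDl.
have := @cvgr_dist_lt _ _ _ (nbhs x) (nbhs_filter x) (fun y : 'rV[R]_d => y) x cvg_id _ (divr_gt0 e0 k1).
apply: filterS => y; rewrite ltr_pdivlMr// => xy.
apply: (le_trans (flip x y)); apply: (le_trans _ (ltW xy)).
by rewrite mulrC; apply: ler_wpM2l => //; rewrite lerDl.
Qed.

Lemma measurable_lipschitz : measurable_fun setT (fun x => (f x)%:E).
Proof.
by apply/measurable_EFinP; apply: continuous_measurable_mx; exact: lipschitz_continuous.
Qed.

Lemma measurable_heat_integrand t x s :
  measurable_fun setT (fun z => ((f (x + s *: z)%R)%:E * (heat_kernel t z)%:E)%E).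
Proof.
apply: emeasurable_funM; last exact: measurable_heat_kernel.
exact: (measurableT_comp measurable_lipschitz (measurable_rV_translate s x)).
Qed.

Lemma heat_integrand_ge0 t x s z : (0 <= (f (x + s *: z)%R)%:E * (heat_kernel t z)%:E)%E.
Proof. by apply: mule_ge0; rewrite lee_fin//; exact: heat_kernel_ge0. Qed.

Definition rheat t x : R := fine (heat t (EFin \o f) x).

Lemma heat_lipschitz_le t x : (heat t (EFin \o f) x <= M%:E)%E.
Proof.
rewrite -[M%:E]mule1 -(@integral_heat_kernel R d 1 ltr01).
have M0 : 0 <= M by apply: le_trans (f0 0) (fM 0).
rewrite -ge0_integralZT; [|exact: M0|exact: measurable_heat_kernel|
  by move=> z; rewrite lee_fin; exact: heat_kernel_ge0].
apply: ge0_le_integralT.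
- exact: measurable_heat_integrand.
- by apply: measurable_funeM; exact: measurable_heat_kernel.
- exact: heat_integrand_ge0.
- move=> z; apply: lee_wpmul2r; rewrite lee_fin; first exact: heat_kernel_ge0.
  exact: fM.
Qed.

Lemma heat_lipschitz_ge0 t x : (0 <= heat t (EFin \o f) x)%E.
Proof. by apply: integral_ge0 => z _; exact: heat_integrand_ge0. Qed.

Lemma rheatE t x : heat t (EFin \o f) x = (rheat t x)%:E.
Proof.
rewrite fineK// ge0_fin_numE; last exact: heat_lipschitz_ge0.
by apply: le_lt_trans (heat_lipschitz_le t x) _; rewrite ltry.
Qed.

Lemma rheat_le t x : rheat t x <= M.
Proof. by rewrite -lee_fin -rheatE; exact: heat_lipschitz_le. Qed.

Lemma rheat_ge0 t x : 0 <= rheat t x.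
Proof. by rewrite -lee_fin -rheatE; exact: heat_lipschitz_ge0. Qed.

Lemma rheat0 x : rheat 0 x = f x.
Proof.
apply: EFin_inj; rewrite -rheatE /heat sqrtr0.
under eq_integral do rewrite scale0r addr0.
rewrite ge0_integralZT; [|exact: f0|exact: measurable_heat_kernel|
  by move=> z; rewrite lee_fin; exact: heat_kernel_ge0].
by rewrite integral_heat_kernel// mule1.
Qed.

Definition rheat_modulus : R := k * (1 + heat_moment 1).

(** Lipschitz in space and Hoelder of order 1/2 in time, down to t = 0: both flows are compared at
    the same z. The bound |z| <= 1 + |z|^2 replaces the first moment by the mass and the second
    moment. *)
Lemma rheat_dist_le t s x y :
  rheat t x <= rheat s y + k * `|x - y| + rheat_modulus * `|Num.sqrt t - Num.sqrt s|.
Proof.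
set a := `|x - y|; set b := `|Num.sqrt t - Num.sqrt s|.
have a0 : 0 <= k * a by apply: mulr_ge0 => //; exact: normr_ge0.
have b0 : 0 <= k * b by apply: mulr_ge0 => //; exact: normr_ge0.
rewrite -lee_fin [in leRHS]EFinD [in leRHS]EFinD -!rheatE.
have h1 : ((k * a + k * b)%:E * \int[lebesgue_rV d]_z (@heat_kernel R d 1 z)%:E = (k * a + k * b)%:E)%E.
  by rewrite integral_heat_kernel// mule1.
have h2 : ((k * b)%:E * \int[lebesgue_rV d]_z (@sqnorm R d z * heat_kernel 1 z)%:E = (k * b * heat_moment 1)%:E)%E.
  by rewrite heat_momentE// EFinM.
have -> : (heat s (EFin \o f) y + (k * a)%:E + (rheat_modulus * b)%:E =
   heat s (EFin \o f) y + ((k * a + k * b)%:E + (k * b * heat_moment 1)%:E))%E.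
  by rewrite -addeA -!EFinD; congr (_ + _%:E)%E; rewrite /rheat_modulus; ring.
rewrite -h1 -h2.
rewrite -ge0_integralZT; [|exact: addr_ge0|exact: measurable_heat_kernel|
  by move=> z; rewrite lee_fin; exact: heat_kernel_ge0].
rewrite -ge0_integralZT; [|exact: b0|exact: measurable_moment|exact: moment_ge0].
have mk c : measurable_fun setT (fun z : 'rV[R]_d => (c%:E * (heat_kernel 1 z)%:E)%E).
  by apply: measurable_funeM; exact: measurable_heat_kernel.
have mm c : measurable_fun setT (fun z : 'rV[R]_d => (c%:E * (sqnorm z * heat_kernel 1 z)%:E)%E).
  by apply: measurable_funeM; exact: measurable_moment.
have pk z c : 0 <= c -> (0 <= c%:E * (heat_kernel 1 z)%:E)%E.
  by move=> c0; apply: mule_ge0; rewrite lee_fin//; exact: heat_kernel_ge0.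
have pm z c : 0 <= c -> (0 <= c%:E * (sqnorm z * heat_kernel 1 z)%:E)%E.
  by move=> c0; apply: mule_ge0; [rewrite lee_fin|exact: moment_ge0].
rewrite -ge0_integralDT; [|exact: mk|exact: mm|
  by move=> z; apply: pk; exact: addr_ge0|by move=> z; exact: pm].
rewrite /heat -ge0_integralDT; [|exact: measurable_heat_integrand|
  by apply: emeasurable_funD; [exact: mk|exact: mm]|exact: heat_integrand_ge0|
  by move=> z; apply: adde_ge0; [apply: pk; exact: addr_ge0|exact: pm]].
apply: ge0_le_integralT.
- exact: measurable_heat_integrand.
- apply: emeasurable_funD; first exact: measurable_heat_integrand.
  by apply: emeasurable_funD; [exact: mk|exact: mm].
- exact: heat_integrand_ge0.
move=> z /=; rewrite -!EFinM -!EFinD lee_fin.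
rewrite [leRHS](_ : _ = (f (y + Num.sqrt s *: z) + k * a + k * b * (1 + sqnorm z)) * heat_kernel 1 z); last by ring.
apply: ler_wpM2r; first exact: heat_kernel_ge0.
have := le_trans (ler_norm _) (flip (x + Num.sqrt t *: z) (y + Num.sqrt s *: z)).
have : k * `|x + Num.sqrt t *: z - (y + Num.sqrt s *: z)| <= k * a + k * b * (1 + sqnorm z).
  rewrite -mulrA -mulrDr; apply: ler_wpM2l => //.
  rewrite (_ : _ - _ = (x - y) + (Num.sqrt t - Num.sqrt s) *: z); last first.
    by rewrite scalerBl opprD addrACA.
  apply: le_trans (ler_normD _ _) _; rewrite lerD2l normrZ -/b.
  apply: ler_wpM2l; first exact: normr_ge0.
  apply: le_trans (norm_le_enorm _) _.
  rewrite -sqr_enorm; have := enorm_ge0 z; have := sqr_ge0 (enorm z - 1); nra.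
lra.
Qed.

(* A ball average and the matching backward time step compensate up to O(s^4). *)
Lemma heat_spacetime t s x : 0 < t -> s ^+ 2 <= 4 * t -> 0 <= sigma -> sigma * s ^+ 2 <= t ->
  ((2 * rheat t x)%:E <=
   \int[@uball R d]_y (rheat t (x + s *: y))%:E +
   (rheat (t - sigma * s ^+ 2 / 2) x + @heat_error R d t * heat_moment t * M * s ^+ 4)%:E)%E.
Proof.
move=> t0 st sg0 sst; set tau := sigma * s ^+ 2 / 2.
have tt0 : 0 < t - tau by rewrite /tau; lra.
have e0 : 0 <= @heat_error R d t * s ^+ 4.
  apply: mulr_ge0; last exact: exprn_even_ge0.
  apply: mulr_ge0; last by rewrite exprn_ge0// invr_ge0; lra.
  by apply: addr_ge0 => //; apply: mulr_ge0; [apply: mulr_ge0 => //; apply: addr_ge0|exact: sqr_ge0].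
have M0 : 0 <= M by apply: le_trans (f0 0) (fM 0).
have mfx (u : 'rV[R]_d) : measurable_fun setT (fun z => (f (u + z))%:E).
  apply: (measurableT_comp measurable_lipschitz).
  by have := measurable_rV_shift u; under eq_fun do rewrite addrC.
have mfk u r : measurable_fun setT (fun z => ((f (u + z)%R)%:E * (heat_kernel r z)%:E)%E).
  by apply: emeasurable_funM; [exact: mfx|exact: measurable_heat_kernel].
have pfk u r z : (0 <= (f (u + z)%R)%:E * (heat_kernel r z)%:E)%E.
  by apply: mule_ge0; rewrite lee_fin//; exact: heat_kernel_ge0.
have hE r u : 0 < r -> (rheat r u)%:E = (\int[lebesgue_rV d]_z ((f (u + z)%R)%:E * (heat_kernel r z)%:E))%E.
  by move=> r0; rewrite -rheatE heatE; [by []|exact: r0|exact: measurable_lipschitz|move=> y; rewrite lee_fin].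
(* After a translation of z, Tonelli moves the ball average from the flow onto the kernel, where
   [heat_kernel_ineq] applies pointwise. *)
pose F (p : 'rV[R]_d * 'rV[R]_d) : \bar R := ((f (x + p.1)%R)%:E * (heat_kernel t (p.1 - s *: p.2)%R)%:E)%E.
have mF : measurable_fun setT F.
  apply: emeasurable_funM.
    exact: (measurableT_comp (mfx x) measurable_fst).
  apply: (measurableT_comp (measurable_heat_kernel t)).
  apply: measurable_fun_mx => i j; under eq_fun do rewrite !mxE.
  apply: measurable_funB.
    exact: (measurableT_comp (coord_measurable_mx i j) measurable_fst).
  apply: measurable_funM => //.
  exact: (measurableT_comp (coord_measurable_mx i j) measurable_snd).
have F0 p : (0 <= F p)%E by apply: mule_ge0; rewrite lee_fin//; exact: heat_kernel_ge0.
have swap : (\int[@uball R d]_y (rheat t (x + s *: y)%R)%:E =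
    \int[lebesgue_rV d]_z \int[@uball R d]_y F (z, y))%E.
  rewrite (fubini_tonelli F mF F0); apply: eq_integral => y _; rewrite (hE t _ t0).
  have mG : measurable_fun setT (fun z => F (z, y)) by exact: measurableT_comp mF (measurable_pair2 y).
  rewrite -(ge0_integral_rV_shift (s *: y) mG (fun z => F0 _)).
  by apply: eq_integral => z _; rewrite /F/= addrK -addrA [s *: y + z]addrC.
have inner z : (\int[@uball R d]_y F (z, y) = (f (x + z)%R)%:E * \int[@uball R d]_y (heat_kernel t (z - s *: y)%R)%:E)%E.
  rewrite /F/= ge0_integralZT; [by []|exact: f0| |by move=> y; rewrite lee_fin; exact: heat_kernel_ge0].
  apply: (measurableT_comp (measurable_heat_kernel t)).
  by have := measurable_rV_translate (- s) z; under eq_fun do rewrite scaleNr.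
have mI : measurable_fun setT (fun z => (\int[@uball R d]_y F (z, y))%E).
  exact: measurable_fun_fubini_tonelli_F.
have I0 z : (0 <= \int[@uball R d]_y F (z, y))%E by exact: integral_ge0.
pose E z := ((@heat_error R d t * s ^+ 4 * M)%:E * (sqnorm z * heat_kernel t z)%:E)%E.
have mE : measurable_fun setT E by apply: measurable_funeM; exact: measurable_moment.
have E0 z : (0 <= E z)%E by apply: mule_ge0; [rewrite lee_fin; exact: mulr_ge0|exact: moment_ge0].
have EI : (\int[lebesgue_rV d]_z E z = (@heat_error R d t * heat_moment t * M * s ^+ 4)%:E)%E.
  rewrite ge0_integralZT; [|exact: mulr_ge0|exact: measurable_moment|exact: moment_ge0].
  by rewrite heat_momentE// -EFinM; congr EFin; ring.
rewrite EFinD swap -EI (hE (t - tau) x tt0) EFinM (hE t x t0).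
rewrite -ge0_integralZT; [|by []|exact: mfk|exact: pfk].
rewrite -ge0_integralDT; [|exact: mfk|exact: mE|exact: pfk|exact: E0].
rewrite -ge0_integralDT; [|exact: mI|by apply: emeasurable_funD|exact: I0|
  by move=> z; apply: adde_ge0].
apply: ge0_le_integralT.
- by apply: measurable_funeM; exact: mfk.
- by apply: emeasurable_funD => //; apply: emeasurable_funD.
- by move=> z; apply: mule_ge0.
move=> z; have K := heat_kernel_ineq z t0 st sg0 sst.
rewrite inner.
have := lee_wpmul2l (_ : (0 <= (f (x + z))%:E)%E) K.
move=> /(_ (f0 _)) {}K.
rewrite muleCA -EFinM.
apply: le_trans K _; rewrite ge0_muleDr; [|by apply: integral_ge0 => y _; rewrite lee_fin; exact: heat_kernel_ge0|].
  apply: leeD2l; rewrite /E -!EFinM -EFinD lee_fin mulrDr lerD2l.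
  rewrite mulrCA -[leRHS]mulrA; apply: ler_wpM2l => //.
  by apply: ler_wpM2r; [apply: mulr_ge0; [exact: sqnorm_ge0|exact: heat_kernel_ge0]|exact: fM].
rewrite lee_fin; apply: addr_ge0; first exact: heat_kernel_ge0.
by apply: mulr_ge0 => //; apply: mulr_ge0; [exact: sqnorm_ge0|exact: heat_kernel_ge0].
Qed.

End lipschitz_data.
End heat_flow.

(** * Comparison with the heat flow *)

Section lower_semicontinuous_minimum.
Context {R : realType}.

(** The sets {f < c} with c above the infimum generate a filter; lower semicontinuity forbids f to
    exceed the infimum at a cluster point of it. *)
Lemma lower_semicontinuous_compact_min (T : topologicalType) (K : set T) (f : T -> \bar R) :
  compact K -> K !=set0 -> lower_semicontinuous f ->
  exists2 x, K x & forall y, K y -> (f x <= f y)%E.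
Proof.
move=> cK [x0 Kx0] scf; pose e := ereal_inf (f @` K).
have [ey|ey] := eqVneq e +oo%E.
  exists x0 => // y Ky; have : (e <= f y)%E by apply: ereal_inf_lbound; exists y.
  by rewrite ey leye_eq => /eqP ->; rewrite leey.
pose B (c : \bar R) := K `&` [set y | (f y < c)%E].
pose F : set_system T := filter_from [set c | (e < c)%E] B.
have FF : ProperFilter F.
  apply: filter_from_proper; last first.
    move=> c /= /ereal_inf_lt[_ [y Ky <-] fy]; by exists y.
  apply: filter_from_filter; first by exists +oo%E; rewrite /= ltey.
  move=> c c' /= ec ec'; exists (mine c c'); first by rewrite /= lt_min ec.
  by move=> y [Ky]; rewrite /= lt_min => /andP[fc fc']; split.
have FK : F K by exists +oo%E; [rewrite /= ltey|move=> y []].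
have [p [Kp clp]] := cK F FF FK.
exists p => // y Ky; apply: (@le_trans _ _ e); last by apply: ereal_inf_lbound; exists y.
rewrite leNgt; apply/negP => efp.
have [a ea afp] : exists2 a : R, (e < a%:E)%E & (a%:E < f p)%E.
  move: ey efp; case: (e) => [r| |] // _; case: (f p) => [q| |] //.
  - by rewrite lte_fin => rq; exists ((r + q) / 2); rewrite lte_fin; lra.
  - by move=> _; exists (r + 1); rewrite ?ltry// lte_fin; lra.
  - by move=> _; exists (q - 1); rewrite ?ltNyr// lte_fin; lra.
  - by move=> _; exists 0; rewrite ?ltNyr// ltry.
have [V pV Va] := scf p a afp.
have FB : F (B a%:E) by exists a%:E.
have [z [[_ /= fz] Vz]] := clp _ _ FB pV.
by have := lt_trans fz (Va z Vz); rewrite ltxx.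
Qed.

Lemma lower_semicontinuousD (T : topologicalType) (f : T -> \bar R) (g : T -> R) :
  lower_semicontinuous f -> (forall x, -oo < f x)%E -> continuous g ->
  lower_semicontinuous (fun x => f x + (g x)%:E)%E.
Proof.
move=> scf fN cg x a afg.
have [b bf bg] : exists2 b : R, (b%:E < f x)%E & a - b < g x.
  have := fN x; move: afg; case: (f x) => [r| |]//.
    rewrite -EFinD lte_fin => h _; exists (r - (r + g x - a) / 2); rewrite ?lte_fin; lra.
  by move=> _ _; exists (a - g x + 1); rewrite ?ltry//; lra.
have [V xV Vb] := scf x b bf.
have : \forall y \near x, a - b < g y.
  by have := cg x; move/cvgr_gt => /(_ _ bg).
move=> gV; exists (V `&` [set y | a - b < g y]); first exact: filterI.
move=> y [/Vb bfy /= gy]; rewrite -(subrK b a) addrC EFinD.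
by apply: lteD => //; rewrite lte_fin.
Qed.

End lower_semicontinuous_minimum.

Section integral_shift.
Local Open Scope ereal_scope.

Lemma adde_ge0_geN (R : realType) (u : \bar R) (C : R) : (- C)%:E <= u -> 0 <= u + C%:E.
Proof.
by case: u => [r| |]//; [rewrite -EFinD !lee_fin -lerBlDr sub0r|rewrite addye].
Qed.

(** The integral of h may be infinite. With P and N the positive and negative parts of h - C, one
    has h + N = P + C among nonnegative functions, and N has a finite integral as N <= C. *)
Lemma integral_subC d (T : measurableType d) (R : realType)
    (m : {measure set T -> \bar R}) (D : set T) (h : T -> \bar R) (C : R) :
  measurable D -> m D < +oo -> (0 <= C)%R -> measurable_fun D h ->
  (forall x, D x -> 0 <= h x) ->
  \int[m]_(x in D) (h x - C%:E) = \int[m]_(x in D) h x - C%:E * m D.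
Proof.
move=> mD mDoo C0 mh h0.
have mf : measurable_fun D (fun x => h x - C%:E) by exact: emeasurable_funB.
have mDfin : m D \is a fin_num by rewrite ge0_fin_numE.
pose P x := maxe (h x - C%:E) 0; pose N x := maxe (- (h x - C%:E)) 0.
have P0 x : 0 <= P x by rewrite le_max lexx orbT.
have N0 x : 0 <= N x by rewrite le_max lexx orbT.
have mP : measurable_fun D P by exact: measurable_maxe.
have mN : measurable_fun D N.
  by apply: measurable_maxe => //; exact: measurableT_comp.
have -> : \int[m]_(x in D) (h x - C%:E) = \int[m]_(x in D) P x - \int[m]_(x in D) N x.
  by rewrite integralE; congr (_ - _)%E; apply: eq_integral => x _; rewrite ?funeposE ?funenegE.
have NC : \int[m]_(x in D) N x <= C%:E * m D.
  rewrite -(@integral_cst _ _ _ m D mD C%:E).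
  apply: ge0_le_integral; [exact: mD|by move=> x _|exact: mN|exact: measurable_cst|].
  move=> x Dx; rewrite /N/= ge_max lee_fin C0 andbT.
  move: (h0 x Dx); case: (h x) => [r| |]//=; last by rewrite leNye.
  by rewrite -?EFinD -?EFinN !lee_fin => r0; lra.
have Nfin : \int[m]_(x in D) N x \is a fin_num.
  rewrite ge0_fin_numE; last exact: integral_ge0.
  by apply: le_lt_trans NC _; rewrite -(fineK mDfin) -EFinM ltry.
have sum : \int[m]_(x in D) h x + \int[m]_(x in D) N x = \int[m]_(x in D) P x + C%:E * m D.
  rewrite -[X in _ = _ + X]integral_cst// -ge0_integralD// -ge0_integralD//.
  apply: eq_integral => x /[!inE] Dx; rewrite /N /P /=.
  move: (h0 x Dx); case: (h x) => [r| |]//=; last first.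
    by move=> _; rewrite max_r ?leNye// adde0 addye// max_l// leey.
  rewrite -?EFinD -?EFinN lee_fin => r0.
  rewrite -?fine_max//= -?EFin_max -?EFinD; congr EFin; rewrite /maxr; case: ltP => ?; case: ltP => ?; lra.
move: sum; rewrite -(fineK Nfin) -(fineK mDfin) -EFinM.
by case: (\int[m]_(x in D) h x) => [r| |]; case: (\int[m]_(x in D) P x) => [q| |]//=;
  rewrite -?EFinD => -[] ?; congr EFin; lra.
Qed.

End integral_shift.

Section gen_laplacian_bound.
Context {R : realType} {d : nat}.
Implicit Types x y z : 'rV[R]_d.

Lemma lebesgue_eball_gt0 (e : R) : 0 < e ->
  exists2 l : R, 0 < l & lebesgue_rV d (eball 0 e) = l%:E.
Proof.
move=> e0; have ed : 0 < `|e| ^- d by rewrite invr_gt0 exprn_gt0// normr_gt0 gt_eqF.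
have : (0 < lebesgue_rV d (eball (0 : 'rV[R]_d) 1) < +oo)%E.
  by rewrite lebesgue_eball1_gt0 lebesgue_eball1_lty.
rewrite (lebesgue_eball1E d e0).
case: (lebesgue_rV d (eball 0 e)) => [l| |].
- rewrite -EFinM !lte_fin => /andP[l0 _]; exists l => //.
  by move: l0; rewrite pmulr_rgt0.
- by rewrite gt0_muley ?lte_fin//= ltxx andbF.
- by rewrite gt0_muleNy ?lte_fin//=.
Qed.

(** Converts an average of the nonnegative W + C over the unit ball into the discrete Laplacian; the
    average is allowed to be infinite. *)
Lemma gen_laplacian_ge (W : 'rV[R]_d -> \bar R) (C s w0 q : R) x0 :
  0 <= C -> (forall x, (- C)%:E <= W x)%E -> measurable_fun setT W ->
  0 < s -> W x0 = w0%:E ->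
  ((w0 + C + q)%:E <= \int[@uball R d]_y (W (x0 + s *: y)%R + C%:E))%E ->
  (((2 * (d + 2))%:R / s ^+ 2 * q)%:E <= gen_laplacian s W x0)%E.
Proof.
move=> C0 WC mW s0 Wx0 h.
have [l l0 lE] := lebesgue_eball_gt0 s0.
have k0 : 0 <= (2 * (d + 2))%:R / s ^+ 2 :> R by rewrite divr_ge0// sqr_ge0.
rewrite /gen_laplacian Wx0 /= EFinM; apply: lee_wpmul2l; first by rewrite lee_fin.
have mWx : measurable_fun setT (fun y => W (x0 + y)).
  by apply: (measurableT_comp mW); have := measurable_rV_shift x0; under eq_fun do rewrite addrC.
have mw : measurable_fun setT (fun y => (W (x0 + y)%R + C%:E)%E) by exact: emeasurable_funD.
have w_ge0 y : (0 <= W (x0 + y)%R + C%:E)%E by exact: adde_ge0_geN.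
have mB : measurable (eball (0 : 'rV[R]_d) s) by exact: measurable_eball.
have -> : (\int[lebesgue_rV d]_(y in eball 0%R s) W (x0 + y)%R =
  \int[lebesgue_rV d]_(y in eball 0%R s) ((W (x0 + y)%R + C%:E) - C%:E))%E.
  by apply: eq_integral => y _; rewrite addeK.
have lty : (lebesgue_rV d (eball 0 s) < +oo)%E by rewrite lE ltry.
rewrite integral_subC; [|exact: mB|exact: lty|exact: C0|exact: measurable_funS mw|by move=> y _].
rewrite [X in (_ - C%:E * X)%E](_ : _ = l%:E); last exact: lE.
move: h; rewrite -(eball_average s0 mw w_ge0) lE inver gt_eqF//.
case: (\int[lebesgue_rV d]_(y in eball 0%R s) _)%E => [r| |].
- rewrite -!EFinM !lee_fin => h.
  have -> : l^-1 * (r - C * l) - w0 = l^-1 * r - C - w0 by field; rewrite gt_eqF.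
  by move: h; lra.
- by move=> _; rewrite -EFinM addye// gt0_muley ?lte_fin ?invr_gt0// addye// leey.
- by rewrite gt0_muleNy ?lte_fin ?invr_gt0.
Qed.

End gen_laplacian_bound.

Section continuous_real.
Context {R : realType} {T : topologicalType}.

Lemma continuous_cstr (c : R) : continuous (fun _ : T => c).
Proof. by move=> t; exact: cvg_cst. Qed.

Lemma continuous_addr (f g : T -> R) :
  continuous f -> continuous g -> continuous (fun t => f t + g t).
Proof. by move=> cf cg t; apply: cvgD; [exact: cf|exact: cg]. Qed.

Lemma continuous_scaler (c : R) (f : T -> R) :
  continuous f -> continuous (fun t => c * f t).
Proof. by move=> cf t; apply: cvgM; [exact: cvg_cst|exact: cf]. Qed.

End continuous_real.

Section mean_sub.
Context {R : realType} {d : nat}.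
Implicit Types x y z : 'rV[R]_d.
Local Notation sigma := (@usig R d).

(* An integrated upper bound on the Laplacian of [b]. *)
Definition mean_sub (b : 'rV[R]_d -> R) (B : R) := forall x (s : R), 0 < s ->
  (\int[@uball R d]_y (b (x + s *: y)%R)%:E <= (b x + B * s ^+ 2)%:E)%E.

(** By the parallelogram law, averaging y and -y leaves exactly |x|^2 + s^2 |y|^2. *)
Lemma mean_sub_sqnorm : mean_sub (@sqnorm R d) (d%:R * sigma).
Proof.
move=> x s s0.
have mn : measurable_fun setT (fun y : 'rV[R]_d => (sqnorm y)%:E).
  by apply/measurable_EFinP; apply: measurable_sqnorm.
have n0 y : (0 <= (sqnorm y)%:E)%E by rewrite lee_fin sqnorm_ge0.
have mt := measurableT_comp mn (measurable_rV_translate s x).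
have mtN : measurable_fun setT (fun y => (sqnorm (x - s *: y))%:E).
  apply: (measurableT_comp mn).
  by have := measurable_rV_translate (- s) x; under eq_fun do rewrite scaleNr.
have par : (\int[@uball R d]_y (sqnorm (x + s *: y)%R)%:E + \int[@uball R d]_y (sqnorm (x + s *: y)%R)%:E =
   (2 * s ^+ 2 * (d%:R * sigma) + 2 * sqnorm x)%:E)%E.
  rewrite [X in (_ + X)%E](uball_sym s x mn n0) -ge0_integralDT; [|exact: mt|exact: mtN|by []|by []].
  rewrite -uball_sqnorm_affine; [|by apply: mulr_ge0 => //; exact: sqr_ge0|
    by apply: mulr_ge0 => //; exact: sqnorm_ge0].
  apply: eq_integral => y _; rewrite -!EFinD; congr EFin.
  by rewrite sqnormD sqnormB sqnormZ; ring.
move: par; case: (\int[@uball R d]_y _)%E => [r| |]//.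
by rewrite -EFinD => -[] h; rewrite lee_fin; lra.
Qed.

Lemma mean_subD (b1 b2 : 'rV[R]_d -> R) (l1 l2 B1 B2 : R) :
  continuous b1 -> continuous b2 -> (forall x, 0 <= b1 x) -> (forall x, 0 <= b2 x) ->
  0 <= l1 -> 0 <= l2 -> mean_sub b1 B1 -> mean_sub b2 B2 ->
  mean_sub (fun x => l1 * b1 x + l2 * b2 x) (l1 * B1 + l2 * B2).
Proof.
move=> c1 c2 p1 p2 l10 l20 m1 m2 x s s0.
have mb (b : 'rV[R]_d -> R) : continuous b -> measurable_fun setT (fun y => (b (x + s *: y))%:E).
  move=> cb; apply: (@measurableT_comp _ _ _ _ _ _ (EFin \o b)); last exact: measurable_rV_translate.
  by apply/measurable_EFinP; exact: continuous_measurable_mx.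
have -> : (\int[@uball R d]_y (l1 * b1 (x + s *: y) + l2 * b2 (x + s *: y))%R%:E =
  l1%:E * \int[@uball R d]_y (b1 (x + s *: y)%R)%:E + l2%:E * \int[@uball R d]_y (b2 (x + s *: y)%R)%:E)%E.
  rewrite -ge0_integralZT; [|exact: l10|exact: mb|by move=> y; rewrite lee_fin].
  rewrite -ge0_integralZT; [|exact: l20|exact: mb|by move=> y; rewrite lee_fin].
  rewrite -ge0_integralDT; [|by apply: measurable_funeM; exact: mb|by apply: measurable_funeM; exact: mb|
    by move=> y; apply: mule_ge0; rewrite lee_fin|by move=> y; apply: mule_ge0; rewrite lee_fin].
  by apply: eq_integral => y _; rewrite EFinD !EFinM.
rewrite (_ : l1 * b1 x + _ + _ = l1 * (b1 x + B1 * s ^+ 2) + l2 * (b2 x + B2 * s ^+ 2)); last by ring.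
rewrite EFinD !EFinM; apply: leeD; apply: lee_wpmul2l; rewrite ?lee_fin//.
  exact: m1.
exact: m2.
Qed.

End mean_sub.

Lemma ler_dist_symmetric (R : realFieldType) (u v r1 r2 : R) :
  u <= v + r1 + r2 -> v <= u + r1 + r2 -> `|u - v| <= r1 + r2.
Proof. by move=> h1 h2; rewrite ler_norml; apply/andP; split; lra. Qed.

(** * Comparison for Lipschitz data below W + C *)

Section comparison.
Context {R : realType} {d : nat}.
Implicit Types x y z : 'rV[R]_d.
Local Notation sigma := (@usig R d).
Variables (W : 'rV[R]_d -> \bar R) (C : R).
Hypothesis C0 : 0 <= C.
Hypothesis WC : forall x, ((- C)%:E <= W x)%E.
Hypothesis scW : lower_semicontinuous W.
Hypothesis sigma0 : 0 < sigma.
Variables (a : 'rV[R]_d -> R) (A0 B : R).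
Hypothesis ca : continuous a.
Hypothesis A00 : 0 <= A0.
Hypothesis aA0 : forall x, 0 <= a x + A0.
Hypothesis B0 : 0 <= B.
Hypothesis maB : mean_sub (fun x => a x + A0) B.
Hypothesis lapW : forall x, (gen_laplacian0 W x <= (a x)%:E)%E.
Variables (f : 'rV[R]_d -> R) (M k : R).
Hypothesis f0 : forall x, 0 <= f x.
Hypothesis fM : forall x, f x <= M.
Hypothesis k0 : 0 <= k.
Hypothesis flip : forall x y, `|f x - f y| <= k * `|x - y|.
Hypothesis fW : forall x, ((f x)%:E <= W x + C%:E)%E.

(* To order s^2, averaging over a ball of radius s is running the heat flow for
   time s^2 sigma / 2.  Hence the normalised Laplacian 2(d+2)/s^2 (average - value)
   is (d+2) sigma times the time derivative. *)
Definition heat_speed : R := ((d + 2)%:R * sigma)^-1.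
Local Notation lam := heat_speed.
Local Notation kap := ((2 * (d + 2))%:R : R).

Lemma heat_speed_gt0 : 0 < lam.
Proof. by rewrite invr_gt0 mulr_gt0// ltr0n addn_gt0 orbT. Qed.

Lemma continuous_rheat : continuous (fun p : R * 'rV[R]_d => rheat f p.1 p.2).
Proof.
move=> p; apply/(@cvgrPdist_le _ _ _ (nbhs p) (nbhs_filter p)) => e e0.
pose h (q : R * 'rV[R]_d) := k * `|p.2 - q.2| + @rheat_modulus R d k * `|Num.sqrt p.1 - Num.sqrt q.1|.
have hp : h p = 0 by rewrite /h !subrr !normr0 !mulr0 addr0.
have ch : h q @[q --> p] --> h p.
  apply: cvgD.
    apply: cvgM; first exact: cvg_cst.
    by apply: cvg_norm; apply: cvgB; [exact: cvg_cst|exact: cvg_snd].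
  apply: cvgM; first exact: cvg_cst.
  apply: cvg_norm; apply: cvgB; first exact: cvg_cst.
  apply: (@continuous_comp _ _ _ (fun q : R * 'rV[R]_d => q.1) Num.sqrt); first exact: cvg_fst.
  exact: sqrt_continuous.
have := @cvgr_lt _ _ (nbhs p) (nbhs_filter p) h (h p) ch e.
rewrite hp => /(_ e0); apply: filterS => q hq.
have h1 := rheat_dist_le f0 fM k0 flip p.1 q.1 p.2 q.2.
have h2 := rheat_dist_le f0 fM k0 flip q.1 p.1 q.2 p.2.
rewrite distrC (distrC (Num.sqrt q.1)) in h2.
apply: (le_trans _ (ltW hq)); exact: (ler_dist_symmetric h1 h2).
Qed.

Section penalised.
Variables (eta eta' T : R).
Hypothesis eta0 : 0 < eta.
Hypothesis eta'0 : 0 < eta'.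
Hypothesis T0 : 0 <= T.
Hypothesis small : kap * (lam * T * B + eta' * (d%:R * sigma)) <= eta.

(** The continuous part of [Phi]. The term in eta' forces a minimum in unbounded space. Of the slack
    2 eta, one eta pays for the ball averages of a and of the penalty, eta/2 for the s^4 error, and
    eta/2 keeps the contradiction strict. *)
Let g (p : R * 'rV[R]_d) : R :=
  C + lam * p.1 * (a p.2 + 2 * eta) + eta' * sqnorm p.2 - rheat f p.1 p.2.
Let Phi (p : R * 'rV[R]_d) : \bar R := (W p.2 + (g p)%:E)%E.

Let continuous_g : continuous g.
Proof.
move=> p; apply: cvgB; last exact: continuous_rheat.
apply: cvgD.
  apply: cvgD; first exact: cvg_cst.
  apply: cvgM; first by apply: cvgM; [exact: cvg_cst|exact: cvg_fst].
  apply: cvgD; last exact: cvg_cst.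
  by apply: (@continuous_comp _ _ _ (fun q : R * 'rV[R]_d => q.2) a); [exact: cvg_snd|exact: ca].
apply: cvgM; first exact: cvg_cst.
apply: (@continuous_comp _ _ _ (fun q : R * 'rV[R]_d => q.2) (@sqnorm R d)); first exact: cvg_snd.
exact: continuous_sqnorm.
Qed.

Let WgtNy x : (-oo < W x)%E.
Proof. by apply: lt_le_trans (WC x); rewrite ltNyr. Qed.

Let W_ge0 x : (0 <= W x + C%:E)%E.
Proof. exact: adde_ge0_geN. Qed.

Let lsc_Phi : lower_semicontinuous Phi.
Proof.
apply: lower_semicontinuousD; [|by move=> p; exact: WgtNy|exact: continuous_g].
move=> p b bW; have [V pV Vb] := scW bW.
exists (snd @^-1` V); last by move=> q /Vb.
by have : (fun q : R * 'rV[R]_d => q.2) q @[q --> p] --> p.2; [exact: cvg_snd|apply].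
Qed.

Let Phi_min t1 x1 : 0 <= t1 <= T -> (Phi (t1, x1) < 0)%E ->
  exists t0 x0, [/\ 0 <= t0 <= T, (Phi (t0, x0) < 0)%E &
    forall t x, 0 <= t <= T -> (Phi (t0, x0) <= Phi (t, x))%E].
Proof.
(* Outside this box |x|^2 >= rho, so the penalty outweighs the bound M on the flow and the worst
   value -A0 of a. The summand 1 gives rho <= rho^2. *)
move=> t1T P1; pose rho := (M + lam * T * A0) / eta' + 1.
have l0 := heat_speed_gt0.
have M0 : 0 <= M by apply: le_trans (f0 0) (fM 0).
have rho1 : 1 <= rho.
  by rewrite /rho lerDr; apply: divr_ge0; [apply: addr_ge0 => //; apply: mulr_ge0 => //; apply: mulr_ge0 => //|]; exact: ltW.
pose box0 : set 'rV[R]_d := [set v | forall i, `[- rho, rho]%classic (v 0 i)].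
have cbox : compact box0 by apply: (@rV_compact _ d (fun=> `[- rho, rho]%classic)) => i; exact: segment_compact.
have cK : compact (`[0, T]%classic `*` box0) by apply: compact_setX => //; exact: segment_compact.
have out t x : 0 <= t <= T -> ~ box0 x -> (0 <= Phi (t, x))%E.
  move=> /andP[t0 tT] nx.
  have nq : rho <= sqnorm x.
    apply: contrapT => /negP; rewrite -ltNge => nr; apply: nx => i /=.
    rewrite in_itv/= -ler_norml; apply: (le_trans (norm_coord_le x 0 i)).
    apply: (le_trans (norm_le_enorm x)).
    rewrite -(@ler_pXn2r _ 2) ?nnegrE ?enorm_ge0//; last by rewrite (le_trans ler01).
    rewrite sqr_enorm (le_trans (ltW nr))// expr2 ler_peMr//.
    by rewrite (le_trans ler01).
  have : (0 <= (- C)%:E + (g (t, x))%:E)%E.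
    rewrite -EFinD lee_fin /g/=.
    have hM := rheat_le f0 fM k0 flip t x.
    have h1 : M + lam * T * A0 <= eta' * sqnorm x.
      have -> : M + lam * T * A0 = eta' * (rho - 1) by rewrite /rho; field; rewrite gt_eqF.
      by apply: ler_wpM2l; [exact: ltW|lra].
    have lt0 : 0 <= lam * t by apply: mulr_ge0 => //; exact: ltW.
    have h2 : - (lam * T * A0) <= lam * t * (a x + 2 * eta).
      have : 0 <= lam * t * (a x + A0) by apply: mulr_ge0.
      have : 0 <= lam * t * (2 * eta) by apply: mulr_ge0 => //; apply: mulr_ge0 => //; exact: ltW.
      have : lam * t * A0 <= lam * T * A0.
        by apply: ler_wpM2r => //; apply: ler_wpM2l => //; exact: ltW.
      lra.
    lra.
  by move=> /le_trans; apply; apply: leeD2r; exact: WC.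
have K0 : (`[0, T]%classic `*` box0) !=set0.
  exists (0, 0); split => /=; first by rewrite in_itv/= lexx.
  by move=> i; rewrite /= mxE in_itv/= oppr_le0 (le_trans ler01).
have [[t0 x0] [/= t0T bx0] minP] := lower_semicontinuous_compact_min cK K0 lsc_Phi.
move: t0T; rewrite in_itv/= => t0T.
have bx1 : box0 x1 by apply: contrapT => /(out _ _ t1T); rewrite leNgt P1.
have P0 : (Phi (t0, x0) < 0)%E.
  by apply: le_lt_trans P1; apply: minP; split => //=; rewrite in_itv.
exists t0, x0; split; [exact: t0T|exact: P0|move=> t x tT]; have [bx|nbx] := pselect (box0 x).
  by apply: minP; split => //=; rewrite in_itv.
by apply: le_trans (ltW P0) _; exact: out.
Qed.

(** Minimality in time bounds the flow at t0 - tau from above, and minimality in space bounds the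
    average of W from below by that of the flow; [heat_spacetime] joins the two bounds. *)
Let laplacian_at_min t0 x0 s : 0 < t0 <= T -> (Phi (t0, x0) < 0)%E ->
  (forall t x, 0 <= t <= T -> (Phi (t0, x0) <= Phi (t, x))%E) ->
  0 < s -> s ^+ 2 <= 4 * t0 -> sigma * s ^+ 2 <= t0 ->
  kap * (@heat_error R d t0 * @heat_moment R d t0 * M) * s ^+ 2 <= eta / 2 ->
  ((a x0 + eta / 2)%:E <= gen_laplacian s W x0)%E.
Proof.
move=> /andP[t0p t0T] P0 minP s0 st ss sK.
have l0 := heat_speed_gt0.
set K := @heat_error R d t0 * @heat_moment R d t0 * M in sK.
have [w0 Ww0] : exists w0, W x0 = w0%:E.
  move: P0 (WgtNy x0); rewrite /Phi/=; case: (W x0) => [r| |]//; first by exists r.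
pose tau := sigma * s ^+ 2 / 2.
have tau0 : 0 <= tau by apply: divr_ge0 => //; apply: mulr_ge0; [exact: ltW|exact: sqr_ge0].
have time : rheat f (t0 - tau) x0 <= rheat f t0 x0 - lam * tau * (a x0 + 2 * eta).
  have tin : 0 <= t0 - tau <= T by apply/andP; split; [rewrite /tau; lra|rewrite lerBlDr; apply: le_trans t0T _; rewrite lerDl].
  have := minP (t0 - tau) x0 tin.
  rewrite /Phi /= Ww0 -!EFinD lee_fin /g /=.
  move: (rheat f t0 x0) (rheat f (t0 - tau) x0) (eta' * sqnorm x0) (a x0 + 2 * eta) => u v n b.
  rewrite mulrBr mulrBl; move: (lam * t0 * b) (lam * tau * b) => p q; lra.
pose B' := lam * t0 * B + eta' * (d%:R * sigma).
(* The part of [g] that varies in space, shifted by lam t0 A0 to be nonnegative; all other constants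
   cancel between x0 and its neighbours. *)
pose b x := lam * t0 * (a x + A0) + eta' * sqnorm x.
have lt0 : 0 <= lam * t0 by apply: mulr_ge0; exact: ltW.
have b_ge0 x : 0 <= b x.
  by apply: addr_ge0; apply: mulr_ge0 => //; [exact: ltW|exact: sqnorm_ge0].
have caA : continuous (fun x => a x + A0) := @continuous_addr R _ a (fun=> A0) ca (@continuous_cstr R _ A0).
have cn := @continuous_sqnorm R d.
have mb : mean_sub b B'.
  exact: (mean_subD caA cn aA0 (@sqnorm_ge0 R d) lt0 (ltW eta'0) maB mean_sub_sqnorm).
have cb : continuous b := continuous_addr (@continuous_scaler R _ (lam * t0) _ caA) (@continuous_scaler R _ eta' _ cn).
have mW : measurable_fun setT W by exact: lower_semicontinuous_measurable_mx.
have mtr : measurable_fun setT (fun y => x0 + s *: y) by exact: measurable_rV_translate.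
have mbs : measurable_fun setT (fun y => (b (x0 + s *: y))%:E).
  apply: (@measurableT_comp _ _ _ _ _ _ (EFin \o b)) => //.
  by apply/measurable_EFinP; exact: continuous_measurable_mx.
have mWs : measurable_fun setT (fun y => (W (x0 + s *: y)%R + C%:E)%E).
  by apply: emeasurable_funD => //; exact: (measurableT_comp mW mtr).
have cv : continuous (rheat f t0).
  apply: (lipschitz_continuous k0) => x y.
  have h1 := rheat_dist_le f0 fM k0 flip t0 t0 x y.
  have h2 := rheat_dist_le f0 fM k0 flip t0 t0 y x.
  rewrite (distrC y) in h2.
  rewrite subrr normr0 in h1 h2.
  by rewrite -[leRHS]addr0 -(mulr0 (@rheat_modulus R d k)); exact: ler_dist_symmetric h1 h2.
have mvs : measurable_fun setT (fun y => (rheat f t0 (x0 + s *: y))%:E).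
  apply: (@measurableT_comp _ _ _ _ _ _ (EFin \o rheat f t0)) => //.
  by apply/measurable_EFinP; exact: continuous_measurable_mx.
have hge0 x : (0 <= (rheat f t0 x)%:E)%E by rewrite lee_fin; exact: (rheat_ge0 f0 fM k0 flip).
have wc0 : 0 <= w0 + C by have := W_ge0 x0; rewrite Ww0 -EFinD lee_fin.
have int : ((w0 + C + b x0)%:E + \int[@uball R d]_y (rheat f t0 (x0 + s *: y)%R)%:E <=
   \int[@uball R d]_y (W (x0 + s *: y)%R + C%:E) + ((b x0 + B' * s ^+ 2)%:E + (rheat f t0 x0)%:E))%E.
  apply: (@le_trans _ _ (\int[@uball R d]_y (W (x0 + s *: y)%R + C%:E) +
     (\int[@uball R d]_y (b (x0 + s *: y)%R)%:E + (rheat f t0 x0)%:E)))%E; last first.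
    by apply: leeD2l; apply: leeD2r; exact: mb.
  rewrite -(@integral_uball_cst R d (w0 + C + b x0)) -(@integral_uball_cst R d (rheat f t0 x0)).
  rewrite -ge0_integralDT; [|exact: measurable_cst|exact: mvs|by move=> y; rewrite lee_fin; exact: addr_ge0|by []].
  rewrite -[X in (_ <= _ + X)%E]ge0_integralDT; [|exact: mbs|exact: measurable_cst|by move=> y; rewrite lee_fin|by move=> y; exact: hge0].
  have mbv : measurable_fun setT (fun y => ((b (x0 + s *: y))%:E + cst (rheat f t0 x0)%:E y)%E).
    by apply: emeasurable_funD.
  have bv0 y : (0 <= (b (x0 + s *: y)%R)%:E + cst (rheat f t0 x0)%:E y)%E.
    by apply: adde_ge0; [rewrite lee_fin|exact: hge0].
  rewrite -ge0_integralDT; [|exact: mWs|exact: mbv|by []|exact: bv0].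
  apply: ge0_le_integralT.
  - by apply: emeasurable_funD; [exact: measurable_cst|exact: mvs].
  - by apply: emeasurable_funD; [exact: mWs|exact: mbv].
  - by move=> y; apply: adde_ge0; [rewrite lee_fin; exact: addr_ge0|exact: hge0].
  move=> y; set x := x0 + s *: y.
  have tin : 0 <= t0 <= T by rewrite (ltW t0p) t0T.
  have := minP t0 x tin; rewrite /Phi /= Ww0 /g /=.
  case: (W x) (WC x) => [r| |]; last by [].
    move=> _; rewrite -!EFinD !lee_fin /b.
    move: (rheat f t0 x0) (rheat f t0 x) (eta' * sqnorm x) (eta' * sqnorm x0) (a x) (a x0) => *; lra.
  by move=> _ _; rewrite ?addye// leey.
have := heat_spacetime f0 fM k0 flip x0 t0p st (ltW sigma0) ss.
rewrite -/tau -/K.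
move: int.
have Ifin : (\int[@uball R d]_y (rheat f t0 (x0 + s *: y)%R)%:E)%E \is a fin_num.
  rewrite ge0_fin_numE; last by apply: integral_ge0.
  apply: (@le_lt_trans _ _ (\int[@uball R d]_y (cst M%:E y))%E).
    by apply: ge0_le_integralT => // y; rewrite lee_fin; exact: (rheat_le f0 fM k0 flip).
  by rewrite integral_uball_cst ltry.
move: Ifin; case: (\int[@uball R d]_y (rheat f t0 (x0 + s *: y)%R)%:E)%E => // I _.
rewrite -!EFinD => int; rewrite lee_fin => st2.
pose q := lam * tau * (a x0 + 2 * eta) - K * s ^+ 4 - B' * s ^+ 2.
have hq : ((w0 + C + q)%:E <= \int[@uball R d]_y (W (x0 + s *: y)%R + C%:E))%E.
  move: int; case: (\int[@uball R d]_y (W (x0 + s *: y)%R + C%:E))%E => [r| |].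
  - by rewrite -EFinD !lee_fin /q; lra.
  - by move=> _; rewrite leey.
  - by [].
apply: le_trans (gen_laplacian_ge C0 WC mW s0 Ww0 hq); rewrite lee_fin.
have sn : s != 0 by rewrite gt_eqF.
(* Here kap lam tau / s^2 = 1, which is what determines [heat_speed]. *)
have -> : kap / s ^+ 2 * q = (a x0 + 2 * eta) - kap * K * s ^+ 2 - kap * B'.
  have sg : sigma != 0 by rewrite gt_eqF.
  have d2 : (d + 2)%:R != 0 :> R by rewrite pnatr_eq0 addn2.
  rewrite /q /tau /heat_speed natrM; move: ((d + 2)%:R) d2 => D D0.
  by field; rewrite ?sn ?sg ?D0.
have h1 : kap * B' <= eta.
  apply: le_trans small; rewrite /B'; apply: ler_wpM2l; first by rewrite ler0n.
  by rewrite lerD2r; apply: ler_wpM2r => //; apply: ler_wpM2l => //; exact: ltW.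
lra.
Qed.

Lemma heat_comparison_penalised t x : 0 <= t <= T ->
  ((rheat f t x)%:E <= W x + (C + lam * t * (a x + 2 * eta) + eta' * sqnorm x)%:E)%E.
Proof.
move=> tT; rewrite leNgt; apply/negP => lt1.
have P1 : (Phi (t, x) < 0)%E.
  move: lt1; rewrite /Phi /g/=; have := WgtNy x; case: (W x) => [r| |]//.
  by move=> _; rewrite -!EFinD !lte_fin; lra.
have [t0 [x0 [/andP[t00 t0T] P0 minP]]] := Phi_min tT P1.
(* At time 0 the flow is f <= W + C, so [Phi] cannot be negative there. *)
have t0p : 0 < t0.
  rewrite lt_neqAle t00 andbT; apply/eqP => t0E; move: P0; rewrite -t0E ltNge => /negP; apply.
  rewrite /Phi /g /= mulr0 mul0r addr0 (rheat0 f0 fM k0 flip).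
  have : 0 <= eta' * sqnorm x0 by apply: mulr_ge0; [exact: ltW|exact: sqnorm_ge0].
  have := fW x0; case: (W x0) => [r| |]; last by [].
    by rewrite -!EFinD !lee_fin; move: (eta' * _) (f x0) => u v h1 h2; lra.
  by move=> _ _; rewrite ?addye// leey.
have t0pT : 0 < t0 <= T by rewrite t0p.
pose K := @heat_error R d t0 * @heat_moment R d t0 * M.
(* The first two entries meet the conditions of [heat_spacetime], the third gives s^2 <= s, and the
   last makes the s^4 error at most eta/2. *)
pose s0 : R := Num.min (Num.min (4 * t0) (t0 / sigma)) (Num.min 1 (eta / 2 / (kap * `|K| + 1))).
have kK : 0 < kap * `|K| + 1 by rewrite ltr_wpDl// mulr_ge0// ler0n.
have s00 : 0 < s0.
  by rewrite !lt_min mulr_gt0//= divr_gt0//= ltr01/= divr_gt0// divr_gt0.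
have lap s : 0 < s -> s < s0 -> ((a x0 + eta / 2)%:E <= gen_laplacian s W x0)%E.
  move=> sp; rewrite !lt_min => /andP[/andP[s1 s2] /andP[s3 s4]].
  have ss : s ^+ 2 <= s by rewrite expr2 ler_piMr// ltW.
  apply: (@laplacian_at_min t0) => //.
  - by rewrite (le_trans ss)// ltW.
  - by rewrite (le_trans (ler_wpM2l (ltW sigma0) ss))// mulrC -ler_pdivlMr// ltW.
  - rewrite -/K; have : s * (kap * `|K| + 1) <= eta / 2 by rewrite -ler_pdivlMr// ltW.
    have : kap * K * s ^+ 2 <= kap * `|K| * s.
      apply: (@le_trans _ _ (kap * `|K| * s ^+ 2)); last by apply: ler_wpM2l => //; rewrite mulr_ge0// ler0n.
      apply: ler_wpM2r; first exact: sqr_ge0.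
      by apply: ler_wpM2l; [rewrite ler0n|exact: ler_norm].
    lra.
(* The liminf is a supremum of infima over neighbourhoods, so the bound on ]0, s0[ passes to it and
   contradicts [lapW]. *)
have : ((a x0 + eta / 2)%:E <= gen_laplacian0 W x0)%E.
  rewrite /gen_laplacian0 limf_einfE.
  apply: (@le_trans _ _ (ereal_inf ((fun e => gen_laplacian e W x0) @` [set s | 0 < s < s0]))).
    by apply: le_ereal_inf_tmp => _ [s /= /andP[sp ss] <-]; exact: lap.
  apply: ereal_sup_ubound; exists [set s | 0 < s < s0] => //.
  rewrite /at_right /within/=; near=> s; move=> sp; rewrite /= sp/=.
  by near: s; exact: lt_nbhsl.
move=> /le_trans /(_ (lapW x0)); rewrite lee_fin gerDl leNgt divr_gt0.
Unshelve. all: by end_near. Qed.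

End penalised.

End comparison.

(** * Approximation from below by bounded Lipschitz functions *)

Section lipschitz_approximation.
Context {R : realType} {d : nat}.
Implicit Types x y z : 'rV[R]_d.
Variable w : 'rV[R]_d -> \bar R.
Hypothesis w0 : forall x, (0 <= w x)%E.
Hypothesis scw : lower_semicontinuous w.

(** Truncation removes the value +oo and provides the upper bound M required of Lipschitz data. *)
Definition truncate_at (n : nat) y : R := fine (mine (w y) n%:R%:E).

Lemma truncate_atE n y : (truncate_at n y)%:E = mine (w y) n%:R%:E.
Proof.
rewrite /truncate_at fineK// ge0_fin_numE.
  by apply: (@le_lt_trans _ _ n%:R%:E); [rewrite ge_min lexx orbT|rewrite ltry].
by rewrite le_min w0/= lee_fin.
Qed.

Lemma truncate_at_ge0 n y : 0 <= truncate_at n y.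
Proof. by rewrite -lee_fin truncate_atE le_min w0/= lee_fin. Qed.

Lemma truncate_at_le n y : truncate_at n y <= n%:R.
Proof. by rewrite -lee_fin truncate_atE ge_min lexx orbT. Qed.

Lemma truncate_at_ndecr m n y : (m <= n)%N -> truncate_at m y <= truncate_at n y.
Proof.
move=> mn; rewrite -lee_fin !truncate_atE le_min ge_min lexx/= ge_min.
by rewrite lee_fin ler_nat mn orbT.
Qed.

(** The Pasch-Hausdorff envelope: the largest minorant of the truncation that is n-Lipschitz for the
    sup norm. *)
Definition inf_conv (n : nat) x : R :=
  inf [set truncate_at n y + n%:R * `|x - y| | y in [set: 'rV[R]_d]].

Lemma inf_conv_le n x y : inf_conv n x <= truncate_at n y + n%:R * `|x - y|.
Proof.
apply: ge_inf; last by exists y.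
exists 0 => _ [z _ <-]; apply: addr_ge0; first exact: truncate_at_ge0.
by apply: mulr_ge0 => //; exact: normr_ge0.
Qed.

Lemma inf_conv_ge n x (c : R) :
  (forall y, c <= truncate_at n y + n%:R * `|x - y|) -> c <= inf_conv n x.
Proof.
move=> h; apply: lb_le_inf; first by exists (truncate_at n 0 + n%:R * `|x - 0|); exists 0.
by move=> _ [y _ <-].
Qed.

Lemma inf_conv_ge0 n x : 0 <= inf_conv n x.
Proof.
apply: inf_conv_ge => y; apply: addr_ge0; first exact: truncate_at_ge0.
by apply: mulr_ge0 => //; exact: normr_ge0.
Qed.

Lemma inf_conv_le_truncate n x : inf_conv n x <= truncate_at n x.
Proof. by have := inf_conv_le n x x; rewrite subrr normr0 mulr0 addr0. Qed.

Lemma inf_conv_le_nat n x : inf_conv n x <= n%:R.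
Proof. exact: le_trans (inf_conv_le_truncate n x) (truncate_at_le n x). Qed.

Lemma inf_conv_le_fun n x : ((inf_conv n x)%:E <= w x)%E.
Proof.
apply: (@le_trans _ _ (truncate_at n x)%:E); first by rewrite lee_fin inf_conv_le_truncate.
by rewrite truncate_atE ge_min lexx.
Qed.

Lemma inf_conv_lipschitz n x y : `|inf_conv n x - inf_conv n y| <= n%:R * `|x - y|.
Proof.
have half u v : inf_conv n u <= inf_conv n v + n%:R * `|u - v|.
  rewrite -lerBlDr; apply: inf_conv_ge => z; rewrite lerBlDr.
  apply: (le_trans (inf_conv_le n u z)); rewrite -addrA lerD2l -mulrDr.
  by apply: ler_wpM2l => //; rewrite [leRHS]addrC; exact: ler_distD.
have h1 := half x y; have := half y x; rewrite (distrC y) => h2.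
by rewrite ler_distl; apply/andP; split => //; rewrite lerBlDr.
Qed.

Lemma inf_conv_ndecr m n x : (m <= n)%N -> inf_conv m x <= inf_conv n x.
Proof.
move=> mn; apply: inf_conv_ge => y; apply: (le_trans (inf_conv_le m x y)).
apply: lerD; first exact: truncate_at_ndecr.
by apply: ler_wpM2r; [exact: normr_ge0|rewrite ler_nat].
Qed.

(** Below any level al < w x, points near x are handled by lower semicontinuity and distant ones by
    the slope n. *)
Lemma inf_conv_cvg x : (inf_conv n x)%:E @[n --> \oo] --> w x.
Proof.
have nd : nondecreasing_seq (fun n => (inf_conv n x)%:E).
  by move=> m n mn; rewrite lee_fin; exact: inf_conv_ndecr.
have := ereal_nondecreasing_cvgn nd.
suff -> : ereal_sup (range (fun n => (inf_conv n x)%:E)) = w x by [].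
apply/eqP; rewrite eq_le; apply/andP; split.
  by apply: ub_ereal_sup => _ [n _ <-]; exact: inf_conv_le_fun.
set S := ereal_sup _; rewrite leNgt; apply/negP => Sw.
have S0 : (0 <= S)%E.
  apply: (@le_trans _ _ (inf_conv 0 x)%:E); first by rewrite lee_fin inf_conv_ge0.
  by apply: ereal_sup_ubound; exists 0%N.
have [al Sal alw] : exists2 al : R, (S < al%:E)%E & (al%:E < w x)%E.
  move: S0 Sw; case: (S) => [r| |] // _; case: (w x) => [q| |] //.
  - by rewrite lte_fin => rq; exists ((r + q) / 2); rewrite lte_fin; lra.
  - by move=> _; exists (r + 1); rewrite ?ltry// lte_fin; lra.
have [V /nbhs_ballP[e /= e0 eV] Val] := scw alw.
(* n >= |al| keeps the truncation above al on the ball of radius e, and n e >= |al| suffices outside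
   it. *)
pose n := (Num.truncn (`|al| + `|al| / e)).+1.
have nal : `|al| + `|al| / e < n%:R by exact: truncnS_gt.
have al0 : 0 <= `|al| / e by rewrite divr_ge0// ltW.
have : al <= inf_conv n x.
  apply: inf_conv_ge => y; have [xy|xy] := ltP `|x - y| e.
    have yV : V y by apply: eV; rewrite mx_norm_ball.
    have : al <= truncate_at n y.
      rewrite -lee_fin truncate_atE le_min (ltW (Val _ yV))/= lee_fin.
      by have := ler_norm al; lra.
    have : 0 <= n%:R * `|x - y| by apply: mulr_ge0 => //; exact: normr_ge0.
    lra.
  have : `|al| <= n%:R * `|x - y|.
    have -> : `|al| = `|al| / e * e by rewrite divfK// gt_eqF.
    by apply: ler_pM => //; [exact: ltW|have := normr_ge0 al; lra].
  by have := truncate_at_ge0 n y; have := ler_norm al; lra.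
rewrite leNgt => /negP; apply.
rewrite -lte_fin; apply: le_lt_trans Sal.
by apply: ereal_sup_ubound; exists n.
Qed.

End lipschitz_approximation.

(** * Comparison for W itself *)

Section heat_comparison.
Context {R : realType} {d : nat}.
Implicit Types x y z : 'rV[R]_d.
Local Notation sigma := (@usig R d).
Variables (W : 'rV[R]_d -> \bar R) (C : R).
Hypothesis C0 : 0 <= C.
Hypothesis WC : forall x, ((- C)%:E <= W x)%E.
Hypothesis scW : lower_semicontinuous W.
Hypothesis sigma0 : 0 < sigma.
Variables (a : 'rV[R]_d -> R) (A0 B : R).
Hypothesis ca : continuous a.
Hypothesis A00 : 0 <= A0.
Hypothesis aA0 : forall x, 0 <= a x + A0.
Hypothesis B0 : 0 <= B.
Hypothesis maB : mean_sub (fun x => a x + A0) B.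
Hypothesis lapW : forall x, (gen_laplacian0 W x <= (a x)%:E)%E.
Local Notation lam := (@heat_speed R d).
Local Notation kap := ((2 * (d + 2))%:R : R).

Let w x := (W x + C%:E)%E.

Let w_ge0 x : (0 <= w x)%E.
Proof. exact: adde_ge0_geN. Qed.

Let scw : lower_semicontinuous w.
Proof.
apply: (@lower_semicontinuousD R _ W (fun=> C) scW); last exact: continuous_cstr.
by move=> x; apply: lt_le_trans (WC x); rewrite ltNyr.
Qed.

(** The penalty tends to 0 for each Lipschitz minorant, then the minorants increase to w. The
    hypothesis uses eta/2 of the smallness budget and leaves the other half to the penalty. *)
Lemma heat_comparison (eta t : R) x : 0 < eta -> 0 <= t -> kap * (lam * t * B) <= eta / 2 ->
  (heat t w x <= w x + (lam * t * (a x + 2 * eta))%:E)%E.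
Proof.
move=> eta0 t0 small.
have kap0 : 0 < kap by rewrite ltr0n addn2.
have s0 : 0 <= d%:R * sigma by apply: mulr_ge0 => //; exact: ltW.
have g0 n : forall y, 0 <= inf_conv w n y by exact: inf_conv_ge0.
have gn n : forall y, inf_conv w n y <= n%:R by exact: inf_conv_le_nat.
have gl n : forall y z, `|inf_conv w n y - inf_conv w n z| <= n%:R * `|y - z|.
  exact: inf_conv_lipschitz.
have gw n : forall y, ((inf_conv w n y)%:E <= W y + C%:E)%E by exact: inf_conv_le_fun.
have nn n : 0 <= n%:R :> R by exact: ler0n.
have bound n : ((rheat (inf_conv w n) t x)%:E <= w x + (lam * t * (a x + 2 * eta))%:E)%E.
  have pen e' : 0 < e' -> kap * (e' * (d%:R * sigma)) <= eta / 2 ->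
      ((rheat (inf_conv w n) t x)%:E <= W x + (C + lam * t * (a x + 2 * eta) + e' * sqnorm x)%:E)%E.
    move=> e'0 he'.
    have sm : kap * (lam * t * B + e' * (d%:R * sigma)) <= eta by rewrite mulrDr; lra.
    have tt : 0 <= t <= t by rewrite t0 lexx.
    exact: (heat_comparison_penalised C0 WC scW sigma0 ca A00 aA0 B0 maB lapW
      (g0 n) (gn n) (nn n) (gl n)
      (gw n) eta0 e'0 t0 sm x tt).
  rewrite /w; have := pen; case: (W x) (WC x) => [r _ {}pen|_ _|//]; last by rewrite ?addye// leey.
   rewrite -!EFinD lee_fin; apply/ler_addgt0Pr => e e0.
  pose D := kap * (d%:R * sigma) + 1.
  have D0 : 0 < D by rewrite /D ltr_wpDl// mulr_ge0// ltW.
  pose N := sqnorm x + 1.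
  have N0 : 0 < N by rewrite /N ltr_wpDl// sqnorm_ge0.
  (* The first entry makes e' |x|^2 at most e; the second fits the penalty into the remaining
     eta/2. *)
  pose e' : R := Num.min (e / N) (eta / 2 / D).
  have e'0 : 0 < e' by rewrite lt_min !divr_gt0.
  have e'N : e' * N <= e by rewrite -ler_pdivlMr// ge_min lexx.
  have e'D : e' * D <= eta / 2 by rewrite -ler_pdivlMr// ge_min lexx orbT.
  have /(pen _ e'0) : kap * (e' * (d%:R * sigma)) <= eta / 2.
    by apply: le_trans e'D; rewrite /D mulrCA mulrDr mulr1 lerDl ltW.
  rewrite -!EFinD lee_fin; move: e'N; rewrite /N mulrDr mulr1; lra.
have mI n : measurable_fun setT (fun z => ((inf_conv w n (x + Num.sqrt t *: z)%R)%:E * (heat_kernel 1 z)%:E)%E).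
  exact: (measurable_heat_integrand (nn n) (gl n)).
have pI n z : (0 <= (inf_conv w n (x + Num.sqrt t *: z)%R)%:E * (heat_kernel 1 z)%:E)%E.
  exact: (heat_integrand_ge0 (g0 n)).
have ndI z : nondecreasing_seq (fun n => (inf_conv w n (x + Num.sqrt t *: z)%R)%:E * (heat_kernel 1 z)%:E)%E.
  move=> m n mn; apply: lee_wpmul2r; first by rewrite lee_fin heat_kernel_ge0.
  by rewrite lee_fin; exact: inf_conv_ndecr.
(* Monotone convergence, for the integrand increases with n. *)
have -> : heat t w x = limn (fun n => (rheat (inf_conv w n) t x)%:E).
  transitivity (\int[lebesgue_rV d]_z limn (fun n => (inf_conv w n (x + Num.sqrt t *: z)%R)%:E * (heat_kernel 1 z)%:E))%E.
    apply: eq_integral => z _; apply/esym/cvg_lim => //.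
    by apply: cvgeZr => //; exact: inf_conv_cvg.
  rewrite monotone_convergence//; congr (limn _); apply/funext => n.
  by rewrite -(rheatE (g0 n) (gn n) (nn n) (gl n)).
apply: lime_le; last exact: nearW.
apply: ereal_nondecreasing_is_cvgn => m n mn.
rewrite -!(rheatE (g0 _) (gn _) (nn _) (gl _)).
by apply: ge0_le_integralT; [exact: mI|exact: mI|exact: pI|move=> z; exact: ndI].
Qed.

End heat_comparison.

(** * Euler-Lagrange conditions *)

Section euler_lagrange.
Context {R : realType} {d : nat}.
Implicit Types x y z : 'rV[R]_d.
Implicit Types rho nu : probability 'rV[R]_d R.
Local Open Scope ereal_scope.

Section interaction.
Variable w : 'rV[R]_d -> \bar R.
Hypothesis w0 : forall x, 0 <= w x.
Hypothesis mw : measurable_fun setT w.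
Hypothesis wN : forall x, w (- x)%R = w x.

Definition potential (m : {measure set 'rV[R]_d -> \bar R}) x := \int[m]_y w (x - y)%R.

Lemma measurable_interaction :
  measurable_fun setT (fun p : 'rV[R]_d * 'rV[R]_d => w (p.1 - p.2)%R).
Proof.
apply: (measurableT_comp mw); apply: measurable_fun_mx => i j.
under eq_fun do rewrite !mxE.
apply: measurable_funB.
  exact: (measurableT_comp (coord_measurable_mx i j) measurable_fst).
exact: (measurableT_comp (coord_measurable_mx i j) measurable_snd).
Qed.

Lemma measurable_interaction2 x : measurable_fun setT (fun y => w (x - y)%R).
Proof. exact: (measurableT_comp measurable_interaction (measurable_pair1 x)). Qed.

Lemma potential_ge0 m x : 0 <= potential m x.
Proof. by apply: integral_ge0 => y _. Qed.

Lemma measurable_potential (m : {sigma_finite_measure set 'rV[R]_d -> \bar R}) :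
  measurable_fun setT (potential m).
Proof.
exact: (measurable_fun_fubini_tonelli_F (m2 := m) _ measurable_interaction (fun=> w0 _)).
Qed.

Lemma measurable_potential_restr (m : {sigma_finite_measure set 'rV[R]_d -> \bar R})
    (A : set 'rV[R]_d) : measurable A ->
  measurable_fun setT (fun x => \int[m]_(y in A) w (x - y)%R).
Proof.
move=> mA; under eq_fun do rewrite integral_mkcond epatch_indic.
have mf : measurable_fun setT (fun p : 'rV[R]_d * 'rV[R]_d =>
    w (p.1 - p.2)%R * (\1_A p.2 : R)%:E).
  apply: emeasurable_funM; first exact: measurable_interaction.
  apply/measurable_EFinP; apply: (measurableT_comp (measurable_indic mA)).
  exact: measurable_snd.
apply: (measurable_fun_fubini_tonelli_F (m2 := m) _ mf) => p.
by rewrite mule_ge0// lee_fin.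
Qed.

Lemma potential_sym rho nu : \int[nu]_x potential rho x = \int[rho]_x potential nu x.
Proof.
rewrite /potential (fubini_tonelli (m1 := nu) (m2 := rho) _ measurable_interaction (fun=> w0 _)).
by apply: eq_integral => y _; apply: eq_integral => x _; rewrite /= -wN opprB.
Qed.

Lemma mnormalize_mass1 (m : {measure set 'rV[R]_d -> \bar R}) rho (A : set 'rV[R]_d) :
  m setT = 1 -> mnormalize m rho A = m A.
Proof. by move=> m1; rewrite /mnormalize m1 ifF ?invr1 ?mule1// onee_eq0. Qed.

Section mixture.
Variables (rho nu : probability 'rV[R]_d R) (th : R).
Hypothesis th0 : (0 <= th)%R.
Hypothesis th1 : (0 <= 1 - th)%R.

Let mix_add := measure_add (mscale (NngNum th1) rho) (mscale (NngNum th0) nu).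

(** The convex combination already has mass one; [mnormalize] only gives it the structure of a
    probability. *)
Definition mixture : probability 'rV[R]_d R := mnormalize mix_add rho.

Lemma integral_mixture (f : 'rV[R]_d -> \bar R) :
  measurable_fun setT f -> (forall x, 0 <= f x) ->
  \int[mixture]_x f x = (1 - th)%:E * \int[rho]_x f x + th%:E * \int[nu]_x f x.
Proof.
move=> mf f0.
have PT (P : probability 'rV[R]_d R) : P setT = 1 by exact: probability_setT.
have mT : mix_add setT = 1.
  rewrite /mix_add measure_addE /= /mscale /= !PT !mule1 -EFinD.
  by congr EFin; rewrite subrK.
transitivity (\int[mix_add]_x f x).
  apply: eq_measure_integral => A mA _; exact: mnormalize_mass1.
by rewrite ge0_integral_measure_add// !ge0_integral_mscale.
Qed.

(** Bilinear expansion in which symmetry merges the two cross terms. It stays unsimplified because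
    every integral may be +oo. *)
Lemma interaction_mixture :
  \int[mixture]_x potential mixture x =
  (1 - th)%:E * ((1 - th)%:E * \int[rho]_x potential rho x + th%:E * \int[nu]_x potential rho x) +
  th%:E * ((1 - th)%:E * \int[nu]_x potential rho x + th%:E * \int[nu]_x potential nu x).
Proof.
have pE x : potential mixture x = (1 - th)%:E * potential rho x + th%:E * potential nu x.
  by rewrite /potential integral_mixture//; exact: measurable_interaction2.
have sE (P : probability 'rV[R]_d R) : \int[P]_x potential mixture x =
    (1 - th)%:E * \int[P]_x potential rho x + th%:E * \int[P]_x potential nu x.
  under eq_integral do rewrite pE.
  have mp (Q : probability 'rV[R]_d R) (c : R) : measurable_fun setT (fun x => c%:E * potential Q x).
    by apply: measurable_funeM; exact: measurable_potential.
  rewrite ge0_integralDT; [|exact: mp|exact: mp|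
    by move=> x; apply: mule_ge0; [rewrite lee_fin|exact: potential_ge0]|
    by move=> x; apply: mule_ge0; [rewrite lee_fin|exact: potential_ge0]].
  rewrite ge0_integralZT; [|exact: th0|exact: measurable_potential|exact: potential_ge0].
  by rewrite ge0_integralZT; [|exact: th1|exact: measurable_potential|exact: potential_ge0].
rewrite integral_mixture; [|exact: measurable_potential|exact: potential_ge0].
by rewrite !sE (potential_sym nu rho).
Qed.

End mixture.

Section minimiser.
Variable rho : probability 'rV[R]_d R.
Hypothesis minrho : forall nu, \int[rho]_x potential rho x <= \int[nu]_x potential nu x.
Variable e : R.
Hypothesis rhoe : \int[rho]_x potential rho x = e%:E.

Lemma minimal_energy_ge0 : (0 <= e)%R.
Proof. by rewrite -lee_fin -rhoe; apply: integral_ge0 => x _; exact: potential_ge0. Qed.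

(* First variation of the energy along the segment from [rho] to [nu]. *)
Lemma potential_mean_ge nu : \int[nu]_x potential nu x < +oo ->
  e%:E <= \int[nu]_x potential rho x.
Proof.
move=> nuoo; rewrite leNgt; apply/negP => Xe.
have X0 : 0 <= \int[nu]_x potential rho x by apply: integral_ge0 => x _; exact: potential_ge0.
have N0 : 0 <= \int[nu]_x potential nu x by apply: integral_ge0 => x _; exact: potential_ge0.
have mixE (th : R) (th0 : (0 <= th)%R) (th1 : (0 <= 1 - th)%R) : e%:E <=
  (1 - th)%:E * ((1 - th)%:E * e%:E + th%:E * \int[nu]_x potential rho x) +
  th%:E * ((1 - th)%:E * \int[nu]_x potential rho x + th%:E * \int[nu]_x potential nu x).
  by rewrite -{1 2}rhoe -interaction_mixture; exact: minrho.
move: X0 N0 nuoo Xe mixE.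
case: (\int[nu]_x potential rho x) => [X| |] //.
case: (\int[nu]_x potential nu x) => [N| |] // _ _ _; rewrite lte_fin => Xe mixE.
(* Minimality reads 2 (e - X) <= th (e - 2 X + N). D dominates the last factor, so th D <= e - X
   contradicts X < e; th <= 1/2 keeps 1 - th nonnegative. *)
pose D : R := (`|e - 2 * X + N| + 1)%R.
have D0 : (0 < D)%R by rewrite /D ltr_wpDl.
pose th : R := Num.min 2^-1%R ((e - X) / D)%R.
have thp : (0 < th)%R by rewrite lt_min invr_gt0 ltr0n/= divr_gt0// subr_gt0.
have th2 : (th <= 2^-1)%R by rewrite ge_min lexx.
have thD : (th * D <= e - X)%R by rewrite -ler_pdivlMr// ge_min lexx orbT.
have th1 : (0 <= 1 - th)%R by lra.
have := mixE th (ltW thp) th1; rewrite -!(EFinM, EFinD) lee_fin => h.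
have h2 : (th * (2 * (e - X)) <= th * (th * (e - 2 * X + N)))%R by lra.
rewrite ler_pM2l// in h2.
have : (th * (e - 2 * X + N) <= th * D)%R.
  by rewrite ler_pM2l// /D; have := ler_norm (e - 2 * X + N)%R; lra.
lra.
Qed.

(** The first variation towards the normalised restriction of m to A. It is used with m = rho and
    with m Lebesgue measure. *)
Lemma potential_mean_ge_restr (m : {sigma_finite_measure set 'rV[R]_d -> \bar R})
    (A : set 'rV[R]_d) :
  measurable A -> 0 < m A -> m A < +oo ->
  \int[m]_(x in A) \int[m]_(y in A) w (x - y)%R < +oo ->
  e%:E * m A <= \int[m]_(x in A) potential rho x.
Proof.
move=> mA A0 Aoo fin.
pose nu : probability 'rV[R]_d R := mnormalize (mrestr m mA) rho.
have nuE (f : 'rV[R]_d -> \bar R) : measurable_fun setT f -> (forall x, 0 <= f x) ->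
    \int[nu]_x f x = (fine (m A))^-1%:E * \int[m]_(x in A) f x.
  by move=> mf f0; exact: ge0_integral_restr_probability.
have [a a0 aE] : exists2 a : R, (0 < a)%R & m A = a%:E.
  by move: A0 Aoo; case: (m A) => [a| |]//; rewrite lte_fin => a0 _; exists a.
have ia0 : (0 <= a^-1)%R by rewrite invr_ge0 ltW.
have pnu x : potential nu x = a^-1%:E * \int[m]_(y in A) w (x - y)%R.
  by rewrite /potential nuE ?aE//; exact: measurable_interaction2.
have nuoo : \int[nu]_x potential nu x < +oo.
  rewrite nuE ?aE/=; [|exact: measurable_potential|exact: potential_ge0].
  have inner x : \int[m]_(y in A) w (x - y)%R = a%:E * potential nu x.
    by rewrite pnu muleA -EFinM mulfV ?mul1e// gt_eqF.
  move: fin; under eq_integral do rewrite inner.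
  have mpA : measurable_fun A (potential nu) by exact: (measurable_funS measurableT (@subsetT _ _) (measurable_potential nu)).
  rewrite ge0_integralZl//; [|by move=> x _; exact: potential_ge0|by rewrite lee_fin ltW].
  have : 0 <= \int[m]_(x in A) potential nu x by apply: integral_ge0 => x _; exact: potential_ge0.
  case: (\int[m]_(x in A) potential nu x) => // [r _ _|_]; first by rewrite -EFinM ltry.
  by rewrite gt0_muley ?lte_fin.
have := potential_mean_ge nuoo.
rewrite nuE; [|exact: measurable_potential|exact: potential_ge0].
rewrite aE /= => h.
have := lee_wpmul2l (_ : 0 <= a%:E) h; rewrite lee_fin => /(_ (ltW a0)).
by rewrite muleA -(EFinM a a^-1) mulfV ?gt_eqF// mul1e muleC.
Qed.

Lemma measurable_potential_le (c : R) : measurable [set x | potential rho x <= c%:E].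
Proof.
by have := emeasurable_fun_infty_c measurableT (measurable_potential rho) c%:E; rewrite setTI.
Qed.

Lemma measurable_potential_ge (c : R) : measurable [set x | c%:E <= potential rho x].
Proof.
by have := emeasurable_fun_c_infty measurableT (measurable_potential rho) c%:E; rewrite setTI.
Qed.

(** If the potential exceeded e by 1/(m+1) on a set of positive mass, its mean, at least e on the
    complement, would exceed e in total. *)
Lemma rho_potential_gt : rho [set x | e%:E < potential rho x] = 0.
Proof.
pose H m := [set x | (e + m.+1%:R^-1)%:E <= potential rho x].
have mH m : measurable (H m) by exact: measurable_potential_ge.
have cover : [set x | e%:E < potential rho x] = \bigcup_m H m.
  apply/seteqP; split => x /=; last first.
    move=> [m _]; apply: lt_le_trans; rewrite lte_fin ltrDl invr_gt0//.
  case px : (potential rho x) => [r| |] //; last by exists 0%N => //; rewrite /H/= px leey.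
  rewrite lte_fin => er; pose n := Num.truncn (r - e)^-1.
  exists n => //; rewrite /H /= px lee_fin -lerBrDl.
  rewrite -[leRHS]invrK lef_pV2 ?posrE ?invr_gt0 ?subr_gt0//.
  exact: ltW (truncnS_gt _).
suff H0 m : rho (H m) = 0.
  have mU : measurable (\bigcup_m H m) by exact: bigcup_measurable.
  rewrite cover; apply/(negligibleP rho mU); apply: negligible_bigcup => m.
  by apply/(negligibleP rho (mH m)); exact: H0.
apply/eqP; rewrite eq_le measure_ge0 andbT leNgt; apply/negP => Hp.
have mHC : measurable (~` H m) by exact: measurableC.
have mpot (A : set 'rV[R]_d) : measurable_fun A (potential rho).
  exact: (measurable_funS measurableT (@subsetT _ _) (measurable_potential rho)).
have total : \int[rho]_(x in H m) potential rho x + \int[rho]_(x in ~` H m) potential rho x = e%:E.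
  rewrite -ge0_integral_setU; [|exact: mH|exact: mHC|by rewrite setUv; exact: mpot|
    by move=> x _; exact: potential_ge0|by apply/disj_setPS; rewrite setICr].
  by rewrite setUv.
have [a aE] : exists a : R, rho (H m) = a%:E.
  by exists (fine (rho (H m))); rewrite fineK//; exact: fin_num_measure.
have mass : rho (~` H m) = (1 - a)%:E.
  by rewrite probability_setC ?aE.
have geH : (e + m.+1%:R^-1)%:E * rho (H m) <= \int[rho]_(x in H m) potential rho x.
  rewrite -integral_cst//; apply: ge0_le_integral => //.
  by move=> x _; rewrite lee_fin addr_ge0// minimal_energy_ge0.
(* The restriction of rho to the complement is an admissible competitor: its interaction is bounded
   by the finite one of rho. *)
have geC : e%:E * rho (~` H m) <= \int[rho]_(x in ~` H m) potential rho x.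
  have [C0|C0] := eqVneq (rho (~` H m)) 0.
    by rewrite C0 mule0; apply: integral_ge0 => x _; exact: potential_ge0.
  apply: potential_mean_ge_restr => //.
  - by rewrite lt_neqAle eq_sym C0 measure_ge0.
  - by apply: (@le_lt_trans _ _ 1); [exact: probability_le1|exact: ltry].
  apply: (@le_lt_trans _ _ (\int[rho]_x potential rho x)); last by rewrite rhoe ltry.
  apply: (@le_trans _ _ (\int[rho]_(x in ~` H m) potential rho x)); last first.
    by apply: ge0_subset_integral => // x _; exact: potential_ge0.
  apply: ge0_le_integral => //.
  - by move=> x _; apply: integral_ge0.
  - exact: (measurable_funS measurableT (@subsetT _ _) (measurable_potential_restr _ mHC)).
  by move=> x _; apply: ge0_subset_integral => //; exact: measurable_interaction2.
move: Hp geH geC total; rewrite mass aE lte_fin; rewrite -!EFinM => a0.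
case: (\int[rho]_(x in H m) potential rho x) => [p| |]; case: (\int[rho]_(x in ~` H m) potential rho x) => [q| |]//.
rewrite !lee_fin -EFinD => h1 h2 [h3].
have : (0 < m.+1%:R^-1 * a :> R)%R by rewrite mulr_gt0// invr_gt0.
by move: h1 h2 h3; move: (m.+1%:R^-1)%R => i; lra.
Qed.

(** Differences of points of B_r lie in B_2r, so local integrability gives finite energy to Lebesgue
    measure on bounded sets. *)
Lemma integral_interaction_ball (r : R) x (A : set 'rV[R]_d) :
  measurable A -> A `<=` eball 0%R r -> A x ->
  \int[lebesgue_rV d]_(y in A) w (x - y)%R <= \int[lebesgue_rV d]_(y in eball 0%R (r + r)%R) w y.
Proof.
move=> mA Ar Ax; set D := eball 0%R (r + r)%R.
have mD : measurable D by exact: measurable_eball.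
pose g y := w y * (\1_D y : R)%:E.
have mg : measurable_fun setT g.
  by apply: emeasurable_funM => //; apply/measurable_EFinP; exact: measurable_indic.
have g0 y : 0 <= g y by rewrite mule_ge0// lee_fin.
have gN y : g (- y)%R = g y.
  rewrite /g wN; congr (_ * (_)%:E).
  rewrite !indicE; congr (_%:R); congr nat_of_bool.
  by rewrite /D; apply/idP/idP; rewrite !inE !mem_eball0 enormN.
rewrite [leRHS]integral_mkcond epatch_indic -/g.
rewrite -(ge0_integral_rV_shift (- x)%R mg g0) integral_mkcond epatch_indic.
apply: ge0_le_integralT.
- apply: emeasurable_funM; first exact: measurable_interaction2.
  by apply/measurable_EFinP; exact: measurable_indic.
- exact: (measurableT_comp mg (measurable_rV_shift _)).
- by move=> y; rewrite mule_ge0// lee_fin.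
move=> y; rewrite -gN opprB /g.
apply: lee_wpmul2l => //; rewrite lee_fin !indicE.
have [yA|] := boolP (y \in A); last by rewrite ler0n.
suff -> : (x - y)%R \in D by [].
rewrite inE /D mem_eball0; apply: le_lt_trans (ler_enormD _ _) _; rewrite enormN.
by apply: ltrD; rewrite -mem_eball0; apply: Ar => //; rewrite inE in yA.
Qed.

Hypothesis locw : forall r : R, \int[lebesgue_rV d]_(y in eball 0%R r) w y < +oo.

(** The set is covered by countably many bounded pieces with potential at most e - 1/(m+1); on a
    piece of positive volume, Lebesgue measure would violate the first variation. *)
Lemma lebesgue_potential_lt :
  (lebesgue_rV d).-negligible [set x | potential rho x < e%:E].
Proof.
pose H m n := [set x | potential rho x <= (e - m.+1%:R^-1)%:E] `&` eball 0%R n.+1%:R.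
have mH m n : measurable (H m n).
  by apply: measurableI; [exact: measurable_potential_le|exact: measurable_eball].
have cover : [set x | potential rho x < e%:E] `<=` \bigcup_m \bigcup_n H m n.
  move=> x /=; have := potential_ge0 rho x.
  case px : (potential rho x) => [r| |] // _; rewrite lte_fin => re.
  pose m := Num.truncn (e - r)^-1; pose n := Num.truncn (enorm x).
  exists m => //; exists n => //; split; last first.
    by rewrite mem_eball0; exact: truncnS_gt.
  rewrite /= px lee_fin lerBrDr -lerBrDl.
  rewrite -[leRHS]invrK lef_pV2 ?posrE ?invr_gt0 ?subr_gt0//.
  exact: ltW (truncnS_gt _).
apply: (negligibleS cover); apply: negligible_bigcup => m; apply: negligible_bigcup => n.
apply/(negligibleP _ (mH m n))/eqP; rewrite eq_le measure_ge0 andbT leNgt; apply/negP => Hp.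
have n0 : (0 < n.+1%:R :> R)%R by [].
have HS : H m n `<=` eball 0%R n.+1%:R by move=> x [].
have [l l0 lE] := lebesgue_eball_gt0 (d := d) n0.
have Hoo : lebesgue_rV d (H m n) < +oo.
  apply: (@le_lt_trans _ _ (lebesgue_rV d (eball 0%R n.+1%:R))); last by rewrite lE ltry.
  by apply: le_measure; rewrite ?inE//; exact: measurable_eball.
have fin : \int[lebesgue_rV d]_(x in H m n) \int[lebesgue_rV d]_(y in H m n) w (x - y)%R < +oo.
  pose K := \int[lebesgue_rV d]_(y in eball 0%R (n.+1%:R + n.+1%:R)%R) w y.
  have K0 : 0 <= K by apply: integral_ge0.
  apply: (@le_lt_trans _ _ (\int[lebesgue_rV d]_(x in H m n) (cst K x))).
    apply: ge0_le_integral => //.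
    - by move=> x _; apply: integral_ge0.
    - exact: (measurable_funS measurableT (@subsetT _ _) (measurable_potential_restr _ (mH m n))).
    by move=> x Hx; exact: integral_interaction_ball.
  by rewrite integral_cst// lte_mul_pinfty// ge0_fin_numE// locw.
have h1 := potential_mean_ge_restr (mH m n) Hp Hoo fin.
have h2 : \int[lebesgue_rV d]_(x in H m n) potential rho x <=
    (e - m.+1%:R^-1)%:E * lebesgue_rV d (H m n).
  rewrite -integral_cst//; apply: ge0_le_integral => //.
  - by move=> x _; exact: potential_ge0.
  - exact: (measurable_funS measurableT (@subsetT _ _) (measurable_potential rho)).
  by move=> x [].
have key (v : \bar R) : 0 < v -> v < +oo -> e%:E * v <= (e - m.+1%:R^-1)%:E * v -> False.
  have i0 : (0 < m.+1%:R^-1 :> R)%R by rewrite invr_gt0.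
  move: (m.+1%:R^-1)%R i0 => i i0; case: v => // v; rewrite lte_fin => v0 _.
  rewrite -!EFinM lee_fin; have : (0 < i * v)%R by rewrite mulr_gt0.
  by lra.
exact: (key _ Hp Hoo (le_trans h1 h2)).
Qed.

(** The bound e holds almost everywhere under the integral, and the kernel has mass one. *)
Lemma heat_potential_ge t x : (0 < t)%R -> e%:E <= heat t (potential rho) x.
Proof.
move=> t0; rewrite heatE//; [|exact: measurable_potential|by move=> z; exact: potential_ge0].
have mk : measurable_fun setT (fun z => (heat_kernel t (z - x)%R)%:E).
  exact: (measurableT_comp (measurable_heat_kernel t) (measurable_rV_shift _)).
have k0 z : 0 <= (heat_kernel t (z - x)%R)%:E by rewrite lee_fin heat_kernel_ge0.
pose f z := potential rho z * (heat_kernel t (z - x)%R)%:E.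
have mf : measurable_fun setT f by apply: emeasurable_funM => //; exact: measurable_potential.
have f0 z : 0 <= f z by rewrite mule_ge0// potential_ge0.
have -> : \int[lebesgue_rV d]_z (potential rho (x + z)%R * (heat_kernel t z)%:E) =
    \int[lebesgue_rV d]_z f z.
  rewrite -(ge0_integral_rV_shift x mf f0); apply: eq_integral => z _.
  by rewrite /f addrK addrC.
have <- : \int[lebesgue_rV d]_z (e%:E * (heat_kernel t (z - x)%R)%:E) = e%:E.
  rewrite ge0_integralZT; [|exact: minimal_energy_ge0|exact: mk|exact: k0].
  rewrite (ge0_integral_rV_shift (- x)%R (measurable_heat_kernel t)).
    by rewrite integral_heat_kernel// mule1.
  by move=> z; rewrite lee_fin heat_kernel_ge0.
apply: ae_ge0_le_integral => //.
- by move=> z _; rewrite mule_ge0// lee_fin minimal_energy_ge0.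
- exact: measurable_funeM.
apply: negligibleS lebesgue_potential_lt => z /= h.
rewrite ltNge; apply/negP => ez; apply: h => _.
exact: lee_wpmul2r.
Qed.

End minimiser.
End interaction.
End euler_lagrange.

(** * Morrey norms of minimisers *)

Section total_variation_finite_measure.
Context d (T : measurableType d) (R : realType).
Local Open Scope ereal_scope.

(** On the negative set of a Hahn decomposition a measure vanishes. The decomposition is arbitrary
    because [charge_total_variation] picks one by choice. *)
Lemma charge_variation_le (m : {finite_measure set T -> \bar R}) (P N A : set T)
    (PN : hahn_decomposition (charge_of_finite_measure m) P N) :
  measurable A -> charge_variation PN A <= m A.
Proof.
move=> mA; have [[mP _] [mN Nle0] _ _] := PN.
rewrite /charge_variation jordan_posE cjordan_posE jordan_negE cjordan_negE.
rewrite /crestr0 mem_set// /crestr.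
rewrite [X in - X](_ : _ = 0); last first.
  by apply/eqP; rewrite eq_le Nle0//=; exact: measurableI.
rewrite oppe0 adde0; apply: le_measure; rewrite ?inE//.
exact: measurableI.
Qed.

Lemma charge_total_variation_le (m : {finite_measure set T -> \bar R}) (A : set T) :
  measurable A -> charge_total_variation (charge_of_finite_measure m) A <= m A.
Proof. exact: charge_variation_le. Qed.

End total_variation_finite_measure.

Section morrey_exponent.
Context {R : realType}.

Lemma morrey_exponentE (d : nat) (beta : R) : 0 < beta < d%:R ->
  @morrey_exponent R d (d%:R / (d%:R - beta))%:E = beta.
Proof.
move=> /andP[b0 bd]; have d0 : 0 < d%:R :> R by exact: lt_trans bd.
have db : 0 < d%:R - beta by rewrite subr_gt0.
have pne : d%:R / (d%:R - beta) != 0 by rewrite mulf_neq0 ?invr_eq0 ?gt_eqF.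
rewrite /morrey_exponent /hoelder_conjugate /= eqe (negbTE pne).
have p1 : d%:R / (d%:R - beta) - 1 = beta / (d%:R - beta).
  by field; rewrite gt_eqF.
rewrite -EFinB p1 inver ifF; last by rewrite mulf_eq0 invr_eq0 !gt_eqF.
rewrite -EFinM inver ifF; last first.
  by rewrite !mulf_eq0 !invr_eq0 mulf_eq0 invr_eq0 !gt_eqF.
by rewrite /=; field; rewrite !gt_eqF.
Qed.

End morrey_exponent.

Section mean_sub_min.
Context {R : realType} {d : nat}.
Implicit Types x : 'rV[R]_d.

Lemma mean_subZ (l : R) (b : 'rV[R]_d -> R) (B : R) : 0 <= l ->
  continuous b -> (forall x, 0 <= b x) -> mean_sub b B ->
  mean_sub (fun x => l * b x) (l * B).
Proof.
move=> l0 cb b0 mb x s s0.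
under eq_integral do rewrite EFinM.
rewrite ge0_integralZT//; last first.
- by move=> y; rewrite lee_fin.
- apply: (@measurableT_comp _ _ _ _ _ _ (EFin \o b)); last exact: measurable_rV_translate.
  by apply/measurable_EFinP; exact: continuous_measurable_mx.
apply: le_trans (lee_wpmul2l _ (mb x s s0)) _; first by rewrite lee_fin.
by rewrite -EFinM lee_fin mulrDr mulrA.
Qed.

(** The minimum lies below both functions; the one that attains it at x bounds the average around
    x. *)
Lemma mean_sub_min (K : R) (b : 'rV[R]_d -> R) (B : R) : 0 <= K -> 0 <= B ->
  continuous b -> (forall x, 0 <= b x) -> mean_sub b B ->
  mean_sub (fun x => Num.min K (b x)) B.
Proof.
move=> K0 B0 cb b0 mb x s s0.
have mbs : measurable_fun setT (fun y : 'rV[R]_d => (b (x + s *: y))%:E).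
  apply: (@measurableT_comp _ _ _ _ _ _ (EFin \o b)); last exact: measurable_rV_translate.
  by apply/measurable_EFinP; exact: continuous_measurable_mx.
have mm : measurable_fun setT (fun y : 'rV[R]_d => (Num.min K (b (x + s *: y)))%:E).
  apply/measurable_EFinP; apply: measurable_minr; first exact: measurable_cst.
  exact/measurable_EFinP.
have m0 (y : 'rV[R]_d) : (0 <= (Num.min K (b (x + s *: y)))%:E)%E by rewrite lee_fin le_min K0 b0.
have Bs : 0 <= B * s ^+ 2 by rewrite mulr_ge0// sqr_ge0.
have [bK|Kb] := leP (b x) K.
  apply: le_trans (mb x s s0); apply: ge0_le_integralT => // y.
  by rewrite lee_fin ge_min lexx orbT.
apply: (@le_trans _ _ (\int[@uball R d]_y (cst K%:E y))%E).
  by apply: ge0_le_integralT => // y; rewrite lee_fin ge_min lexx.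
by rewrite integral_uball_cst lee_fin lerDl.
Qed.

End mean_sub_min.

Section heat_potential.
Context {R : realType} {d : nat}.
Local Open Scope ereal_scope.

(** The heat flow commutes with convolution by rho, by Tonelli. *)
Lemma heat_potentialE (w : 'rV[R]_d -> \bar R) (rho : probability 'rV[R]_d R) (t : R) x :
  (forall x, 0 <= w x) -> measurable_fun setT w ->
  heat t (potential w rho) x = \int[rho]_y heat t w (x - y)%R.
Proof.
move=> w0 mw; rewrite /heat /potential.
have mf : measurable_fun setT (fun p : 'rV[R]_d * 'rV[R]_d =>
    w (x + Num.sqrt t *: p.1 - p.2)%R * (heat_kernel 1 p.1)%:E).
  apply: emeasurable_funM; last exact: (measurableT_comp (measurable_heat_kernel 1) measurable_fst).
  apply: (@measurableT_comp _ _ _ _ _ _ (fun p : 'rV[R]_d * 'rV[R]_d => w (p.1 - p.2)%R) _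
    (fun p : 'rV[R]_d * 'rV[R]_d => (x + Num.sqrt t *: p.1, p.2)%R)).
    exact: measurable_interaction.
  apply: measurable_fun_pair; last exact: measurable_snd.
  exact: (measurableT_comp (measurable_rV_translate (Num.sqrt t) x) measurable_fst).
have f0 (p : 'rV[R]_d * 'rV[R]_d) : 0 <= w (x + Num.sqrt t *: p.1 - p.2)%R * (heat_kernel 1 p.1)%:E.
  by rewrite mule_ge0// lee_fin heat_kernel_ge0.
transitivity (\int[lebesgue_rV d]_z \int[rho]_y
    (w (x + Num.sqrt t *: z - y)%R * (heat_kernel 1 z)%:E)).
  apply: eq_integral => z _; rewrite muleC -ge0_integralZT; first last.
  - by move=> y; exact: w0.
  - exact: measurable_interaction2.
  - exact: heat_kernel_ge0.
  by apply: eq_integral => y _; rewrite muleC.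
rewrite (fubini_tonelli (m1 := lebesgue_rV d) (m2 := rho) _ mf f0).
by apply: eq_integral => y _; apply: eq_integral => z _; rewrite /= addrAC.
Qed.

End heat_potential.

(** * A quadratic barrier above the generalised Laplacian *)

Section repulsive_barrier.
Context {R : realType} {d : nat}.
Variable W : 'rV[R]_d -> \bar R.
Variables (beta delta Crep CW r : R).
Hypothesis beta0 : 0 < beta.
Hypothesis Crep0 : 0 < Crep.
Hypothesis CW0 : 0 < CW.
Hypothesis r0 : 0 < r.
Hypothesis r2delta : 2 * r <= delta.
Hypothesis repW : forall x, (0 < enorm x < delta)%R ->
  ((Crep * enorm x `^ (- beta))%:E <= - gen_laplacian0 W x)%E.
Hypothesis rep0 : (- gen_laplacian0 W 0 = +oo)%E.
Hypothesis lapW : forall x, (gen_laplacian0 W x <= CW%:E)%E.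

Let A := Crep * (2 * r) `^ (- beta).
Let B := (A + CW) / (2 * r) ^+ 2.

(* -A at 0 and CW outside B_2r, since B (2 r)^2 = A + CW. *)
Definition barrier (x : 'rV[R]_d) : R := Num.min (A + CW) (B * sqnorm x) - A.

Let r20 : 0 < 2 * r. Proof. by rewrite mulr_gt0. Qed.

Let A_gt0 : 0 < A. Proof. by rewrite mulr_gt0// powR_gt0. Qed.

Let ACW_gt0 : 0 < A + CW. Proof. exact: addr_gt0. Qed.

Let B_gt0 : 0 < B. Proof. by rewrite divr_gt0// exprn_gt0. Qed.

Lemma continuous_barrier : continuous barrier.
Proof.
have cB : continuous (fun x : 'rV[R]_d => B * sqnorm x).
  exact: (@continuous_scaler R _ B _ (@continuous_sqnorm R d)).
apply: (@continuous_addr R _ (fun x => Num.min (A + CW) (B * sqnorm x))); last exact: continuous_cstr.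
move=> x; exact: (@continuous_min R _ (fun=> A + CW) (fun y => B * sqnorm y) x
  (@continuous_cstr R _ (A + CW) x) (cB x)).
Qed.

Lemma barrierDA x : barrier x + A = Num.min (A + CW) (B * sqnorm x).
Proof. by rewrite subrK. Qed.

Lemma barrierDA_ge0 x : 0 <= barrier x + A.
Proof.
rewrite barrierDA le_min ltW//= mulr_ge0//; [exact: ltW|exact: sqnorm_ge0].
Qed.

Lemma barrier_le x : barrier x <= CW.
Proof. by rewrite lerBlDr [CW + A]addrC ge_min lexx. Qed.

(** At half the radius the quadratic has a quarter of its height, which is why the repulsion on B_2r
    serves to bound the mass of B_r. *)
Lemma barrier_ball_le x : enorm x < r -> barrier x + A <= (A + CW) / 4.
Proof.
move=> xr; rewrite barrierDA; apply: le_trans (_ : B * sqnorm x <= _).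
  by rewrite ge_min lexx orbT.
have -> : (A + CW) / 4 = B * r ^+ 2.
  by rewrite /B exprMn; field; rewrite gt_eqF.
rewrite ler_pM2l// -sqr_enorm ler_pXn2r ?nnegrE ?enorm_ge0 ?ltW//.
Qed.

(** Outside B_2r the barrier is CW. Inside, the repulsion is at least A, since |x|^-beta decreases,
    and the barrier never falls below -A. *)
Lemma gen_laplacian0_le_barrier x : (gen_laplacian0 W x <= (barrier x)%:E)%E.
Proof.
have [x2r|x2r] := ltP (enorm x) (2 * r); last first.
  rewrite /barrier min_l ?[A + CW]addrC ?addrK// addrC /B -sqr_enorm.
  rewrite mulrAC ler_pdivlMr ?exprn_gt0// ler_pM2l//.
  by rewrite ler_pXn2r// nnegrE ?enorm_ge0// ltW.
have [->|x0] := eqVneq x 0.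
  by move: rep0; case: (gen_laplacian0 W 0) => //= _; exact: leNye.
have ex : 0 < enorm x by rewrite (lt_le_trans _ (norm_le_enorm x))// normr_gt0.
have := repW (x := x); rewrite ex (lt_le_trans x2r r2delta) => /(_ isT).
rewrite leeNr => /le_trans; apply; rewrite lee_fin.
apply: (@le_trans _ _ (- A)).
  rewrite lerN2 ler_pM2l// !powRN lef_pV2 ?posrE ?powR_gt0//.
  by apply: ge0_ler_powR; rewrite ?nnegrE ?enorm_ge0 ?ltW.
by rewrite -subr_ge0 opprK barrierDA_ge0.
Qed.

Hypothesis d0 : (0 < d)%N.

Lemma mean_sub_barrier : mean_sub (fun x => barrier x + A) (B * (d%:R * @usig R d)).
Proof.
have -> : (fun x => barrier x + A) = (fun x => Num.min (A + CW) (B * sqnorm x)).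
  by apply/funext => x; exact: barrierDA.
have s0 := ltW (@usig_gt0 R d d0).
apply: mean_sub_min; first exact: ltW.
- by apply: mulr_ge0; [exact: ltW|exact: mulr_ge0].
- exact: (@continuous_scaler R _ B _ (@continuous_sqnorm R d)).
- by move=> x; apply: mulr_ge0; [exact: ltW|exact: sqnorm_ge0].
apply: mean_subZ; [exact: ltW|exact: continuous_sqnorm|exact: sqnorm_ge0|exact: mean_sub_sqnorm].
Qed.

End repulsive_barrier.

(** * Reduction to a nonnegative interaction *)

Section shifted_interaction.
Context {R : realType} {d : nat}.
Local Open Scope ereal_scope.
Variables (W : 'rV[R]_d -> \bar R) (C : R).
Hypothesis C0 : (0 <= C)%R.
Hypothesis WC : forall x, (- C)%:E <= W x.
Hypothesis scW : lower_semicontinuous W.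
Hypothesis locW : locally_integrable_rV W.

Definition shifted x := W x + C%:E.
Local Notation w := shifted.

Lemma shifted_ge0 x : 0 <= w x.
Proof. exact: adde_ge0_geN. Qed.

Lemma measurable_shifted : measurable_fun setT w.
Proof. by apply: emeasurable_funD => //; exact: lower_semicontinuous_measurable_mx. Qed.

Lemma shifted_integral_eball_lty (r : R) : \int[lebesgue_rV d]_(y in eball 0%R r) w y < +oo.
Proof.
have mE : measurable (eball (0 : 'rV[R]_d) r) by exact: measurable_eball.
have mW : measurable_fun setT W by exact: lower_semicontinuous_measurable_mx.
have [r0|r0] := leP r 0%R.
  have -> : eball (0 : 'rV[R]_d) r = set0.
    by apply/seteqP; split => x //; rewrite mem_eball0 => /(le_lt_trans (enorm_ge0 x)); rewrite ltNge r0.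
  by rewrite integral_set0.
have [l l0 lE] := lebesgue_eball_gt0 (d := d) r0.
(* Local integrability speaks of compact sets, so the ball is enclosed in a closed cube. *)
pose K := [set v : 'rV[R]_d | forall i, `[(- r)%R, r]%classic (v ord0 i)].
have cK : compact K by apply: (@rV_compact _ d (fun=> `[(- r)%R, r]%classic)) => i; exact: segment_compact.
have mK : measurable K by exact: (measurable_box (fun=> measurable_itv _)).
have EK : eball (0 : 'rV[R]_d) r `<=` K.
  move=> x; rewrite mem_eball0 => xr i; rewrite /= in_itv/= -ler_norml.
  by apply: le_trans (norm_coord_le x ord0 i) _; apply: le_trans (norm_le_enorm x) (ltW xr).
have /integrableP[_ fin] := integrableS mK mE EK (locW cK).
apply: (@le_lt_trans _ _ (\int[lebesgue_rV d]_(y in eball 0%R r) (`|W y| + C%:E))).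
  apply: ge0_le_integral => //.
  - by move=> x _; exact: shifted_ge0.
  - exact: measurable_funS measurable_shifted.
  - apply: emeasurable_funD => //; apply: measurableT_comp => //.
    exact: measurable_funS mW.
  by move=> x _; apply: leeD2r; exact: lee_abs.
rewrite ge0_integralD//; last first.
- apply: measurableT_comp => //; exact: measurable_funS mW.
rewrite lte_add_pinfty// integral_cst// lte_mul_pinfty//.
by rewrite [X in X < _](_ : _ = l%:E) ?ltry//; exact: lE.
Qed.

(** Probabilities have mass one, so the shift changes all energies by the same constant and keeps
    the minimisers. *)
Lemma energy_shifted (rho : probability 'rV[R]_d R) :
  energy W rho = 2^-1%:E * (\int[rho]_x potential w rho x - C%:E).
Proof.
have P1 : rho setT = 1 by exact: probability_setT.
have mu_lty : rho setT < +oo by rewrite P1 ltry.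
rewrite /energy; congr (_ * _).
transitivity (\int[rho]_x (potential w rho x - C%:E)).
  apply: eq_integral => x _.
  transitivity (\int[rho]_y (w (x - y)%R - C%:E)).
    by apply: eq_integral => y _; rewrite /w addeK.
  rewrite integral_subC//; first by rewrite [X in _ - _ * X = _](_ : _ = 1) ?mule1//; exact: P1.
  - exact: (measurable_interaction2 measurable_shifted x).
  - by move=> y _; exact: shifted_ge0.
rewrite integral_subC//; first by rewrite [X in _ - _ * X = _](_ : _ = 1) ?mule1//; exact: P1.
- by apply: measurable_potential; [exact: shifted_ge0|exact: measurable_shifted].
- by move=> x _; apply: potential_ge0; exact: shifted_ge0.
Qed.

Lemma minimiser_shifted (rho nu : probability 'rV[R]_d R) : is_minimiser W rho ->
  \int[rho]_x potential w rho x <= \int[nu]_x potential w nu x.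
Proof.
move=> /(_ nu); rewrite !energy_shifted lee_pmul2l ?lte_fin ?invr_gt0//.
by rewrite leeD2rE.
Qed.

(** Instability enters here: it supplies a competitor of energy below +oo. *)
Lemma minimiser_shifted_fin (rho : probability 'rV[R]_d R) : is_minimiser W rho ->
  unstable W -> exists e : R, \int[rho]_x potential w rho x = e%:E.
Proof.
move=> minrho [nu nuW].
have : energy W rho < +oo.
  by apply: le_lt_trans (minrho nu) (lt_le_trans nuW (leey _)).
have : 0 <= \int[rho]_x potential w rho x.
  by apply: integral_ge0 => x _; apply: potential_ge0; exact: shifted_ge0.
rewrite energy_shifted; case: (\int[rho]_x _) => [r| |] // _; first by exists r.
by rewrite addye// gt0_muley// lte_fin invr_gt0.
Qed.

End shifted_interaction.

(** * Mass of balls under a minimiser *)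

Section ball_estimate.
Context {R : realType} {d : nat}.
Local Open Scope ereal_scope.

Lemma measurable_heat (w : 'rV[R]_d -> \bar R) (t : R) :
  (forall x, 0 <= w x) -> measurable_fun setT w -> measurable_fun setT (heat t w).
Proof.
move=> w0 mw.
have mf : measurable_fun setT (fun p : 'rV[R]_d * 'rV[R]_d =>
    w (p.1 + Num.sqrt t *: p.2)%R * (heat_kernel 1 p.2)%:E).
  apply: emeasurable_funM; last exact: (measurableT_comp (measurable_heat_kernel 1) measurable_snd).
  apply: (measurableT_comp mw); apply: measurable_fun_mx => i j.
  under eq_fun do rewrite !mxE.
  apply: measurable_funD.
    exact: (measurableT_comp (coord_measurable_mx i j) measurable_fst).
  apply: measurable_funM => //.
  exact: (measurableT_comp (coord_measurable_mx i j) measurable_snd).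
apply: (measurable_fun_fubini_tonelli_F (m2 := lebesgue_rV d) _ mf) => p.
by rewrite mule_ge0// lee_fin heat_kernel_ge0.
Qed.

Variables (W : 'rV[R]_d -> \bar R) (C : R).
Hypothesis C0 : (0 <= C)%R.
Hypothesis WC : forall x, (- C)%:E <= W x.
Hypothesis scW : lower_semicontinuous W.
Hypothesis locW : locally_integrable_rV W.
Hypothesis WN : forall x, W (- x)%R = W x.
Hypothesis d0 : (0 < d)%N.
Local Notation w := (shifted W C).

Lemma shiftedN x : w (- x)%R = w x.
Proof. by rewrite /shifted WN. Qed.

Variables (beta delta Crep CW : R).
Hypothesis beta0 : (0 < beta)%R.
Hypothesis Crep0 : (0 < Crep)%R.
Hypothesis CW0 : (0 < CW)%R.
Hypothesis repW : forall x, (0 < enorm x < delta)%R ->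
  (Crep * enorm x `^ (- beta))%:E <= - gen_laplacian0 W x.
Hypothesis rep0 : - gen_laplacian0 W 0%R = +oo.
Hypothesis lapW : forall x, gen_laplacian0 W x <= CW%:E.

Variable rho : probability 'rV[R]_d R.
Hypothesis minrho : is_minimiser W rho.
Variable e : R.
Hypothesis rhoe : \int[rho]_x potential w rho x = e%:E.

Let w0 := shifted_ge0 WC.
Let mw := measurable_shifted C scW.
Let minw nu := minimiser_shifted C0 WC scW nu minrho.
Let locw := shifted_integral_eball_lty C0 WC scW locW.

Lemma minimiser_small_ball_le (r : R) x : (0 < r)%R -> (2 * r <= delta)%R ->
  potential w rho x <= e%:E ->
  rho (eball x r) <= (8 / 3 * CW / (Crep * (2 * r) `^ (- beta)))%:E.
Proof.
move=> r0 r2 xe; set A := (Crep * _)%R.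
have A0 : (0 < A)%R by rewrite mulr_gt0// powR_gt0// mulr_gt0.
pose a := barrier beta Crep CW r : 'rV[R]_d -> R.
pose B := ((A + CW) / (2 * r) ^+ 2 * (d%:R * @usig R d))%R.
have B0 : (0 < B)%R.
  apply: mulr_gt0; last by apply: mulr_gt0; [rewrite ltr0n|exact: usig_gt0].
  by apply: divr_gt0; [exact: addr_gt0|rewrite exprn_gt0// mulr_gt0].
pose lam : R := @heat_speed R d.
have lam0 : (0 < lam)%R by apply: heat_speed_gt0; exact: usig_gt0.
pose kap : R := (2 * (d + 2))%:R.
have kap0 : (0 < kap)%R by rewrite ltr0n addn2.
(* With this choice a + 2 eta + A is exactly the nonnegative function [g] below. *)
pose eta : R := (CW / 2)%R.
have eta0 : (0 < eta)%R by rewrite divr_gt0.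
(* The time for which the smallness condition of [heat_comparison] is an equality. *)
pose t : R := (eta / 2 / (kap * (lam * B)))%R.
have t0 : (0 < t)%R by apply: divr_gt0; [exact: divr_gt0|do 2!apply: mulr_gt0 => //].
pose k : R := (lam * t)%R.
have k0 : (0 < k)%R by rewrite mulr_gt0.
have small : (kap * (lam * t * B) <= eta / 2)%R.
  rewrite (_ : _ * _ = eta / 2)%R//.
  by rewrite /t; field; rewrite !gt_eqF.
pose g y : R := (a (x - y)%R + A + CW)%R.
have g0 y : (0 <= g y)%R.
  by apply: addr_ge0; [exact: barrierDA_ge0|exact: ltW].
have mxy : measurable_fun setT (fun y : 'rV[R]_d => (x - y)%R).
  by have := measurable_rV_translate (-1)%R x; under eq_fun do rewrite scaleN1r.
have mg : measurable_fun setT (fun y : 'rV[R]_d => (g y)%:E).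
  apply: (measurableT_comp _ mxy (f := fun z : 'rV[R]_d => (a z + A + CW)%:E)).
  apply/measurable_EFinP; do 2!apply: measurable_funD => //.
  by apply: continuous_measurable_mx; exact: continuous_barrier.
have hw y : heat t w (x - y)%R + (k * A)%:E <= w (x - y)%R + (k * g y)%:E.
  have := @heat_comparison R d W C C0 WC scW (usig_gt0 d0) a A B
    (@continuous_barrier R d beta Crep CW r) (ltW A0)
    (barrierDA_ge0 beta Crep0 CW0 r0) (ltW B0)
    (mean_sub_barrier beta Crep0 CW0 r0 d0)
    (gen_laplacian0_le_barrier beta0 Crep0 CW0 r0 r2 repW rep0 lapW)
    eta t (x - y)%R eta0 (ltW t0) small.
  move=> /(leeD2r (k * A)%:E) /le_trans; apply.
  rewrite -addeA -EFinD; apply: leeD2l; rewrite lee_fin /g -/lam -/k -mulrDr.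
  by rewrite ler_pM2l// /eta; lra.
have rho1 (c : R) : \int[rho]_y (cst c%:E y) = c%:E.
  rewrite integral_cst//= [X in _ * X](_ : _ = 1) ?mule1//; exact: probability_setT.
have mh : measurable_fun setT (fun y : 'rV[R]_d => heat t w (x - y)%R).
  exact: (measurableT_comp (measurable_heat t w0 mw) mxy).
have h0 y : 0 <= heat t w y.
  by apply: integral_ge0 => z _; rewrite mule_ge0// lee_fin heat_kernel_ge0.
have kA0 : (0 <= k * A)%R by apply: mulr_ge0; exact: ltW.
have mwx := measurable_interaction2 mw x.
have kg0 y : 0 <= (k * g y)%:E by rewrite lee_fin mulr_ge0// ltW.
have mkg : measurable_fun setT (fun y : 'rV[R]_d => (k * g y)%:E).
  by under eq_fun do rewrite EFinM; exact: measurable_funeM.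
(* The comparison integrated against rho. As the potential at x is at most e, it yields A <= int
   g. *)
have int1 : e%:E + (k * A)%:E <= potential w rho x + k%:E * \int[rho]_y (g y)%:E.
  apply: (@le_trans _ _ (\int[rho]_y (heat t w (x - y)%R + cst (k * A)%:E y))).
    rewrite ge0_integralDT; [|exact: mh|exact: measurable_cst|by move=> y|by move=> y; rewrite lee_fin].
    rewrite rho1 -heat_potentialE; [|exact: w0|exact: mw].
    by apply: leeD2r; apply: (heat_potential_ge w0 mw shiftedN minw rhoe locw).
  apply: (@le_trans _ _ (\int[rho]_y (w (x - y)%R + (k * g y)%:E))).
    apply: ge0_le_integralT => //.
    - by apply: emeasurable_funD => //; exact: measurable_cst.
    - exact: emeasurable_funD.
    - by move=> y; rewrite adde_ge0// lee_fin.
  rewrite ge0_integralDT; [|exact: mwx|exact: mkg|by move=> y; exact: w0|exact: kg0].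
  under [X in _ + X]eq_integral do rewrite EFinM.
  rewrite ge0_integralZT; [by []|exact: ltW|exact: mg|by move=> y; rewrite lee_fin].
(* The gap between the global bound 2 CW + A on g and its bound (A + CW)/4 + CW on the ball. *)
pose c : R := (3 / 4 * (A + CW))%R.
have c0 : (0 <= c)%R by rewrite /c mulr_ge0// ?divr_ge0// addr_ge0 ?ltW.
pose E := eball x r.
have mE : measurable E by exact: measurable_eball.
have ball_arith (K L u : R) :
    (u + K <= (K + L) / 4 -> u + K + L + 3 / 4 * (K + L) <= 2 * L + K)%R by lra.
have int2 : \int[rho]_y (g y)%:E + c%:E * rho E <= (2 * CW + A)%:E.
  have mi : measurable_fun setT (fun y : 'rV[R]_d => (\1_E y : R)%:E).
    by apply/measurable_EFinP; exact: measurable_indic.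
  have i0 (y : 'rV[R]_d) : 0 <= (\1_E y : R)%:E by rewrite lee_fin.
  have -> : c%:E * rho E = \int[rho]_y (c%:E * (\1_E y : R)%:E).
    by rewrite ge0_integralZT// integral_indic// setIT.
  rewrite -ge0_integralDT; [|exact: mg|exact: measurable_funeM|by move=> y; rewrite lee_fin|
    by move=> y; rewrite mule_ge0// lee_fin].
  rewrite -(rho1 (2 * CW + A)%R); apply: ge0_le_integralT.
  - by apply: emeasurable_funD => //; exact: measurable_funeM.
  - exact: measurable_cst.
  - by move=> y; rewrite adde_ge0// ?mule_ge0// lee_fin.
  move=> y; rewrite /= -EFinM -EFinD lee_fin indicE.
  have [|_] := boolP (y \in E); last first.
    by rewrite mulr0 addr0 /g; have := barrier_le beta Crep CW r (x - y)%R; rewrite -/a; lra.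
  rewrite inE /E /eball /= -enormN opprB => xy.
  have := barrier_ball_le beta Crep0 CW0 r0 xy; rewrite -/A -/(a _) /g /c mulr1.
  exact: ball_arith.
(* A <= G leaves 3/4 (A + CW) rho(E) <= 2 CW, whence the factor 8/3. *)
have final_arith (K L G v : R) : (G + 3 / 4 * (K + L) * v <= 2 * L + K -> K <= G ->
    0 <= v * L -> v * K <= 8 / 3 * L)%R by lra.
have [p pE] : exists p : R, rho E = p%:E.
  by exists (fine (rho E)); rewrite fineK//; exact: fin_num_measure.
have p0 : (0 <= p)%R by rewrite -lee_fin -pE measure_ge0.
have G0 : 0 <= \int[rho]_y (g y)%:E by apply: integral_ge0 => y _; rewrite lee_fin.
rewrite -/E pE lee_fin; move: int1 int2 G0; rewrite pE.
case: (\int[rho]_y (g y)%:E) => [G| |]//.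
move: xe (potential_ge0 w0 rho x); case: (potential w rho x) => [q| |]//.
rewrite -!(EFinM, EFinD) !lee_fin => qe _ i1 i2 _.
have AG : (A <= G)%R by rewrite -(ler_pM2l k0) -(lerD2l e); apply: le_trans i1 _; rewrite lerD2r.
rewrite ler_pdivlMr//.
have pC : (0 <= p * CW)%R by rewrite mulr_ge0// ltW.
exact: final_arith i2 AG pC.
Qed.

(** The first summand serves radii with 2r <= delta, where the repulsion is available; the second
    serves the larger ones. *)
Definition morrey_bound : R := (8 / 3 * CW / Crep * 2 `^ beta + (2 / delta) `^ beta)%R.

Hypothesis delta0 : (0 < delta)%R.

Lemma morrey_bound_gt0 : (0 < morrey_bound)%R.
Proof.
apply: addr_gt0; last by rewrite powR_gt0// divr_gt0.
by apply: mulr_gt0; [rewrite divr_gt0// mulr_gt0// divr_gt0|rewrite powR_gt0].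
Qed.

Lemma minimiser_centred_ball_le (r : R) x : (0 < r)%R -> potential w rho x <= e%:E ->
  rho (eball x r) <= (morrey_bound * r `^ beta)%:E.
Proof.
move=> r0 xe; have [r2|r2] := leP (2 * r)%R delta.
  apply: le_trans (minimiser_small_ball_le r0 r2 xe) _; rewrite lee_fin.
  have -> : (8 / 3 * CW / (Crep * (2 * r) `^ (- beta)) =
      8 / 3 * CW / Crep * 2 `^ beta * r `^ beta)%R.
    by rewrite powRN invfM invrK powRM ?ltW// !mulrA.
  by rewrite ler_wpM2r// ?powR_ge0// lerDl powR_ge0.
(* For 2r > delta the total mass 1 is already at most (2r / delta)^beta. *)
apply: (@le_trans _ _ 1); first by apply: probability_le1; exact: measurable_eball.
have d2r : (1 <= 2 / delta * r)%R.
  by rewrite mulrAC ler_pdivlMr// mul1r ltW.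
rewrite lee_fin mulrDl -powRM; [|by rewrite divr_ge0// ltW|exact: ltW].
apply: (@le_trans _ _ ((2 / delta * r) `^ beta)%R).
  have := @ge0_ler_powR R beta (ltW beta0) 1%R (2 / delta * r)%R; rewrite powR1.
  by apply; rewrite ?nnegrE; [exact: ler01|exact: le_trans ler01 d2r|exact: d2r].
rewrite lerDr; apply: mulr_ge0; last exact: powR_ge0.
apply: mulr_ge0; last exact: powR_ge0.
by apply: divr_ge0; [apply: mulr_ge0; [rewrite divr_ge0|exact: ltW]|exact: ltW].
Qed.

Lemma minimiser_ball_le (r : R) z : (0 < r)%R ->
  rho (eball z r) <= (2 `^ beta * morrey_bound * r `^ beta)%:E.
Proof.
move=> r0; have mE : measurable (eball z r) by exact: measurable_eball.
have [[x [zx xe]]|nex] := pselect (exists x, eball z r x /\ potential w rho x <= e%:E).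
  have r20 : (0 < 2 * r)%R by rewrite mulr_gt0.
  have := minimiser_centred_ball_le r20 xe.
  rewrite powRM; [|by []|exact: ltW]; rewrite mulrA [(_ * 2 `^ _)%R]mulrC.
  apply: le_trans; apply: le_measure; rewrite ?inE//; first exact: measurable_eball.
  move=> y; rewrite /eball /= in zx * => zy.
  rewrite -(subrKA z y) addrC.
  apply: le_lt_trans (ler_enormD _ _) _; rewrite mulr_natl mulr2n; apply: ltrD => //.
  by rewrite -enormN opprB.
have mP : measurable [set x | e%:E < potential w rho x].
  rewrite (_ : [set x | _] = ~` [set x | potential w rho x <= e%:E]).
    by apply: measurableC; exact: measurable_potential_le.
  by apply/seteqP; split => x /= => [|/negP]; rewrite ltNge => // /negP.
apply: (@le_trans _ _ 0); last first.
  by rewrite lee_fin !mulr_ge0 ?powR_ge0// ltW// morrey_bound_gt0.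
rewrite -(rho_potential_gt w0 mw shiftedN minw rhoe); apply: le_measure; rewrite ?inE//.
move=> x zx /=; rewrite ltNge; apply/negP => xe; apply: nex; exists x; split=> //.
Qed.

End ball_estimate.

Section morrey_of_ball_bound.
Context {R : realType} {d : nat}.
Local Open Scope ereal_scope.

Lemma morrey_of_ball_le (rho : probability 'rV[R]_d R) (beta M : R) : (0 < beta < d%:R)%R ->
  (0 < M)%R -> (forall (r : R) z, (0 < r)%R -> rho (eball z r) <= (M * r `^ beta)%:E) ->
  let p : \bar R := (d%:R / (d%:R - beta))%:E in
  morrey p (charge_of_finite_measure rho) /\
  morrey_norm p (charge_of_finite_measure rho) <= M%:E.
Proof.
move=> betad M0 rhoM p; rewrite /morrey /morrey_norm (morrey_exponentE betad).
have le r z : (0 < r)%R ->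
    charge_total_variation (charge_of_finite_measure rho) (eball z r) <= (M * r `^ beta)%:E.
  move=> r0; apply: le_trans (rhoM r z r0).
  by apply: charge_total_variation_le; exact: measurable_eball.
split; first by exists M.
apply: ub_ereal_sup => _ [r [z [r0 ->]]].
apply: le_trans (lee_wpmul2l _ (le r z r0)) _; first by rewrite lee_fin powR_ge0.
by rewrite -EFinM lee_fin powRN mulrC mulfK// gt_eqF// powR_gt0.
Qed.

End morrey_of_ball_bound.

Theorem theorem3p2 (R : realType) (d : nat) (W : 'rV[R]_d -> \bar R) (beta : R) :
  (1 <= d)%N ->
  lower_semicontinuous W ->
  (exists c : R, forall x, (c%:E <= W x)%E) ->
  locally_integrable_rV W ->
  (forall x, W (- x) = W x) ->
  cvg (W @ at_infinity) ->
  (exists2 RW : R, 0 < RW & radially_strictly_increasing W RW) ->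
  unstable W ->
  0 < beta < d%:R ->
  repulsive beta W ->
  (exists2 CW : R, 0 < CW & forall x, (gen_laplacian0 W x <= CW%:E)%E) ->
  exists2 C' : R, 0 < C' &
    forall rho : probability 'rV[R]_d R, is_minimiser W rho ->
      let p : \bar R := (d%:R / (d%:R - beta))%:E in
      morrey p (charge_of_finite_measure rho) /\
      (morrey_norm p (charge_of_finite_measure rho) <= (2 `^ beta * C')%:E)%E.
Proof.
move=> d0 scW [c cW] locW WN _ _ unstW betad [_ [delta [Crep [delta0 Crep0 repW rep0]]]].
move=> [CW CW0 lapW]; have /andP[beta0 _] := betad.
(* The lower bound is put in the form -C with C >= 0. *)
pose C := Num.max 0 (- c).
have C0 : 0 <= C by rewrite le_max lexx.
have WC x : ((- C)%:E <= W x)%E.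
  by apply: le_trans (cW x); rewrite lee_fin lerNl le_max lexx orbT.
have K0 := morrey_bound_gt0 beta Crep0 CW0 delta0.
(* The constant is fixed before rho and is built only from beta and the data delta, Crep, CW of
   W. *)
exists (morrey_bound beta delta Crep CW) => // rho minrho.
have [e rhoe] := minimiser_shifted_fin C0 WC scW minrho unstW.
apply: morrey_of_ball_le => //; first by rewrite mulr_gt0// powR_gt0.
move=> r z r0.
exact: (minimiser_ball_le C0 WC scW locW WN d0 beta0 Crep0 CW0 repW rep0 lapW minrho rhoe delta0 z r0).
Qed.
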